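(* Let the coefficients $f,\kappa,\sigma$ satisfy the assumptions (A1) and (A2) listed in the context, and let $x_t$ and $X_t^{\varepsilon,\delta}$ be the solutions of $$\frac{dx_t}{dt}=f(x_t)+\kappa(x_t),\quad x(0)=x_0,\qquad dX_t^{\varepsilon,\delta}=\{f(X_t^{\varepsilon,\delta})+\kappa(X_{\pi_\delta(t)}^{\varepsilon,\delta})\}\,dt+\varepsilon\sigma(X_t^{\varepsilon,\delta})\,dW_t,\quad X_0^{\varepsilon,\delta}=x_0 .$$ Then for every integer $p\ge 1$ there exists a constant $C>0$, independent of time $t$ and of $\varepsilon,\delta$, such that for all sufficiently small $\varepsilon,\delta>0$, $$\sup_{t\ge 0}\mathbb E\left[|X_t^{\varepsilon,\delta}-x_t|^p\right]\le C\left(\delta^p+\varepsilon^p+\delta^{p/2}\varepsilon^p\right).$$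
   Context: $f,\kappa,\sigma:\mathbb R\to\mathbb R$ are functions, $x_0\in\mathbb R$ is deterministic, $W=\{W_t:t\ge0\}$ is a standard one-dimensional Brownian motion on a probability space $(\Omega,\mathscr F,\mathbb P)$, and $\pi_\delta(t)=\delta\lfloor t/\delta\rfloor$ for $\delta>0$, $t\ge 0$. It is assumed that the coefficients are such that the SDE for $X^{\varepsilon,\delta}$ has a unique, at least weak, solution. (A1) There exist positive numbers $q,\xi,\mu$ and Lipschitz constants $L_\kappa,L_\sigma$ such that for all $x,y\in\mathbb R$: $|f(x)-f(y)|\le[\xi(|x|^q+|y|^q)+\mu]|x-y|$, $|\kappa(x)-\kappa(y)|\le L_\kappa|x-y|$, $|\sigma(x)-\sigma(y)|\le L_\sigma|x-y|$. Moreover there is $\lambda>0$ such that $(x-y)(f(x)-f(y))\le-\lambda|x-y|^2$ for all $x,y\in\mathbb R$, and $\frac{\lambda}{2}-L_\kappa>0$. (A2) There exists $\gamma<\infty$ such that $|\sigma(x)|+|\kappa(x)|\le\gamma$ for all $x\in\mathbb R$. The constant $C$ may depend on $p$, $x_0$ and the coefficients, but not on $t,\varepsilon,\delta$. *)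

(* Defs.v *)
From HB Require Import structures.
From mathcomp Require Import all_boot all_order all_algebra.
From mathcomp Require Import all_classical all_reals all_analysis.

Set Implicit Arguments.
Unset Strict Implicit.
Unset Printing Implicit Defensive.

Import Order.TTheory GRing.Theory Num.Theory.
Import numFieldNormedType.Exports.

Local Open Scope classical_set_scope.
Local Open Scope ring_scope.

Section coefficients.
Context {R : realType}.

Definition assumption_A1 (f kappa sigma : R -> R) : Prop :=
  exists q xi mu Lk Ls lambda : R,
    [/\ [/\ 0 < q, 0 < xi & 0 < mu],
        forall x y, `|f x - f y| <=
          (xi * (`|x| `^ q + `|y| `^ q) + mu) * `|x - y|,
        (forall x y, `|kappa x - kappa y| <= Lk * `|x - y|) /\
        (forall x y, `|sigma x - sigma y| <= Ls * `|x - y|),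
        0 < lambda /\
        (forall x y, (x - y) * (f x - f y) <= - lambda * `|x - y| ^+ 2)
      & 0 < lambda / 2 - Lk].

Definition assumption_A2 (kappa sigma : R -> R) : Prop :=
  exists gamma : R, forall x, `|sigma x| + `|kappa x| <= gamma.

(* The derivative at the endpoint 0 is the right derivative; by continuity of
   the right-hand side it is determined by the equation on t > 0 together with
   continuity of x on [0, +oo[. *)
Definition ode_solution (f kappa : R -> R) (x0 : R) (x : R -> R) : Prop :=
  [/\ x 0 = x0,
      {within `[0, +oo[, continuous x}
    & forall t : R, 0 < t -> is_derive t 1 x (f (x t) + kappa (x t))].

Definition grid_time (delta t : R) : R := delta * (Num.floor (t / delta))%:~R.

End coefficients.

(* Processes are functions R -> T -> R, and filtrations functions
   R -> set (set T), of which only the values at times t >= 0 are relevant. *)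
Section processes.
Context {R : realType} {d : measure_display} {T : measurableType d}.
Variables (P : probability T R) (F : R -> set (set T)).

Definition is_filtration : Prop :=
  [/\ forall t, 0 <= t -> sigma_algebra setT (F t),
      forall t, 0 <= t -> F t `<=` measurable
    & forall s t : R, 0 <= s -> s <= t -> F s `<=` F t].

Definition measurable_wrt (G : set (set T)) (Y : T -> R) : Prop :=
  forall B : set R, measurable B -> G (Y @^-1` B).

Definition adapted (X : R -> T -> R) : Prop :=
  forall t, 0 <= t -> measurable_wrt (F t) (X t).

Definition brownian_motion (W : R -> T -> R) : Prop :=
  [/\ adapted W,
      {ae P, forall w, W 0 w = 0},
      {ae P, forall w, {within `[0, +oo[, continuous (fun t => W t w)}},
      forall s t : R, 0 <= s -> s < t -> forall B : set R, measurable B ->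
        P ((fun w => W t w - W s w) @^-1` B) =
        normal_prob 0 (Num.sqrt (t - s)) B
    & forall s t : R, 0 <= s -> s < t ->
        forall (A : set T) (B : set R), F s A -> measurable B ->
        P (A `&` (fun w => W t w - W s w) @^-1` B) =
        (P A * P ((fun w => W t w - W s w)%R @^-1` B))%E].

(* \sum_i xi_i 1_{]t_i, t_(i+1)]} on [0, t], with 0 = t_0 <= ... <= t_n = t
   and xi_i bounded and F_(t_i)-measurable. *)
Record simple_process (t : R) := SimpleProcess {
  sp_size : nat;
  sp_time : nat -> R;
  sp_coef : nat -> T -> R;
  sp_time_first : sp_time 0 = 0;
  sp_time_last : sp_time sp_size = t;
  sp_time_le : forall i, (i < sp_size)%N -> sp_time i <= sp_time i.+1;
  sp_coef_adapted : forall i, (i < sp_size)%N ->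
    measurable_wrt (F (sp_time i)) (sp_coef i);
  sp_coef_bounded : forall i, (i < sp_size)%N ->
    exists K : R, forall w, `|sp_coef i w| <= K }.

Definition sp_value (t : R) (h : simple_process t) (s : R) (w : T) : R :=
  \sum_(i < sp_size h)
    sp_coef h i w * \1_`]sp_time h i, sp_time h i.+1] s.

Definition sp_integral (W : R -> T -> R) (t : R) (h : simple_process t)
    (w : T) : R :=
  \sum_(i < sp_size h)
    sp_coef h i w * (W (sp_time h i.+1) w - W (sp_time h i) w).

(* Y is a version of the Ito integral of H with respect to W over [0, t]: the
   L^2(P) limit of the integrals of simple processes converging to H in
   L^2(ds x P).  This is the square-integrable theory, which is all that is
   needed for a bounded diffusion coefficient. *)
Definition is_ito_integral (W H : R -> T -> R) (t : R) (Y : T -> R) : Prop :=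
  measurable_fun setT Y /\
  exists h : nat -> simple_process t,
    (fun n => \int[P]_w \int[lebesgue_measure]_(s in `[0%R, t])
        ((sp_value (h n) s w - H s w) ^+ 2)%R%:E)%E @ \oo --> 0%E /\
    (fun n => 'E_P[fun w => ((sp_integral W (h n) w - Y w) ^+ 2)%R])%E
      @ \oo --> 0%E.

(* (T, F, P, W, X) is a weak solution of
   dX_t = (f(X_t) + kappa(X_(grid_time delta t))) dt + eps sigma(X_t) dW_t,
   X_0 = x0. *)
Definition weak_solution (f kappa sigma : R -> R) (x0 eps delta : R)
    (W X : R -> T -> R) : Prop :=
  [/\ is_filtration,
      brownian_motion W,
      adapted X /\
      (forall w, {within `[0, +oo[, continuous (fun t => X t w)}),
      {ae P, forall w, X 0 w = x0}
    & forall t, 0 <= t -> exists2 I : T -> R,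
        is_ito_integral W (fun s w => sigma (X s w)) t I &
        {ae P, forall w, X t w = x0 +
          (\int[lebesgue_measure]_(s in `[0%R, t])
             (f (X s w) + kappa (X (grid_time delta s) w)))
          + eps * I w}].

End processes.

(* Equality of all finite-dimensional distributions, i.e. of the laws on the
   space of continuous paths. *)
Definition same_law {R : realType} {d d' : measure_display}
    {T : measurableType d} {T' : measurableType d'}
    (P : probability T R) (P' : probability T' R)
    (X : R -> T -> R) (X' : R -> T' -> R) : Prop :=
  forall (n : nat) (t : 'I_n -> R) (B : 'I_n -> set R),
    (forall i, 0 <= t i) -> (forall i, measurable (B i)) ->
    P [set w | forall i, B i (X (t i) w)] =
    P' [set w | forall i, B i (X' (t i) w)].

Definition unique_weak_solution {R : realType} (f kappa sigma : R -> R)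
    (x0 eps delta : R) : Prop :=
  (exists (d : measure_display) (T : measurableType d) (P : probability T R)
          (F : R -> set (set T)) (W X : R -> T -> R),
     weak_solution P F f kappa sigma x0 eps delta W X) /\
  (forall (d d' : measure_display) (T : measurableType d)
          (T' : measurableType d') (P : probability T R)
          (P' : probability T' R)
          (F : R -> set (set T)) (F' : R -> set (set T'))
          (W X : R -> T -> R) (W' X' : R -> T' -> R),
     weak_solution P F f kappa sigma x0 eps delta W X ->
     weak_solution P' F' f kappa sigma x0 eps delta W' X' ->
     same_law P P' X X').

(* Main.v *)
(** Let [I_t] be the Ito integral of [sigma(X)] over [0, t] and
    [N_t = X_t - x0 - \int_0^t (f(X_s) + kappa(X_(pi(s)))) ds], which is
    [eps I_t] almost surely.  A bounded integrand makes the increments of [I]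
    sub-Gaussian: on a common refinement of the partitions of the simple
    processes approximating [I_t] and [I_s], freezing the past at each node
    bounds the exponential moments of the sums with clamped coefficients, and
    the moment bounds pass to the L^2 limit, so that
    [E |N_t - N_s|^p <= C eps^p (t - s)^(p/2)].

    Instead of the Ito formula, use
    [Z_t = N_t - lambda \int_0^t e^(-lambda (t - s)) N_s ds], the solution of
    [dZ = dN - lambda Z dt]; its moments are of order [eps^p] uniformly in time.
    Off the grid, [Y = X - x - Z] satisfies the pathwise equation
    [Y' = f(x + Z + Y) - f(x) + kappa(X_pi) - kappa(x) + lambda Z], and the
    dissipativity of [f] gives
    [|Y_t| <= \int_0^t e^(-lambda (t - s)) (|f(x_s + Z_s) - f(x_s)| +
       lambda |Z_s| + |kappa(X_(pi(s))) - kappa(x_s)|) ds].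
    By Jensen's inequality and Tonelli's theorem, with [2 L_kappa < lambda], the
    supremum [M] of the [p]-th moments of the error satisfies
    [M <= (M + C (eps^p + delta^p)) / 2]. *)

Require Import Defs.
From HB Require Import structures.
From mathcomp Require Import all_boot all_order all_algebra.
From mathcomp Require Import all_classical all_reals all_analysis.
From mathcomp Require Import measurable_realfun ring lra.

Set Implicit Arguments.
Unset Strict Implicit.
Unset Printing Implicit Defensive.

Import Order.TTheory GRing.Theory Num.Theory.
Import numFieldNormedType.Exports.

Local Open Scope classical_set_scope.
Local Open Scope ring_scope.

(** A weak solution supplies an Ito integral for each time separately, as an L^2 limit and up to a
    null set. The stochastic part is therefore confined to one estimate on increments between two
    fixed times. [N] is defined path by path, is continuous for every [w], and all that follows is
    calculus on single paths. [Z] is subtracted because [X - x] need not be differentiable in time;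
    in [X - x - Z] the rough part cancels.

    The approximating simple processes need not obey the bound on [sigma]. Clamping restores it
    without increasing the distance to [sigma(X)], and truncation at a fixed level lets L^2
    convergence carry higher moments.

    The inequality for [M] is informative only if [M] is finite; the boundedness of [kappa] gives
    this. Its half comes from (a + b)^p <= ((2a)^p + (2b)^p) / 2: the ratio L_kappa / lambda, below
    one half, is doubled to at most one, and the weights have mass at most one. *)

Lemma eq_lexx (disp : Order.disp_t) (T : porderType disp) (a b : T) :
  a = b -> (a <= b)%O.
Proof. by move=> ->. Qed.

(** * Gaussian integrals *)

Section normal.
Context {R : realType}.
Local Notation mu := (@lebesgue_measure R).

Import HBNNSimple.

(* [normal_prob] is a measure on [measurableTypeR R], whose display differs from
   that of [R]. *)
Definition gauss (s : R) (A : set R) : \bar R := normal_prob 0 s A.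

Section gauss_measure.
Variable s : R.

Let gauss0 : gauss s set0 = 0%E.
Proof. exact: (@measure0 _ _ _ (normal_prob 0 s)). Qed.

Let gauss_ge0 A : (0 <= gauss s A)%E.
Proof. exact: (@measure_ge0 _ _ _ (normal_prob 0 s)). Qed.

Let gauss_sigma_additive : semi_sigma_additive (gauss s).
Proof. exact (@measure_semi_sigma_additive _ _ _ (normal_prob 0 s)). Qed.

HB.instance Definition _ := isMeasure.Build _ _ _
  (gauss s) gauss0 gauss_ge0 gauss_sigma_additive.

Let gauss_setT : gauss s [set: _] = 1%E.
Proof. exact: (@probability_setT _ _ _ (normal_prob 0 s)). Qed.

HB.instance Definition _ :=
  @Measure_isProbability.Build _ _ R (gauss s) gauss_setT.

End gauss_measure.

(** For an indicator this is how [normal_prob] is defined from its density; linearity reaches simple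
    functions, and both sides are monotone limits along [nnsfun_approx]. *)
Lemma ge0_integral_gauss (s : R) (f : R -> \bar R) :
  measurable_fun setT f -> (forall x, 0 <= f x)%E ->
  (\int[gauss s]_x f x =
   \int[mu]_x (f x * (normal_pdf 0 s x)%:E))%E.
Proof.
move=> mf f0.
have mp : measurable_fun setT (fun x : R => (normal_pdf 0 s x)%:E).
  by apply/measurable_EFinP; exact: measurable_normal_pdf.
have p0 x : (0 <= (normal_pdf 0 s x)%:E)%E by rewrite lee_fin normal_pdf_ge0.
have nnE (g : {nnsfun R >-> R}) :
    (\int[gauss s]_x (g x)%:E =
     \int[mu]_x ((g x)%:E * (normal_pdf 0 s x)%:E))%E.
  have mg r : measurable_fun setT (fun x : R => (r * \1_(g @^-1` [set r]) x)%:E).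
    by apply/measurable_EFinP; apply/measurableT_comp.
  have mi r : measurable_fun setT (fun x : R => (\1_(g @^-1` [set r]) x)%:E).
    by apply/measurable_EFinP.
  under [LHS]eq_integral do rewrite fimfunE -fsumEFin//.
  rewrite [LHS]ge0_integral_fsum//; last first.
    by move=> n x _; rewrite EFinM nnfun_muleindic_ge0.
  under [RHS]eq_integral.
    move=> x xD; rewrite fimfunE -fsumEFin// ge0_mule_fsuml; last first.
      by move=> r; rewrite EFinM nnfun_muleindic_ge0.
    over.
  rewrite [RHS]ge0_integral_fsum//; last 2 first.
  - move=> r; apply: emeasurable_funM => //; exact: mg.
  - by move=> n x _; rewrite EFinM mule_ge0// nnfun_muleindic_ge0.
  apply: eq_fsbigr => r _.
  rewrite integralZl_indic_nnsfun//= integral_indic//= setIT.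
  under [RHS]eq_integral do rewrite EFinM -muleA.
  have [r0|r0] := leP 0 r; last first.
    rewrite preimage_nnfun0// /gauss /normal_prob integral_set0 mule0.
    under eq_integral do rewrite indic0 mul0e mule0.
    by rewrite integral0.
  rewrite ge0_integralZl//; last 2 first.
  - by apply: emeasurable_funM => //; exact: mi.
  - by move=> x _; rewrite mule_ge0// lee_fin.
  congr (_ * _)%E.
  rewrite /gauss /normal_prob [LHS]integral_mkcond/=; apply: eq_integral => x _.
  rewrite patchE indicE; case: ifPn => _; first by rewrite mul1e.
  by rewrite mul0e.
pose f_ := nnsfun_approx measurableT mf.
have nd x : {homo (fun n => (f_ n x)%:E) : m n / (m <= n)%N >-> (m <= n)%E}.
  by move=> m n mn; rewrite lee_fin; exact/lefP/nd_nnsfun_approx.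
have mf_ n : measurable_fun setT (fun x : R => (f_ n x)%:E).
  by apply/measurable_EFinP.
transitivity (lim (\int[gauss s]_x (f_ n x)%:E @[n --> \oo])%E).
  rewrite -monotone_convergence//=.
  - apply: eq_integral => ? /[!inE] xD; apply/esym/cvg_lim => //=.
    exact: cvg_nnsfun_approx.
  - by move=> n ? _; rewrite lee_fin.
transitivity
    (lim (\int[mu]_x ((f_ n x)%:E * (normal_pdf 0 s x)%:E) @[n --> \oo])%E).
  by apply: congr_lim; apply/funext => n; exact: nnE.
rewrite -monotone_convergence//=.
- apply: eq_integral => x /[!inE] xD; apply/cvg_lim => //.
  apply: cvgeZr; first by rewrite fin_numE.
  exact: cvg_nnsfun_approx.
- by move=> n; apply: emeasurable_funM => //; exact: mf_.
- by move=> n ? _; rewrite mule_ge0// lee_fin.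
- by move=> ? _ ? ? mn; rewrite lee_wpmul2r//; exact: nd.
Qed.

(** Completing the square: [expR (a * y)] times the centred density is [expR (a ^+ 2 * s ^+ 2 / 2)]
    times the density with mean [a * s ^+ 2], whose integral is one. *)
Lemma gauss_mgf (s a : R) : s != 0 ->
  (\int[gauss s]_y (expR (a * y))%:E = (expR (a ^+ 2 * s ^+ 2 / 2))%:E)%E.
Proof.
move=> s0.
have me : measurable_fun setT (fun y : R => expR (a * y)).
  by apply: measurableT_comp => //; exact: measurable_funM.
rewrite ge0_integral_gauss; last 2 first.
- exact/measurable_EFinP.
- by move=> x; rewrite lee_fin expR_ge0.
have mp : measurable_fun setT (fun y : R => (normal_pdf (a * s ^+ 2) s y)%:E).
  by apply/measurable_EFinP; exact: measurable_normal_pdf.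
transitivity (\int[mu]_x ((expR (a ^+ 2 * s ^+ 2 / 2))%:E *
   (normal_pdf (a * s ^+ 2) s x)%:E))%E.
  apply: eq_integral => x _; rewrite -!EFinM; congr EFin.
  rewrite !normal_pdfE// /normal_fun mulrCA [RHS]mulrCA; congr (_ * _).
  rewrite -!expRD; congr expR.
  by field.
rewrite ge0_integralZl//; last first.
  by move=> x _; rewrite lee_fin normal_pdf_ge0.
by rewrite integral_normal_pdf mule1.
Qed.

Lemma gauss_opp (s : R) (f : R -> \bar R) : s != 0 ->
  measurable_fun setT f -> (forall x, 0 <= f x)%E ->
  (\int[gauss s]_y f (- y)%R = \int[gauss s]_y f y)%E.
Proof.
move=> s0 mf f0.
have mN : measurable_fun setT (fun y : R => - y) by exact: oppr_measurable.
rewrite !ge0_integral_gauss//; last exact: measurableT_comp.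
pose h := fun y : R => (f y * (normal_pdf 0 s y)%:E)%E.
have mh : measurable_fun setT h.
  apply: emeasurable_funM => //.
  by apply/measurable_EFinP; exact: measurable_normal_pdf.
have h0 y : (0 <= h y)%E by rewrite mule_ge0// lee_fin normal_pdf_ge0.
transitivity (\int[mu]_y h (- y)%R)%E.
  apply: eq_integral => x _; rewrite /h; congr (_ * _%:E)%E.
  by rewrite !normal_pdfE// /normal_fun !subr0 sqrrN.
have /= <- := @ge0_integral_pushforward _ _ _ (measurableTypeR R) R
  (-%R : measurableTypeR R -> measurableTypeR R) mN mu setT h measurableT mh
  (fun y _ => h0 y).
by apply: eq_measure_integral => A mA _; exact: lebesgue_measureN.
Qed.

(** This is [1 + x / n <= expR (x / n)] raised to the power [n]. *)
Lemma exprn_le_expR (x : R) (n : nat) : 0 <= x -> x ^+ n <= n%:R ^+ n * expR x.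
Proof.
case: n => [|n] x0; first by rewrite !expr0 mul1r -expR0 ler_expR.
have n0 : 0 < n.+1%:R :> R by [].
have -> : expR x = expR (x / n.+1%:R) ^+ n.+1.
  by rewrite -expRM_natl mulrC divfK// gt_eqF.
rewrite -exprMn lerXn2r ?nnegrE ?mulr_ge0 ?expR_ge0//.
rewrite mulrC -ler_pdivrMr//; apply: le_trans (expR_ge1Dx _).
by rewrite lerDr.
Qed.

Lemma normr_exprn_le_expR (x : R) (n : nat) :
  `|x| ^+ n <= n%:R ^+ n * (expR x + expR (- x)).
Proof.
apply: (le_trans (exprn_le_expR n (normr_ge0 x))).
rewrite ler_wpM2l ?exprn_ge0//.
by have [x0|x0] := ger0P x; rewrite ?lerDl ?lerDr expR_ge0.
Qed.

(** The variance is not computed: bounding the square of [y / s] by exponentials reduces it to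
    [gauss_mgf] at [s^-1] and [- s^-1]. The constant is not sharp, but the power of [s] is the right
    one. *)
Lemma gauss_moment2_le (s : R) : s != 0 ->
  (\int[gauss s]_y (y ^+ 2)%:E <= (8 * expR (1 / 2) * s ^+ 2)%:E)%E.
Proof.
move=> s0.
have me (a : R) : measurable_fun setT (fun y : R => (expR (a * y))%:E).
  by apply/measurable_EFinP; apply: measurableT_comp => //; exact: measurable_funM.
have e0 (a y : R) : (0 <= (expR (a * y))%:E)%E by rewrite lee_fin expR_ge0.
have k0 : (0 <= (4 * s ^+ 2)%:E)%E by rewrite lee_fin mulr_ge0// sqr_ge0.
apply: (@le_trans _ _ (\int[gauss s]_y
    ((4 * s ^+ 2)%:E * ((expR (s^-1 * y))%:E + (expR (- s^-1 * y))%:E)))%E).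
  apply: ge0_le_integral => //.
  - by move=> y _; rewrite lee_fin sqr_ge0.
  - by apply/measurable_EFinP; exact: measurable_funX.
  - by apply: emeasurable_funM => //; exact: emeasurable_funD.
  - move=> y _; rewrite -EFinD -EFinM lee_fin mulNr.
    have := normr_exprn_le_expR (s^-1 * y) 2.
    rewrite -normrX ger0_norm ?sqr_ge0// => h.
    have -> : y ^+ 2 = s ^+ 2 * (s^-1 * y) ^+ 2 by field.
    apply: (le_trans (ler_wpM2l (sqr_ge0 s) h)).
    by apply: eq_lexx; ring.
rewrite ge0_integralZl//; last 2 first.
- exact: emeasurable_funD.
- by move=> y _; rewrite adde_ge0.
rewrite ge0_integralD// !gauss_mgf//.
rewrite -EFinD -EFinM lee_fin sqrrN.
have -> : s^-1 ^+ 2 * s ^+ 2 / 2 = 1 / 2 :> R by field.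
by apply: eq_lexx; ring.
Qed.

(** Averaging over [y] and [- y] removes the cross term [2 * u * a * y], so that only nonnegative
    functions are integrated. *)
Lemma gauss_sqr_le (s u a : R) : s != 0 ->
  (\int[gauss s]_y ((u + a * y) ^+ 2)%:E <=
   (u ^+ 2 + 8 * expR (1 / 2) * a ^+ 2 * s ^+ 2)%:E)%E.
Proof.
move=> s0.
have m2 (b : R) : measurable_fun setT (fun y : R => ((u + b * y) ^+ 2)%:E).
  by apply/measurable_EFinP/measurable_funX/measurable_funD => //; exact: measurable_funM.
have p2 (b y : R) : (0 <= ((u + b * y) ^+ 2)%:E)%E by rewrite lee_fin sqr_ge0.
have E : (\int[gauss s]_y ((u + a * y) ^+ 2)%:E =
          \int[gauss s]_y ((u + (- a) * y) ^+ 2)%:E)%E.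
  rewrite -(gauss_opp s0)//.
  by apply: eq_integral => y _; rewrite mulrN mulNr.
have msq : measurable_fun setT (fun y : R => (y ^+ 2)%:E).
  by apply/measurable_EFinP; exact: measurable_funX.
have sq0 (y : R) : (0 <= (y ^+ 2)%:E)%E by rewrite lee_fin sqr_ge0.
suff H : (2%:E * \int[gauss s]_y ((u + a * y) ^+ 2)%:E <=
   2%:E * (u ^+ 2 + 8 * expR (1 / 2) * a ^+ 2 * s ^+ 2)%:E)%E.
  by rewrite lee_pmul2l in H.
have dbl (x : \bar R) : (0 <= x -> 2%:E * x = x + x)%E.
  by move=> x0; rewrite -[2%:E]/(1 + 1)%E ge0_muleDl// mul1e.
rewrite [X in (X <= _)%E]dbl ?integral_ge0// [X in (_ + X <= _)%E]E.
rewrite -ge0_integralD//.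
rewrite (eq_integral (fun y : R => ((2 * u ^+ 2)%:E + (2 * a ^+ 2)%:E * (y ^+ 2)%:E)%E)); last first.
  by move=> y _; rewrite -EFinM -!EFinD; congr EFin; ring.
rewrite ge0_integralD//; last 3 first.
- by move=> *; rewrite lee_fin mulr_ge0// sqr_ge0.
- by move=> *; rewrite mule_ge0// lee_fin mulr_ge0// sqr_ge0.
- exact: emeasurable_funM.
have g1 : gauss s setT = 1%E := probability_setT _.
rewrite integral_cst//= g1 mule1 ge0_integralZl//; last first.
  by rewrite lee_fin mulr_ge0// sqr_ge0.
rewrite -EFinM mulrDr EFinD leeD2l//.
apply: (@le_trans _ _ ((2 * a ^+ 2)%:E * (8 * expR (1 / 2) * s ^+ 2)%:E)%E).
  by rewrite lee_wpmul2l ?gauss_moment2_le// lee_fin mulr_ge0// sqr_ge0.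
by rewrite -EFinM lee_fin; apply: eq_lexx; ring.
Qed.

End normal.

(** * Transforms of Brownian increments *)

Section freezing.
Context {R : realType} {d : measure_display} {T : measurableType d}.
Variables (P : probability T R) (G : set (set T)) (D : T -> R) (s : R).
Hypothesis sG : sigma_algebra setT G.
Hypothesis GM : G `<=` measurable.
Hypothesis mD : measurable_fun setT D.
Hypothesis lawD : forall B, measurable B -> P (D @^-1` B) = gauss s B.
Hypothesis indepD : forall A B, G A -> measurable B ->
  P (A `&` D @^-1` B) = (P A * P (D @^-1` B))%E.

(** The past as a measurable type of its own. The product law is tied to this coarser structure on
    the first factor: with the full sigma-algebra of [T], the increment would be a function of the
    first coordinate. *)
Let gT := g_sigma_algebraType G.

Let measurable_gT (A : set T) : @measurable _ gT A -> G A.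
Proof. by rewrite measurable_g_measurableTypeE. Qed.

Let toG : T -> gT := idfun.

Let mtoG : measurable_fun setT toG.
Proof.
by move=> _ B mB; rewrite setTI; apply: GM; exact: measurable_gT.
Qed.

HB.instance Definition _ := isMeasurableFun.Build _ _ T gT toG mtoG.

Let pair : T -> gT * R := fun w => (toG w, D w).

Let mpair : measurable_fun setT pair.
Proof. exact: measurable_fun_pair. Qed.

HB.instance Definition _ := isMeasurableFun.Build _ _ T _ pair mpair.

Let PG : probability gT R := distribution P toG.

(* The law of [(w, D w)] on [(T, G) x R] is [P x gauss s]. *)
Lemma freezing (phi : gT * R -> \bar R) :
  measurable_fun setT phi -> (forall z, 0 <= phi z)%E ->
  (\int[P]_w phi (w, D w) = \int[P]_w \int[gauss s]_y phi (w, y))%E.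
Proof.
move=> mphi phi0.
transitivity (\int[(PG \x gauss s)%E]_z phi z)%E.
  transitivity (\int[pushforward P pair]_z phi z)%E.
    by rewrite ge0_integral_pushforward.
  apply: eq_measure_integral => X mX _; apply/esym.
  apply: (@product_measure_unique _ _ _ _ _ PG (gauss s) (pushforward P pair)) => //.
  move=> A B mA mB.
  rewrite /PG /distribution /pushforward /=.
  rewrite -lawD// -indepD//; exact: measurable_gT.
rewrite fubini_tonelli1//.
rewrite /PG /distribution ge0_integral_pushforward//.
  by apply: measurable_fun_fubini_tonelli_F.
by move=> x _; apply: integral_ge0.
Qed.

Let measurable_wrt_gT (U : T -> R) : measurable_wrt G U ->
  measurable_fun setT (U : gT -> R).
Proof.
move=> mU _ B mB; rewrite setTI.
by rewrite measurable_g_measurableTypeE//; exact: mU.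
Qed.

(** The form in which freezing is used: [U] is the sum up to a node, [V] the coefficient of the next
    increment. *)
Lemma freezing_pair (U V : T -> R) (psi : R * R * R -> \bar R) :
  measurable_wrt G U -> measurable_wrt G V ->
  measurable_fun setT psi -> (forall z, 0 <= psi z)%E ->
  (\int[P]_w psi (U w, V w, D w) = \int[P]_w \int[gauss s]_y psi (U w, V w, y))%E.
Proof.
move=> mU mV mpsi psi0.
apply: (@freezing (fun z => psi (U z.1, V z.1, z.2))) => //.
apply: (@measurableT_comp _ _ _ _ _ _ psi) => //.
apply: measurable_fun_pair => //; apply: measurable_fun_pair => //.
- by apply: measurableT_comp => //; exact: measurable_wrt_gT.
- by apply: measurableT_comp => //; exact: measurable_wrt_gT.
Qed.

End freezing.

Section measurable_wrt.
Context {R : realType} {d : measure_display} {T : measurableType d}.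
Implicit Types (G : set (set T)) (U : T -> R).

Lemma measurable_wrtP G U : sigma_algebra setT G ->
  measurable_wrt G U <-> measurable_fun setT (U : g_sigma_algebraType G -> R).
Proof.
move=> sG; split=> [mU _ B mB|mU B mB].
  by rewrite setTI measurable_g_measurableTypeE//; exact: mU.
by rewrite -(measurable_g_measurableTypeE sG) -[_ @^-1` _]setTI; exact: mU.
Qed.

Lemma measurable_wrt_sub G G' U : G `<=` G' ->
  measurable_wrt G U -> measurable_wrt G' U.
Proof. by move=> GG' mU B mB; apply: GG'; exact: mU. Qed.

Lemma measurable_wrt_fun G U : G `<=` measurable ->
  measurable_wrt G U -> measurable_fun setT U.
Proof. by move=> GM mU _ B mB; rewrite setTI; apply: GM; exact: mU. Qed.

Lemma measurable_wrt_sum G (I : Type) (s : seq I) (U : I -> T -> R) :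
  sigma_algebra setT G -> (forall i, measurable_wrt G (U i)) ->
  measurable_wrt G (fun w => \sum_(i <- s) U i w).
Proof.
move=> sG mU; apply/measurable_wrtP => //.
by apply: measurable_sum => i; apply/measurable_wrtP.
Qed.

Lemma measurable_wrtM G U V : sigma_algebra setT G ->
  measurable_wrt G U -> measurable_wrt G V -> measurable_wrt G (fun w => U w * V w).
Proof.
move=> sG mU mV; apply/measurable_wrtP => //.
by apply: measurable_funM; apply/measurable_wrtP.
Qed.

Lemma measurable_wrtB G U V : sigma_algebra setT G ->
  measurable_wrt G U -> measurable_wrt G V -> measurable_wrt G (fun w => U w - V w).
Proof.
move=> sG mU mV; apply/measurable_wrtP => //.
by apply: measurable_funB; apply/measurable_wrtP.
Qed.

Lemma measurable_wrt_comp G U (f : R -> R) : measurable_fun setT f ->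
  measurable_wrt G U -> measurable_wrt G (f \o U).
Proof.
move=> mf mU B mB; rewrite comp_preimage; apply: mU.
by rewrite -[_ @^-1` _]setTI; exact: mf.
Qed.

Lemma measurable_wrt_cst G (r : R) : sigma_algebra setT G ->
  measurable_wrt G (fun=> r).
Proof. by move=> sG; apply/measurable_wrtP => //; exact: measurable_cst. Qed.

End measurable_wrt.

(* The bound on [\int y ^+ 2] in [gauss_moment2_le]. *)
Definition sqr_const {R : realType} : R := 8 * expR (1 / 2).

Lemma sqr_const_ge0 {R : realType} : 0 <= sqr_const :> R.
Proof. by rewrite mulr_ge0 ?expR_ge0. Qed.

Section martingale_transform.
Context {R : realType} {d : measure_display} {T : measurableType d}.
Variables (P : probability T R) (F : R -> set (set T)) (W : R -> T -> R).
Hypothesis fF : is_filtration F.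
Hypothesis bW : brownian_motion P F W.

Lemma brownian_adapted (t u : R) : 0 <= t -> t <= u -> measurable_wrt (F u) (W t).
Proof.
case: fF => _ _ Fm; case: bW => aW _ _ _ _ t0 tu.
by apply: measurable_wrt_sub (aW _ t0); exact: Fm.
Qed.

Lemma brownian_measurable (t : R) : 0 <= t -> measurable_fun setT (W t).
Proof.
move=> t0; case: fF => _ FM _.
by apply: (measurable_wrt_fun (FM _ t0)); exact: brownian_adapted.
Qed.

Lemma freezing_increment (a b : R) (U V : T -> R) (psi : R * R * R -> \bar R) :
  0 <= a -> a < b -> measurable_wrt (F a) U -> measurable_wrt (F a) V ->
  measurable_fun setT psi -> (forall z, 0 <= psi z)%E ->
  (\int[P]_w psi (U w, V w, (W b w - W a w)%R) =
   \int[P]_w \int[gauss (Num.sqrt (b - a))]_y psi (U w, V w, y))%E.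
Proof.
move=> a0 ab mU mV mpsi psi0; case: (fF) => sF FM _.
case: (bW) => _ _ _ lawW indW.
have b0 : 0 <= b := le_trans a0 (ltW ab).
apply: (@freezing_pair _ _ _ P (F a) (fun w => W b w - W a w)) => //.
- exact: sF.
- exact: FM.
- by apply: measurable_funB; exact: brownian_measurable.
- by move=> B mB; exact: lawW.
- by move=> A B FA mB; exact: indW.
Qed.

(** With the past frozen, the increment is a centred Gaussian variable and [gauss_sqr_le] applies.
    The law is prescribed for [a < b], so [a = b], where the increment vanishes, is a separate
    case. *)
Lemma increment_sqr_le (a b : R) (U V : T -> R) : 0 <= a -> a <= b ->
  measurable_wrt (F a) U -> measurable_wrt (F a) V ->
  (\int[P]_w ((U w + V w * (W b w - W a w)) ^+ 2)%:E <=
   \int[P]_w ((U w ^+ 2)%:E + (sqr_const * (V w ^+ 2 * (b - a)))%:E))%E.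
Proof.
move=> a0 ab mU mV; case: (fF) => _ FM _.
have mU' := measurable_wrt_fun (FM _ a0) mU.
have mV' := measurable_wrt_fun (FM _ a0) mV.
have mR r : measurable_fun setT
    (fun w => ((U w ^+ 2)%:E + (sqr_const * (V w ^+ 2 * r))%:E)%E).
  apply: emeasurable_funD; apply/measurable_EFinP.
    exact: measurable_funX.
  apply: measurable_funM => //; apply: measurable_funM => //.
  exact: measurable_funX.
move: ab; rewrite le_eqVlt => /predU1P[<-|ab].
  apply: ge0_le_integral => //.
  - by move=> w _; rewrite lee_fin sqr_ge0.
  - apply/measurable_EFinP/measurable_funX/measurable_funD => //.
    apply: measurable_funM => //.
    by apply: measurable_funB; exact: brownian_measurable.
  - by move=> w _; rewrite !subrr !mulr0 addr0 adde0.
have ba : 0 <= b - a by rewrite subr_ge0 ltW.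
have s0 : Num.sqrt (b - a) != 0 by rewrite gt_eqF// sqrtr_gt0 subr_gt0.
pose psi := fun z : R * R * R => ((z.1.1 + z.1.2 * z.2) ^+ 2)%:E.
have mpsi : measurable_fun setT psi.
  apply/measurable_EFinP/measurable_funX/measurable_funD.
    by apply: measurableT_comp.
  apply: measurable_funM; last exact: measurable_snd.
  by apply: measurableT_comp.
have psi0 z : (0 <= psi z)%E by rewrite lee_fin sqr_ge0.
have := freezing_increment a0 ab mU mV mpsi psi0; rewrite /psi/= => ->.
apply: ge0_le_integral => //.
- by move=> w _; apply: integral_ge0 => y _; rewrite lee_fin sqr_ge0.
- have mUV : measurable_fun setT (fun w => (U w, V w)) by exact: measurable_fun_pair.
  exact: (measurableT_comp (measurable_fun_fubini_tonelli_F
    (m2 := gauss (Num.sqrt (b - a))) psi mpsi psi0) mUV).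
- move=> w _; apply: (le_trans (gauss_sqr_le _ _ s0)).
  by rewrite sqr_sqrtr// -EFinD /sqr_const !mulrA.
Qed.

(** Given the past, the exponential moment of the new term is explicit, and the uniform bound on [V]
    turns it into a constant that leaves the integral. *)
Lemma increment_exp_le (a b theta g : R) (U V : T -> R) : 0 <= a -> a <= b ->
  measurable_wrt (F a) U -> measurable_wrt (F a) V ->
  (forall w, `|V w| <= g) ->
  (\int[P]_w (expR (theta * (U w + V w * (W b w - W a w))))%:E <=
   (expR (theta ^+ 2 * (g ^+ 2 * (b - a)) / 2))%:E *
   \int[P]_w (expR (theta * U w))%:E)%E.
Proof.
move=> a0 ab mU mV Vg; case: (fF) => _ FM _.
have mU' := measurable_wrt_fun (FM _ a0) mU.
have mV' := measurable_wrt_fun (FM _ a0) mV.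
have me : measurable_fun setT (fun w => (expR (theta * U w))%:E).
  by apply/measurable_EFinP; apply: measurableT_comp => //; exact: measurable_funM.
move: ab; rewrite le_eqVlt => /predU1P[<-|ab].
  rewrite subrr !mulr0 mul0r expR0 mul1e.
  by under eq_integral do rewrite subrr mulr0 addr0.
have ba : 0 <= b - a by rewrite subr_ge0 ltW.
have s0 : Num.sqrt (b - a) != 0 by rewrite gt_eqF// sqrtr_gt0 subr_gt0.
pose psi := fun z : R * R * R => (expR (theta * (z.1.1 + z.1.2 * z.2)))%:E.
have mpsi : measurable_fun setT psi.
  apply/measurable_EFinP/measurableT_comp => //; apply: measurable_funM => //.
  apply/measurable_funD.
    by apply: measurableT_comp.
  apply: measurable_funM; last exact: measurable_snd.
  by apply: measurableT_comp.
have psi0 z : (0 <= psi z)%E by rewrite lee_fin expR_ge0.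
have := freezing_increment a0 ab mU mV mpsi psi0; rewrite /psi/= => ->.
rewrite -ge0_integralZl//.
apply: ge0_le_integral => //.
- by move=> w _; apply: integral_ge0 => y _; rewrite lee_fin expR_ge0.
- have mUV : measurable_fun setT (fun w => (U w, V w)) by exact: measurable_fun_pair.
  exact: (measurableT_comp (measurable_fun_fubini_tonelli_F
    (m2 := gauss (Num.sqrt (b - a))) psi mpsi psi0) mUV).
- by apply: emeasurable_funM.
- move=> w _.
  under eq_integral do rewrite mulrDr expRD EFinM mulrA.
  rewrite ge0_integralZl//; last first.
    by apply/measurable_EFinP/measurableT_comp.
  rewrite gauss_mgf// -!EFinM lee_fin mulrC ler_wpM2r ?expR_ge0//.
  rewrite ler_expR sqr_sqrtr// ler_pM2r// exprMn -mulrA.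
  rewrite ler_wpM2l ?sqr_ge0// ler_wpM2r//.
  by rewrite -(real_normK (num_real (V w))) lerXn2r ?nnegrE// (le_trans _ (Vg w)).
Qed.

End martingale_transform.

Section transform.
Context {R : realType} {T : Type}.
Variables (W : R -> T -> R) (tau : nat -> R) (n : nat) (c : nat -> T -> R).
Hypothesis tau_le : forall k, (k < n)%N -> tau k <= tau k.+1.

(** The martingale transform: the stochastic integral of the step process with value [c k] on the
    cell from [tau k] to [tau k.+1]. *)
Definition transform (w : T) : R :=
  \sum_(k < n) c k w * (W (tau k.+1) w - W (tau k) w).

Lemma nondecreasing_upto (j k : nat) : (j <= k <= n)%N -> tau j <= tau k.
Proof.
move=> /andP[]; elim: k => [|k IH] jk kn; first by move: jk; rewrite leqn0 => /eqP ->.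
move: jk; rewrite leq_eqVlt => /predU1P[->//|jk].
by rewrite (le_trans (IH _ (ltnW kn)))// tau_le.
Qed.

End transform.

Section transform_bounds.
Context {R : realType} {d : measure_display} {T : measurableType d}.
Variables (P : probability T R) (F : R -> set (set T)) (W : R -> T -> R).
Hypothesis fF : is_filtration F.
Hypothesis bW : brownian_motion P F W.
Variables (tau : nat -> R) (c : nat -> T -> R).
Hypothesis tau0 : 0 <= tau 0.

Lemma transform_adapted (n : nat) :
  (forall k, (k < n)%N -> tau k <= tau k.+1) ->
  (forall k, (k < n)%N -> measurable_wrt (F (tau k)) (c k)) ->
  measurable_wrt (F (tau n)) (transform W tau n c).
Proof.
move=> tau_le mc; case: (fF) => sF _ Fm.
have tk k : (k <= n)%N -> 0 <= tau k.
  by move=> kn; rewrite (le_trans tau0)// (nondecreasing_upto tau_le)// kn.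
apply: measurable_wrt_sum => [|[k kn]/=]; first exact/sF/tk.
have le_n j : (j <= n)%N -> tau j <= tau n.
  by move=> jn; rewrite (nondecreasing_upto tau_le)// jn leqnn.
apply: measurable_wrtM; first exact/sF/tk.
  apply: measurable_wrt_sub (mc _ kn).
  by apply: Fm; rewrite ?tk ?le_n// ltnW.
apply: measurable_wrtB; first exact/sF/tk.
  by apply: (brownian_adapted fF bW); rewrite ?tk ?le_n.
by apply: (brownian_adapted fF bW); rewrite ?tk ?le_n// ltnW.
Qed.

(** One half of the Ito isometry, up to the constant [sqr_const]. The last increment is frozen and
    the others are left to the induction; all integrands are nonnegative, so the computation stays
    in [[0, +oo]]. *)
Lemma transform_sqr_le (n : nat) :
  (forall k, (k < n)%N -> tau k <= tau k.+1) ->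
  (forall k, (k < n)%N -> measurable_wrt (F (tau k)) (c k)) ->
  (\int[P]_w (transform W tau n c w ^+ 2)%:E <=
   \int[P]_w (\sum_(k < n) sqr_const * (c k w ^+ 2 * (tau k.+1 - tau k)))%:E)%E.
Proof.
case: (fF) => sF FM Fm.
elim: n => [|n IH] tau_le mc.
  rewrite /transform; under eq_integral do rewrite big_ord0 expr0n.
  by under [leRHS]eq_integral do rewrite big_ord0.
have tau_le' k : (k < n)%N -> tau k <= tau k.+1 by move=> kn; apply/tau_le/ltnW.
have mc' k : (k < n)%N -> measurable_wrt (F (tau k)) (c k).
  by move=> kn; apply/mc/ltnW.
have tk k : (k <= n)%N -> 0 <= tau k.
  by move=> kn; rewrite (le_trans tau0)// (nondecreasing_upto tau_le')// kn.
have mck k : (k < n.+1)%N -> measurable_fun setT (c k).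
  by move=> kn; apply: measurable_wrt_fun (mc _ kn); apply/FM/tk.
have mS : measurable_wrt (F (tau n)) (transform W tau n c) by exact: transform_adapted.
have mS' := measurable_wrt_fun (FM _ (tk _ (leqnn n))) mS.
have nn : (n < n.+1)%N by [].
have := increment_sqr_le fF bW (tk _ (leqnn n)) (tau_le _ nn) mS (mc _ nn).
under eq_integral do rewrite -(@big_ord_recr _ _ _ n
  (fun k : 'I_n.+1 => c k _ * (W (tau k.+1) _ - W (tau k) _))).
move=> /le_trans; apply.
have sq0 k w : (k < n.+1)%N -> 0 <= sqr_const * (c k w ^+ 2 * (tau k.+1 - tau k)).
  by move=> kn; rewrite mulr_ge0 ?sqr_const_ge0// mulr_ge0 ?sqr_ge0// subr_ge0 tau_le.
have msq k : (k < n.+1)%N ->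
    measurable_fun setT (fun w => sqr_const * (c k w ^+ 2 * (tau k.+1 - tau k))).
  move=> kn; apply: measurable_funM => //; apply: measurable_funM => //.
  by apply: measurable_funX; exact: mck.
rewrite ge0_integralD//; last 4 first.
- by move=> w _; rewrite lee_fin sqr_ge0.
- by apply/measurable_EFinP; exact: measurable_funX.
- by move=> w _; rewrite lee_fin sq0.
- by apply/measurable_EFinP; exact: msq.
apply: (le_trans (leeD2r _ (IH tau_le' mc'))).
rewrite -ge0_integralD//; last 4 first.
- by move=> w _; rewrite lee_fin sumr_ge0// => -[k kn] _; rewrite sq0//= ltnW.
- apply/measurable_EFinP; apply: measurable_sum => -[k kn] /=.
  by apply: msq; exact: ltnW.
- by move=> w _; rewrite lee_fin sq0.
- by apply/measurable_EFinP; exact: msq.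
apply: ge0_le_integral => //.
- move=> w _; rewrite -EFinD lee_fin addr_ge0 ?sq0// sumr_ge0// => -[k kn] _.
  by rewrite sq0//= ltnW.
- apply: emeasurable_funD; apply/measurable_EFinP; last exact: msq.
  by apply: measurable_sum => -[k kn] /=; apply: msq; exact: ltnW.
- apply/measurable_EFinP; apply: measurable_sum => -[k kn] /=; exact: msq.
- by move=> w _; rewrite -EFinD big_ord_recr.
Qed.

(** Freezing the last increment costs a deterministic factor, and these factors multiply along the
    induction. The bounds [g k] vary with the cell because the transform to which this is applied
    vanishes on the cells before [s]. *)
Lemma transform_exp_le (n : nat) (g : nat -> R) (theta : R) :
  (forall k, (k < n)%N -> tau k <= tau k.+1) ->
  (forall k, (k < n)%N -> measurable_wrt (F (tau k)) (c k)) ->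
  (forall k w, (k < n)%N -> `|c k w| <= g k) ->
  (\int[P]_w (expR (theta * transform W tau n c w))%:E <=
   (expR (theta ^+ 2 * (\sum_(k < n) g k ^+ 2 * (tau k.+1 - tau k)) / 2))%:E)%E.
Proof.
elim: n => [|n IH] tau_le mc cg.
  rewrite /transform; under eq_integral do rewrite big_ord0 mulr0 expR0.
  have P1 : P setT = 1%E by exact: probability_setT.
  by rewrite integral_cst//= P1 mul1e big_ord0 mulr0 mul0r expR0.
have tau_le' k : (k < n)%N -> tau k <= tau k.+1 by move=> kn; apply/tau_le/ltnW.
have mc' k : (k < n)%N -> measurable_wrt (F (tau k)) (c k).
  by move=> kn; apply/mc/ltnW.
have tk : 0 <= tau n.
  by rewrite (le_trans tau0)// (nondecreasing_upto tau_le')//=.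
have mS : measurable_wrt (F (tau n)) (transform W tau n c) by exact: transform_adapted.
have nn : (n < n.+1)%N by [].
have := increment_exp_le fF bW theta tk (tau_le _ nn) mS (mc _ nn) (fun w => cg _ w nn).
under eq_integral do rewrite -(@big_ord_recr _ _ _ n
  (fun k : 'I_n.+1 => c k _ * (W (tau k.+1) _ - W (tau k) _))).
move=> /le_trans; apply.
have {}IH := IH tau_le' mc' (fun k w kn => cg k w (ltnW kn)).
apply: (le_trans (lee_wpmul2l _ IH)); first by rewrite lee_fin expR_ge0.
by rewrite -EFinM -expRD lee_fin ler_expR big_ord_recr/= (mulrDr (theta ^+ 2)) mulrDl addrC.
Qed.

End transform_bounds.

(** * Partitions and simple processes on a common refinement *)

Section grid.
Context {R : realType}.
Variables (tau : nat -> R) (n : nat).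
Hypothesis tau_le : forall k, (k < n)%N -> tau k <= tau k.+1.

Lemma grid_dichotomy (m k : nat) : (m <= n)%N -> (k < n)%N ->
  tau m <= tau k \/ tau k.+1 <= tau m.
Proof.
move=> mn kn; case: (leqP m k) => mk; [left|right].
  by rewrite (nondecreasing_upto tau_le)// mk ltnW.
by rewrite (nondecreasing_upto tau_le)// mk.
Qed.

(** The weights compare values of [tau] and not indices, because simple processes see only times,
    and a merged partition may repeat a node. *)
Lemma grid_telescope (X : R -> R) (m : nat) : (m <= n)%N ->
  \sum_(k < n) (tau k.+1 <= tau m)%R%:R * (X (tau k.+1) - X (tau k)) =
  X (tau m) - X (tau 0).
Proof.
move=> mn.
transitivity (\sum_(k < n | (k < m)%N) (X (tau k.+1) - X (tau k))).
  rewrite [RHS]big_mkcond/=; apply: eq_bigr => -[k kn] _ /=.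
  case: ltnP => km.
    by rewrite (nondecreasing_upto tau_le) ?km// mul1r.
  (* A cell beyond the index [m] is counted only if it has length zero. *)
  have [h|] := leP (tau k.+1) (tau m); last by rewrite mul0r.
  have mk : tau m <= tau k by rewrite (nondecreasing_upto tau_le)// km ltnW.
  have -> : tau k.+1 = tau k.
    by apply/eqP; rewrite eq_le tau_le// (le_trans h).
  by rewrite subrr mulr0.
rewrite -(big_ord_widen n (fun k => X (tau k.+1) - X (tau k)))//.
by rewrite -(big_mkord xpredT (fun k => X (tau k.+1) - X (tau k))) telescope_sumr.
Qed.

Lemma grid_increment (X : R -> R) (a b : nat) : (a <= n)%N -> (b <= n)%N ->
  tau a <= tau b ->
  \sum_(k < n) \1_`]tau a, tau b] (tau k.+1) * (X (tau k.+1) - X (tau k)) =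
  X (tau b) - X (tau a).
Proof.
move=> an bn ab.
transitivity (\sum_(k < n) ((tau k.+1 <= tau b)%R%:R * (X (tau k.+1) - X (tau k))
    - (tau k.+1 <= tau a)%R%:R * (X (tau k.+1) - X (tau k)))).
  apply: eq_bigr => k _; rewrite -mulrBl; congr (_ * _).
  rewrite indicE mem_setE in_itv/= ltNge.
  have [h|h] := leP (tau k.+1) (tau a) => /=; last by rewrite subr0.
  by rewrite (le_trans h ab) subrr.
by rewrite sumrB !grid_telescope//; ring.
Qed.

End grid.

(** The step function with values [e k] lies below [Phi] on cells that are left-open and
    right-closed, like the intervals of simple processes. *)
Lemma grid_integral_le {R : realType} (tau : nat -> R) (n : nat) (e : nat -> R)
    (Phi : R -> R) :
  (forall k, (k < n)%N -> tau k <= tau k.+1) ->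
  measurable_fun setT Phi -> (forall u, 0 <= Phi u) -> (forall k, 0 <= e k) ->
  (forall k u, (k < n)%N -> tau k < u <= tau k.+1 -> e k <= Phi u) ->
  ((\sum_(k < n) e k * (tau k.+1 - tau k))%:E <=
   \int[lebesgue_measure]_(u in `]tau 0%N, tau n]) (Phi u)%:E)%E.
Proof.
move=> tau_le mPhi Phi0 e0; elim: n tau_le => [|n IH] tau_le ePhi.
  by rewrite big_ord0 integral_ge0// => u _; rewrite lee_fin.
have nn : (n < n.+1)%N by [].
have tau_le' k : (k < n)%N -> tau k <= tau k.+1 by move=> kn; apply/tau_le/ltnW.
have t0n : tau 0%N <= tau n by rewrite (nondecreasing_upto tau_le')/=.
have mE A : measurable_fun A (fun u : measurableTypeR R => (Phi u)%:E).
  by apply: measurable_funTS; exact/measurable_EFinP.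
have -> : `]tau 0%N, tau n.+1]%classic = `]tau 0%N, tau n] `|` `]tau n, tau n.+1].
  apply/seteqP; split=> u /=; rewrite !in_itv/=.
    by move=> /andP[a b]; have [h|h] := leP u (tau n); [left|right]; apply/andP.
  move=> [|] /andP[a b]; first by rewrite a (le_trans b)// tau_le.
  by rewrite (le_lt_trans t0n a).
rewrite ge0_integral_setU//=; last 2 first.
- by move=> u _; rewrite lee_fin.
- apply/eqP; rewrite -subset0 => u [] /=; rewrite !in_itv/= => /andP[_ a] /andP[b _].
  by move: (le_lt_trans a b); rewrite ltxx.
rewrite big_ord_recr/= EFinD leeD//.
  by apply: IH => // k u kn; apply: ePhi; exact: ltnW.
apply: (@le_trans _ _ (\int[lebesgue_measure]_(u in `]tau n, tau n.+1]) (e n)%:E)%E).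
  rewrite integral_cst//= lebesgue_measure_itv/= lte_fin.
  case: ltP => h; first by rewrite -EFinB -EFinM.
  by rewrite mule0 lee_fin mulr_ge0_le0// subr_le0.
apply: ge0_le_integral => //=.
- by move=> u _; rewrite lee_fin.
- by move=> u; rewrite in_itv/= => h; rewrite lee_fin ePhi.
Qed.

Section simple_process_on_grid.
Context {R : realType} {d : measure_display} {T : measurableType d}.
Variables (F : R -> set (set T)) (W : R -> T -> R) (t : R).
Variables (h : simple_process F t).
Hypothesis fF : is_filtration F.

Lemma sp_time_mono (i j : nat) : (i <= j <= sp_size h)%N ->
  sp_time h i <= sp_time h j.
Proof. by move=> ij; apply: nondecreasing_upto ij; exact: sp_time_le. Qed.

Lemma sp_time_ge0 (i : nat) : (i <= sp_size h)%N -> 0 <= sp_time h i.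
Proof. by move=> ih; rewrite -(sp_time_first h) sp_time_mono. Qed.

Lemma sp_time_le_last (i : nat) : (i <= sp_size h)%N -> sp_time h i <= t.
Proof. by move=> ih; rewrite -[leRHS](sp_time_last h) sp_time_mono ?ih/=. Qed.

(** No interval of the process reaches beyond its horizon. After the earlier time [s], the
    difference of the approximations over [[0, t]] and [[0, s]] is thus the former alone. *)
Lemma sp_value_gt (u : R) w : t < u -> sp_value h u w = 0.
Proof.
move=> tu; rewrite /sp_value big1// => -[i ih] _ /=.
rewrite indicE mem_setE in_itv/=.
have -> : (u <= sp_time h i.+1) = false.
  by apply/negbTE; rewrite -ltNge (le_lt_trans (sp_time_le_last ih)).
by rewrite andbF mulr0.
Qed.

Variables (tau : nat -> R) (n : nat).
Hypothesis tau_le : forall k, (k < n)%N -> tau k <= tau k.+1.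
Hypothesis tau0 : 0 <= tau 0.
Hypothesis h_tau : forall i, (i <= sp_size h)%N ->
  exists2 m, (m <= n)%N & sp_time h i = tau m.

(** The nodes of [h] are among those of [tau], so [h] is constant on each []tau k, tau k.+1]], and
    its value at the right end serves as the coefficient of the cell. *)
Lemma sp_integral_grid w : sp_integral W h w =
  transform W tau n (fun k w => sp_value h (tau k.+1) w) w.
Proof.
rewrite /sp_integral /transform /sp_value.
under [RHS]eq_bigr do rewrite mulr_suml.
rewrite exchange_big/=; apply: eq_bigr => -[i ih] _ /=.
have [a an ea] := h_tau (ltnW ih); have [b bn eb] := h_tau ih.
have ab : tau a <= tau b by rewrite -ea -eb sp_time_le.
rewrite ea eb -(grid_increment tau_le (W^~ w) an bn ab) mulr_sumr.
by apply: eq_bigr => k _; rewrite mulrA.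
Qed.

Let time_cases (i k : nat) : (i <= sp_size h)%N -> (k < n)%N ->
  sp_time h i <= tau k \/ tau k.+1 <= sp_time h i.
Proof. by move=> /h_tau[m mn ->] kn; exact: (grid_dichotomy tau_le). Qed.

Lemma sp_value_grid (k : nat) (u : R) w : (k < n)%N -> tau k < u <= tau k.+1 ->
  sp_value h u w = sp_value h (tau k.+1) w.
Proof.
move=> kn /andP[ku uk]; rewrite /sp_value; apply: eq_bigr => -[i ih] _ /=.
congr (_ * _); rewrite !indicE !mem_setE !in_itv/=; congr (nat_of_bool _)%:R.
congr andb.
- have [a|a] := time_cases (ltnW ih) kn.
    by rewrite (le_lt_trans a ku) (lt_le_trans (le_lt_trans a ku) uk).
  by rewrite !ltNge a (le_trans uk a).
- have [a|a] := time_cases ih kn.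
    by rewrite !leNgt (le_lt_trans a ku) (lt_le_trans (le_lt_trans a ku) uk).
  by rewrite a (le_trans uk a).
Qed.

(** The value at the right end is known at the left end: an interval of [h] containing [tau k.+1]
    begins at a node not after [tau k], where its coefficient is already measurable. *)
Lemma sp_value_adapted (k : nat) : (k < n)%N ->
  measurable_wrt (F (tau k)) (sp_value h (tau k.+1)).
Proof.
move=> kn; case: (fF) => sF FM Fm.
have tk : 0 <= tau k.
  by apply: (le_trans tau0); apply: (nondecreasing_upto tau_le); exact: ltnW.
apply: measurable_wrt_sum => [|[i ih]/=]; first exact: sF.
have [a|a] := time_cases (ltnW ih) kn.
  apply: measurable_wrtM; [exact: sF| |by apply: measurable_wrt_cst; exact: sF].
  apply: measurable_wrt_sub (sp_coef_adapted ih).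
  by apply: Fm => //; exact/sp_time_ge0/ltnW.
have -> : (fun w => sp_coef h i w * \1_`]sp_time h i, sp_time h i.+1] (tau k.+1)) =
    fun=> 0.
  by apply/funext => w; rewrite indicE mem_setE in_itv/= ltNge a mulr0.
by apply: measurable_wrt_cst; exact: sF.
Qed.

End simple_process_on_grid.

(** * Joint measurability and Tonelli *)

Section joint_measurability.
Context {R : realType} {d : measure_display} {T : measurableType d}.

Definition jointly_measurable (X : R -> T -> R) : Prop :=
  measurable_fun [set: T * measurableTypeR R] (fun z => X z.2 z.1).

Lemma jointly_measurable_step (Y : nat -> T -> R) (q : R -> nat) :
  (forall k, measurable_fun setT (Y k)) ->
  (forall k, measurable [set s | q s = k]) ->
  jointly_measurable (fun s w => Y (q s) w).
Proof.
move=> mY mq _ B mB; rewrite setTI.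
rewrite (_ : _ @^-1` _ = \bigcup_k ((Y k @^-1` B) `*` [set s | q s = k])).
  apply: bigcupT_measurable => k; apply: measurableX.
    by rewrite -[X in measurable X]setTI; exact: mY.
  exact: (mq k).
apply/seteqP; split=> [[w s]/= h|[w s] [k _ [/= h qk]]]; first by exists (q s).
by rewrite qk.
Qed.

Lemma measurable_truncn_eq (a : R) (k : nat) : 0 < a ->
  measurable [set s : R | Num.truncn (s * a) = k].
Proof.
move=> a0; case: k => [|k].
  rewrite (_ : [set _ | _] = `]-oo, a^-1[%classic) ?measurable_itv//.
  apply/seteqP; split=> s /=; rewrite in_itv/=.
    by move=> /eqP; rewrite -leqn0 leqNgt truncn_gt0 -ltNge -ltr_pdivlMr// mul1r.
  move=> h; apply/eqP; rewrite -leqn0 leqNgt truncn_gt0 -ltNge -ltr_pdivlMr//.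
  by rewrite mul1r.
rewrite (_ : [set _ | _] = `[k.+1%:R / a, k.+2%:R / a[%classic) ?measurable_itv//.
apply/seteqP; split=> s /=; rewrite in_itv/= ler_pdivrMr// ltr_pdivlMr//.
  move=> h; have s0 : 0 <= s * a.
    by rewrite leNgt; apply/negP => s0; move: h; rewrite truncn_floor leNgt s0.
  by have := truncn_itv s0; rewrite h.
by move=> h; exact: truncn_def.
Qed.

(** The process is the pointwise limit of step processes frozen at the last multiple of [1 / n.+1].
    At negative times [truncn] returns 0, which is consistent because the paths are constant
    there. *)
Lemma continuous_jointly_measurable (X : R -> T -> R) :
  (forall t, measurable_fun setT (X t)) -> (forall w, continuous (X^~ w)) ->
  (forall t w, t <= 0 -> X t w = X 0 w) ->
  jointly_measurable X.
Proof.
move=> mX cX X0.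
pose Xn (n : nat) (s : R) (w : T) := X ((Num.truncn (s * n.+1%:R))%:R / n.+1%:R) w.
have mXn n : jointly_measurable (Xn n).
  apply: (@jointly_measurable_step (fun k => X (k%:R / n.+1%:R))
    (fun s => Num.truncn (s * n.+1%:R))) => // k.
  exact: measurable_truncn_eq.
apply: (@measurable_fun_cvg _ _ _ _ (fun n z => Xn n z.2 z.1)) => //.
move=> [w s] _ /=.
have [s0|s0] := leP s 0.
  rewrite X0//; apply: cvg_near_cst; near=> n.
  rewrite /Xn truncn_floor.
  have : s * n.+1%:R <= 0 by rewrite mulr_le0_ge0.
  rewrite le_eqVlt => /predU1P[->|h]; first by rewrite lexx floor0 mul0r.
  by rewrite leNgt h mul0r.
apply: (@cvg_comp _ _ _ (fun n => (Num.truncn (s * n.+1%:R))%:R / n.+1%:R)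
  (X^~ w) _ (nbhs s)); last exact: cX.
apply/cvgrPdist_le => e e0; near=> n.
have n0 : 0 < n.+1%:R :> R by [].
have sn : 0 <= s * n.+1%:R by rewrite mulr_ge0// ltW.
have /andP[h1 h2] := truncn_itv sn.
rewrite ger0_norm; last by rewrite subr_ge0 ler_pdivrMr.
apply: (@le_trans _ _ n.+1%:R^-1).
  rewrite lerBlDl -[X in _ <= _ + X]mul1r -mulrDl ler_pdivlMr//.
  by rewrite natr1 ltW.
near: n; exists (Num.truncn e^-1) => // n /= hn.
rewrite invf_ple ?posrE//.
apply: (le_trans (ltW (truncnS_gt _))).
by rewrite ler_nat ltnS.
Unshelve. all: by end_near. Qed.

End joint_measurability.

Section tonelli.
Context {R : realType} {d : measure_display} {T : measurableType d}.
Variable P : probability T R.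
Local Notation mu := (@lebesgue_measure R).

Lemma integral_mul_indic (D : set R) (f : R -> \bar R) :
  (\int[mu]_(u in D) f u = \int[mu]_u (f u * (\1_D u)%:E))%E.
Proof.
rewrite integral_mkcond; apply: eq_integral => u _.
rewrite patchE indicE; case: ifPn => _; first by rewrite mule1.
by rewrite mule0.
Qed.

Variables (D : set R) (G : T -> R -> \bar R).
Hypothesis mD : measurable D.
Hypothesis mG : measurable_fun [set: T * measurableTypeR R] (fun z => G z.1 z.2).
Hypothesis G0 : forall w u, (0 <= G w u)%E.

Let mGD : measurable_fun [set: T * measurableTypeR R]
  (fun z => (G z.1 z.2 * (\1_D z.2)%:E)%E).
Proof.
apply: emeasurable_funM => //; apply/measurable_EFinP.
have mi : measurable_fun [set: measurableTypeR R] (\1_D : R -> R).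
  exact: measurable_indic.
exact: (measurableT_comp mi measurable_snd).
Qed.

Let GD0 (z : T * measurableTypeR R) : (0 <= G z.1 z.2 * (\1_D z.2)%:E)%E.
Proof. by rewrite mule_ge0// lee_fin. Qed.

Lemma measurable_integral_section :
  measurable_fun setT (fun w => \int[mu]_(u in D) G w u)%E.
Proof.
under eq_fun do rewrite integral_mul_indic.
exact: (measurable_fun_fubini_tonelli_F (m2 := mu) _ mGD GD0).
Qed.

Lemma tonelli_lebesgue :
  (\int[P]_w \int[mu]_(u in D) G w u = \int[mu]_(u in D) \int[P]_w G w u)%E.
Proof.
under eq_integral do rewrite integral_mul_indic.
rewrite (fubini_tonelli (m1 := P) (m2 := mu) _ mGD GD0) [RHS]integral_mul_indic.
apply: eq_integral => u _ /=; rewrite ge0_integralZr//.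
have mu1 : measurable_fun setT (fun w : T => (w, u) : T * measurableTypeR R).
  by apply: measurable_fun_pair => //; exact: measurable_cst.
exact: (measurableT_comp mG mu1).
Qed.

End tonelli.

Lemma sp_value_jointly_measurable {R : realType} {d : measure_display}
    {T : measurableType d} (F : R -> set (set T)) (t : R)
    (h : simple_process F t) : is_filtration F ->
  jointly_measurable (sp_value h).
Proof.
move=> [sF FM Fm]; apply: measurable_sum => -[i ih] /=.
have mi : measurable_fun [set: measurableTypeR R]
    (\1_`]sp_time h i, sp_time h i.+1] : R -> R).
  exact: measurable_indic.
have mc : measurable_fun setT (sp_coef h i).
  apply: measurable_wrt_fun (sp_coef_adapted ih).
  by apply/FM/sp_time_ge0/ltnW.
apply: measurable_funM.
  exact: (measurableT_comp mc measurable_fst).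
exact: (measurableT_comp mi measurable_snd).
Qed.

(** * Moments of increments of Ito integrals *)

Section clamp.
Context {R : realType}.

Definition clamp (g x : R) : R := Num.max (- g) (Num.min x g).

Lemma clamp_le (g x : R) : 0 <= g -> `|clamp g x| <= g.
Proof.
move=> g0; rewrite /clamp ler_norml le_max lexx/= ge_max ge_min lexx orbT andbT.
by rewrite (le_trans _ g0)// oppr_le0.
Qed.

(** Clamping is the projection onto [[- g, g]]: no point of that interval is closer to [x]. With [y]
    the bounded integrand, the clamping error is at most the approximation error. *)
Lemma clamp_dist (g x y : R) : `|y| <= g -> `|x - clamp g x| <= `|x - y|.
Proof.
rewrite ler_norml => /andP[gy yg].
have := ler_norm (x - y); have := ler_norm (y - x); rewrite (distrC y).
rewrite ler_norml /clamp /Order.max /Order.min => a b.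
by case: (ltP x g) => h1; case: ltP => h2; apply/andP; split; lra.
Qed.

Lemma measurable_clamp (g : R) : measurable_fun setT (clamp g).
Proof.
by apply: measurable_maxr => //; apply: measurable_minr.
Qed.

End clamp.

Lemma jointly_measurable_section {R : realType} {d : measure_display}
    {T : measurableType d} (X : R -> T -> R) (w : T) : jointly_measurable X ->
  measurable_fun [set: R] (fun u => X u w).
Proof.
move=> mX.
have mw : measurable_fun [set: measurableTypeR R]
    (fun u => (w, u) : T * measurableTypeR R).
  by apply: measurable_fun_pair => //; exact: measurable_cst.
exact: (measurableT_comp mX mw).
Qed.

Section ito_increment.
Context {R : realType} {d : measure_display} {T : measurableType d}.
Variables (P : probability T R) (F : R -> set (set T)) (W : R -> T -> R).
Hypothesis fF : is_filtration F.
Hypothesis bW : brownian_motion P F W.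
Variables (H : R -> T -> R) (gam : R).
Hypothesis mH : jointly_measurable H.
Hypothesis gam0 : 0 <= gam.
Hypothesis H_le : forall u w, `|H u w| <= gam.
Local Notation mu := (@lebesgue_measure R).

Definition sp_dist (t : R) (h : simple_process F t) : \bar R :=
  (\int[P]_w \int[mu]_(u in `[0%R, t]) ((sp_value h u w - H u w) ^+ 2)%R%:E)%E.

Lemma sp_dist_measurable (r t : R) (h : simple_process F t) :
  measurable_fun setT
    (fun w => \int[mu]_(u in `[0%R, r]) ((sp_value h u w - H u w) ^+ 2)%R%:E)%E.
Proof.
apply: (@measurable_integral_section _ _ _ _
  (fun w u => ((sp_value h u w - H u w) ^+ 2)%:E)) => //.
- apply/measurable_EFinP; apply: measurable_funX; apply: measurable_funB => //.
  exact: sp_value_jointly_measurable.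
- by move=> w u; rewrite lee_fin sqr_ge0.
Qed.

(* On the common refinement [tau] of the two partitions, [J] is the transform
   with the coefficients of [h - g] clamped after time [s] and set to [0]
   before it. *)
Lemma ito_increment_approx (s t : R) (h : simple_process F t)
    (g : simple_process F s) : 0 <= s -> s <= t ->
  exists J : T -> R, [/\ measurable_fun setT J,
    (\int[P]_w ((sp_integral W h w - sp_integral W g w - J w) ^+ 2)%:E <=
     sqr_const%:E * (2%:E * sp_dist h + 2%:E * sp_dist g))%E &
    forall theta, (\int[P]_w (expR (theta * J w))%:E <=
      (expR (theta ^+ 2 * (gam ^+ 2 * (t - s)) / 2))%:E)%E].
Proof.
move=> s0 st.
pose pts := map (sp_time h) (iota 0 (sp_size h).+1) ++
            map (sp_time g) (iota 0 (sp_size g).+1).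
pose srt := sort <=%O pts.
pose n := (size srt).-1; pose tau k := nth 0 srt k.
have szE : size srt = n.+1.
  by rewrite /n /srt size_sort /pts size_cat !size_map !size_iota addSn.
have h_pts i : (i <= sp_size h)%N -> sp_time h i \in pts.
  by move=> ih; rewrite mem_cat map_f// mem_iota.
have g_pts i : (i <= sp_size g)%N -> sp_time g i \in pts.
  by move=> ih; rewrite mem_cat orbC map_f// mem_iota.
have pts_itv x : x \in pts -> 0 <= x <= t.
  rewrite mem_cat => /orP[] /mapP[i]; rewrite mem_iota add0n ltnS => /= ih ->.
    by rewrite sp_time_ge0 ?sp_time_le_last.
  by rewrite sp_time_ge0//= (le_trans (sp_time_le_last _) st).
have tau_pts k : (k <= n)%N -> tau k \in pts.
  by move=> kn; rewrite -(mem_sort <=%O) mem_nth// szE.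
have pts_tau x : x \in pts -> exists2 m, (m <= n)%N & x = tau m.
  rewrite -(mem_sort <=%O) => xs; exists (index x srt).
    by rewrite -ltnS -szE index_mem.
  by rewrite /tau nth_index.
have tau_le k : (k < n)%N -> tau k <= tau k.+1.
  move=> kn; have /(sortedP 0) := sort_sorted (@le_total _ R) pts.
  by apply; rewrite -/srt szE ltnS.
have tau0 : 0 <= tau 0%N by have /pts_itv/andP[] := tau_pts 0%N (leq0n n).
have tau_t : tau n <= t by have /pts_itv/andP[] := tau_pts n (leqnn n).
have h_tau i : (i <= sp_size h)%N -> exists2 m, (m <= n)%N & sp_time h i = tau m.
  by move=> /h_pts /pts_tau.
have g_tau i : (i <= sp_size g)%N -> exists2 m, (m <= n)%N & sp_time g i = tau m.
  by move=> /g_pts /pts_tau.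
have [ms msn sE] : exists2 m, (m <= n)%N & s = tau m.
  by have := g_tau _ (leqnn _); rewrite sp_time_last.
have tk k : (k <= n)%N -> 0 <= tau k.
  by move=> kn; have /pts_itv/andP[] := tau_pts k kn.
have ms_le : tau ms <= tau n by rewrite (nondecreasing_upto tau_le)// msn/=.
case: (fF) => sF FM Fm.
pose c k w := sp_value h (tau k.+1) w - sp_value g (tau k.+1) w.
pose ind k : R := (s <= tau k)%R%:R.
pose ct k w := ind k * clamp gam (c k w).
have mc k : (k < n)%N -> measurable_wrt (F (tau k)) (c k).
  move=> kn; apply: measurable_wrtB; first exact/sF/tk/ltnW.
    exact: (sp_value_adapted fF tau_le tau0 h_tau).
  exact: (sp_value_adapted fF tau_le tau0 g_tau).
have mct k : (k < n)%N -> measurable_wrt (F (tau k)) (ct k).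
  move=> kn; have sFk : sigma_algebra setT (F (tau k)) by exact/sF/tk/ltnW.
  apply: measurable_wrtM => //; first exact: measurable_wrt_cst.
  by apply: (measurable_wrt_comp (measurable_clamp gam)); exact: mc.
exists (transform W tau n ct); split.
- apply: (@measurable_wrt_fun _ _ _ (F (tau n))); first exact/FM/tk.
  exact: (transform_adapted fF bW).
- have -> : (fun w => ((sp_integral W h w - sp_integral W g w -
      transform W tau n ct w) ^+ 2)%:E) =
      (fun w => (transform W tau n (fun k w => c k w - ct k w) w ^+ 2)%:E).
    apply/funext => w; congr ((_ ^+ 2)%:E).
    rewrite (sp_integral_grid W tau_le h_tau) (sp_integral_grid W tau_le g_tau).
    by rewrite /transform -!sumrB; apply: eq_bigr => k _; rewrite /c; ring.
  apply: le_trans.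
    apply: (transform_sqr_le fF bW) => // k kn.
    by apply: measurable_wrtB; [exact/sF/tk/ltnW|exact: mc|exact: mct].
  pose Dh w := (\int[mu]_(u in `[0%R, t]) ((sp_value h u w - H u w) ^+ 2)%:E)%E.
  pose Dg w := (\int[mu]_(u in `[0%R, s]) ((sp_value g u w - H u w) ^+ 2)%:E)%E.
  have mDh : measurable_fun setT Dh by exact: sp_dist_measurable.
  have mDg : measurable_fun setT Dg by exact: sp_dist_measurable.
  have Dh0 w : (0 <= Dh w)%E by apply: integral_ge0 => u _; rewrite lee_fin sqr_ge0.
  have Dg0 w : (0 <= Dg w)%E by apply: integral_ge0 => u _; rewrite lee_fin sqr_ge0.
  apply: (@le_trans _ _
      (\int[P]_w (sqr_const%:E * (2%:E * Dh w + 2%:E * Dg w)))%E); last first.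
    rewrite ge0_integralZl//; last 3 first.
    + by apply: emeasurable_funD; apply: emeasurable_funM.
    + by move=> w _; rewrite adde_ge0// mule_ge0.
    + by rewrite lee_fin sqr_const_ge0.
    rewrite ge0_integralD//; last 4 first.
    + by move=> w _; rewrite mule_ge0.
    + exact: emeasurable_funM.
    + by move=> w _; rewrite mule_ge0.
    + exact: emeasurable_funM.
    by rewrite !ge0_integralZl.
  apply: ge0_le_integral => //.
  + move=> w _; rewrite lee_fin sumr_ge0// => -[k kn] _ /=.
    by rewrite mulr_ge0 ?sqr_const_ge0// mulr_ge0 ?sqr_ge0// subr_ge0 tau_le.
  + apply/measurable_EFinP; apply: measurable_sum => -[k kn] /=.
    apply: measurable_funM => //; apply: measurable_funM => //.
    apply: measurable_funX; apply: measurable_wrt_fun.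
      exact/FM/(tk k)/ltnW.
    by apply: measurable_wrtB; [exact/sF/tk/ltnW|exact: mc|exact: mct].
  + apply: emeasurable_funM => //.
    by apply: emeasurable_funD; apply: emeasurable_funM.
  move=> w _.
  under eq_bigr do rewrite mulrC.
  rewrite -mulr_suml mulrC EFinM lee_wpmul2l ?lee_fin ?sqr_const_ge0//.
  (* [Phi] dominates the squared change of the coefficient on every cell. After [s], [g] vanishes
     and the change is the clamping error, at most [h - H]; before [s], the whole coefficient
     [h - g = (h - H) - (g - H)] is dropped. *)
  pose Phi u := 2 * (sp_value h u w - H u w) ^+ 2 +
                2 * ((sp_value g u w - H u w) ^+ 2 * \1_`[0, s] u).
  have mh : measurable_fun setT (fun u => sp_value h u w).
    by apply: jointly_measurable_section; exact: sp_value_jointly_measurable.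
  have mg : measurable_fun setT (fun u => sp_value g u w).
    by apply: jointly_measurable_section; exact: sp_value_jointly_measurable.
  have mHw := jointly_measurable_section w mH.
  have mhH : measurable_fun setT (fun u => (sp_value h u w - H u w) ^+ 2).
    by apply: measurable_funX; exact: measurable_funB.
  have mgH : measurable_fun setT
      (fun u : R => (sp_value g u w - H u w) ^+ 2 * \1_`[0, s] u).
    apply: measurable_funM; last exact: measurable_indic.
    by apply: measurable_funX; exact: measurable_funB.
  have mPhi : measurable_fun setT Phi.
    by apply: measurable_funD; apply: measurable_funM.
  have i0 u : 0 <= \1_`[0, s] u :> R by rewrite indicE.
  have Phi0 u : 0 <= Phi u.
    apply: addr_ge0; apply: mulr_ge0 => //; first exact: sqr_ge0.
    by apply: mulr_ge0 => //; exact: sqr_ge0.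
  have key := @grid_integral_le R tau n (fun k => (c k w - ct k w) ^+ 2) Phi
    tau_le mPhi Phi0 (fun k => sqr_ge0 _) _.
  apply: (le_trans (key _)) => {key}.
    move=> k u kn ku.
    have hE := sp_value_grid tau_le h_tau w kn ku.
    have gE := sp_value_grid tau_le g_tau w kn ku.
    have cE : c k w = sp_value h u w - sp_value g u w by rewrite hE gE.
    case/andP: ku => ku uk.
    rewrite /ct /ind; have [sk|ks] := leP s (tau k).
      rewrite mul1r cE (sp_value_gt g w (le_lt_trans sk ku)) subr0.
      apply: (@le_trans _ _ ((sp_value h u w - H u w) ^+ 2)).
        rewrite -[leLHS]real_normK ?num_real// -[leRHS]real_normK ?num_real//.
        by rewrite lerXn2r ?nnegrE// clamp_dist.
      have := sqr_ge0 (sp_value h u w - H u w).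
      have := mulr_ge0 (sqr_ge0 (sp_value g u w - H u w)) (i0 u).
      rewrite /Phi; lra.
    (* [s] is a node of [tau], so a cell that starts before [s] ends by [s]. *)
    have us : u <= s.
      have [|h2] := grid_dichotomy tau_le msn kn; first by rewrite -sE leNgt ks.
      by rewrite sE (le_trans uk).
    have u0 : 0 <= u by rewrite (le_trans (tk _ (ltnW kn)))// ltW.
    rewrite mul0r subr0 cE /Phi indicE mem_setE in_itv/= u0 us mulr1.
    have := sqr_ge0 ((sp_value h u w - H u w) + (sp_value g u w - H u w)); nra.
  have sub : `]tau 0%N, tau n] `<=` `[0, t].
    move=> u /=; rewrite !in_itv/= => /andP[a b].
    by rewrite (le_trans tau0 (ltW a)) (le_trans b).
  apply: (@le_trans _ _ (\int[mu]_(u in `[0%R, t]) (Phi u)%:E)%E).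
    apply: ge0_subset_integral => //.
    - by apply: measurable_funTS; exact/measurable_EFinP.
    - by move=> u _; rewrite lee_fin.
  rewrite /Phi.
  have mhH' : measurable_fun `[0, t] (fun u : measurableTypeR R =>
      ((sp_value h u w - H u w) ^+ 2)%:E).
    by apply: measurable_funTS; exact/measurable_EFinP.
  have mgH' : measurable_fun `[0, t] (fun u : measurableTypeR R =>
      ((sp_value g u w - H u w) ^+ 2 * \1_`[0, s] u)%:E).
    by apply: measurable_funTS; exact/measurable_EFinP.
  under eq_integral do rewrite EFinD (EFinM 2) (EFinM 2).
  rewrite ge0_integralD//; last 4 first.
  - by move=> u _; rewrite mule_ge0// lee_fin sqr_ge0.
  - exact: emeasurable_funM.
  - by move=> u _; rewrite mule_ge0// lee_fin mulr_ge0// sqr_ge0.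
  - exact: emeasurable_funM.
  have p1 (u : R) : (0 <= ((sp_value h u w - H u w) ^+ 2)%:E)%E.
    by rewrite lee_fin sqr_ge0.
  have p2 (u : R) : (0 <= ((sp_value g u w - H u w) ^+ 2 * \1_`[0, s] u)%:E)%E.
    by rewrite lee_fin mulr_ge0// sqr_ge0.
  rewrite !ge0_integralZl//.
  rewrite [X in (_ + 2%:E * X <= _)%E](_ : _ = Dg w)//.
  rewrite [LHS]integral_mul_indic /Dg [RHS]integral_mul_indic.
  apply: eq_integral => u _; rewrite -!EFinM -mulrA; congr ((_ * _)%:E).
  rewrite !indicE !mem_setE !in_itv/=.
  have [/= us|] := leP u s; last by rewrite andbF mul0r.
  by rewrite (le_trans us st) andbT; case: (0 <= u); rewrite ?mulr1 ?mulr0.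
- move=> theta.
  (* The factor [ind k] in the bound keeps only the cells after [s], whose lengths add up to at most
     [t - s]. *)
  have ctg k w : (k < n)%N -> `|ct k w| <= ind k * gam.
    by move=> kn; rewrite normrM /ind normr_nat ler_wpM2l// clamp_le.
  apply: (le_trans (transform_exp_le fF bW tau0 theta tau_le mct ctg)).
  rewrite lee_fin ler_expR ler_pM2r// ler_wpM2l ?sqr_ge0//.
  apply: (@le_trans _ _ (gam ^+ 2 * (tau n - tau ms))); last first.
    by rewrite ler_wpM2l ?sqr_ge0// -sE lerB.
  rewrite -(grid_increment tau_le id msn (leqnn n) ms_le) mulr_sumr.
  apply: ler_sum => -[k kn] _ /=.
  rewrite exprMn mulrAC mulrC ler_wpM2l ?sqr_ge0//.
  have d0 : 0 <= tau k.+1 - tau k by rewrite subr_ge0 tau_le.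
  rewrite /ind; have [sk|_] := leP s (tau k); last first.
    by rewrite expr0n mul0r mulr_ge0// indicE.
  rewrite expr1n mul1r indicE mem_setE in_itv/= -sE.
  have -> : tau k.+1 <= tau n by rewrite (nondecreasing_upto tau_le)// kn leqnn.
  rewrite andbT; have [_|h2] := ltP s (tau k.+1); first by rewrite mul1r.
  by rewrite mul0r subr_le0 (le_trans h2).
Qed.

End ito_increment.

(** * Moments from exponential bounds and L^2 limits *)

Section moments.
Context {R : realType} {d : measure_display} {T : measurableType d}.
Variable P : probability T R.

Definition exp_moment_const (p : nat) : R := p%:R ^+ p * (2 * expR (1 / 2)).

Lemma exp_moment_const_ge0 p : 0 <= exp_moment_const p.
Proof. by rewrite mulr_ge0 ?exprn_ge0// mulr_ge0 ?expR_ge0. Qed.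

(** The hypothesis is used at [theta = v^-1] and [theta = - v^-1], where its bound is
    [expR (1 / 2)]; powers are dominated by these two exponentials. *)
Lemma moment_of_exp_le (J : T -> R) (v : R) (p : nat) : 0 < v ->
  measurable_fun setT J ->
  (forall theta, (\int[P]_w (expR (theta * J w))%:E <=
     (expR (theta ^+ 2 * v ^+ 2 / 2))%:E)%E) ->
  (\int[P]_w (`|J w| ^+ p)%:E <= (exp_moment_const p * v ^+ p)%:E)%E.
Proof.
move=> v0 mJ exp_le.
have me a : measurable_fun setT (fun w => (expR (a * J w))%:E).
  by apply/measurable_EFinP; apply: measurableT_comp => //; exact: measurable_funM.
have k0 : 0 <= v ^+ p * p%:R ^+ p by rewrite mulr_ge0 ?exprn_ge0// ltW.
apply: (@le_trans _ _ (\int[P]_w ((v ^+ p * p%:R ^+ p)%:E *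
    ((expR (v^-1 * J w))%:E + (expR (- v^-1 * J w))%:E)))%E).
  apply: ge0_le_integral => //.
  - apply/measurable_EFinP; apply: measurable_funX.
    exact: measurableT_comp.
  - by apply: emeasurable_funM => //; exact: emeasurable_funD.
  - move=> w _; rewrite -EFinD -EFinM lee_fin mulNr.
    have := normr_exprn_le_expR (v^-1 * J w) p.
    rewrite normrM ger0_norm ?invr_ge0 ?(ltW v0)// exprMn exprVn.
    rewrite ler_pdivrMl ?exprn_gt0//.
    by rewrite mulrA.
rewrite ge0_integralZl//; last 2 first.
- exact: emeasurable_funD.
- by move=> w _; rewrite adde_ge0// lee_fin expR_ge0.
rewrite ge0_integralD//.
apply: (@le_trans _ _ ((v ^+ p * p%:R ^+ p)%:E *
    ((expR (1 / 2))%:E + (expR (1 / 2))%:E))%E).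
  rewrite lee_wpmul2l// leeD//; apply: (le_trans (exp_le _)).
    by rewrite lee_fin ler_expR exprVn mulVf// expf_neq0// gt_eqF.
  by rewrite lee_fin ler_expR sqrrN exprVn mulVf// expf_neq0// gt_eqF.
rewrite -EFinD -EFinM lee_fin /exp_moment_const.
by apply: eq_lexx; ring.
Qed.

(** Either the truncated value [m] is at most [2 * |z|], or [z] is so small that [m <= 2 * |y - z|];
    then two factors of [m] are paid by the square and the other [p] by the level [k]. Thus an L^2
    estimate of [y - z] controls higher moments. *)
Lemma trunc_exprn_le (k p : nat) (y z : R) :
  Num.min `|y| k%:R ^+ p.+2 <=
  2 ^+ p.+2 * `|z| ^+ p.+2 + 4 * k%:R ^+ p * (y - z) ^+ 2.
Proof.
set m := Num.min _ _.
have m0 : 0 <= m by rewrite /m le_min normr_ge0 ler0n.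
have mk : m <= k%:R by rewrite /m ge_min lexx orbT.
have my : m <= `|y| by rewrite /m ge_min lexx.
have [h|h] := leP m (2 * `|z|).
  apply: (@le_trans _ _ (2 ^+ p.+2 * `|z| ^+ p.+2)).
    by rewrite -exprMn lerXn2r ?nnegrE// mulr_ge0.
  by rewrite lerDl mulr_ge0 ?sqr_ge0// mulr_ge0// exprn_ge0.
have myz : m <= 2 * `|y - z|.
  have := lerB_dist y z; have := normr_ge0 z; lra.
apply: (@le_trans _ _ (4 * k%:R ^+ p * (y - z) ^+ 2)); last first.
  by rewrite lerDr mulr_ge0 ?exprn_ge0.
rewrite -addn2 exprD (mulrC 4) -mulrA ler_pM ?exprn_ge0//.
  by rewrite lerXn2r ?nnegrE.
rewrite -(real_normK (num_real (y - z))).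
have -> : 4 * `|y - z| ^+ 2 = (2 * `|y - z|) ^+ 2 by ring.
by rewrite lerXn2r ?nnegrE// mulr_ge0.
Qed.

Lemma moment_of_trunc_le (Y : T -> R) (p : nat) (B : \bar R) :
  measurable_fun setT Y ->
  (forall k : nat, (\int[P]_w (Num.min `|Y w| k%:R ^+ p)%:E <= B)%E) ->
  (\int[P]_w (`|Y w| ^+ p)%:E <= B)%E.
Proof.
move=> mY trunc_le.
pose g (k : nat) w := (Num.min `|Y w| k%:R ^+ p)%:E.
have m0 (k : nat) w : 0 <= Num.min `|Y w| k%:R by rewrite le_min normr_ge0 ler0n.
have mg k : measurable_fun setT (g k).
  apply/measurable_EFinP; apply: measurable_funX; apply: measurable_minr => //.
  exact: measurableT_comp.
have := @cvg_monotone_convergence _ _ _ P setT measurableT g mg _ _.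
rewrite (eq_integral (fun w => (`|Y w| ^+ p)%:E)); last first.
  move=> w _; apply/cvg_lim => //; apply: cvg_near_cst; near=> k.
  rewrite /g; congr ((_ ^+ _)%:E); apply/min_idPl.
  near: k; exists (Num.truncn `|Y w|).+1 => // k /= hk.
  by apply: (le_trans (ltW (truncnS_gt _))); rewrite ler_nat.
move=> h; apply: (cvge_le _ (h _ _)).
- by near=> k; exact: trunc_le.
- by move=> k w _; rewrite lee_fin exprn_ge0.
- move=> w _ j k jk; rewrite lee_fin lerXn2r ?nnegrE//.
  by rewrite le_min !ge_min lexx/= ler_nat jk orbT.
Unshelve. all: by end_near. Qed.

End moments.

Section ito_moment.
Context {R : realType} {d : measure_display} {T : measurableType d}.
Variables (P : probability T R) (F : R -> set (set T)) (W : R -> T -> R).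
Hypothesis fF : is_filtration F.
Hypothesis bW : brownian_motion P F W.
Variables (H : R -> T -> R) (gam : R).
Hypothesis mH : jointly_measurable H.
Hypothesis gam0 : 0 < gam.
Hypothesis H_le : forall u w, `|H u w| <= gam.

Lemma sp_integral_measurable (t : R) (h : simple_process F t) :
  measurable_fun setT (sp_integral W h).
Proof.
case: (fF) => _ FM _; apply: measurable_sum => -[i ih] /=.
apply: measurable_funM.
  by apply: measurable_wrt_fun (sp_coef_adapted ih); apply/FM/sp_time_ge0/ltnW.
by apply: measurable_funB; apply: (brownian_measurable fF bW); apply: sp_time_ge0 => //; exact: ltnW.
Qed.

(** The index [p.+1] appears because the moment of order [p] is deduced from the one of order
    [p.+1]. *)
Definition ito_moment_const (p : nat) : R :=
  1 + 2 ^+ p.+1 * exp_moment_const p.+1.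

Lemma ito_moment_const_gt0 p : 0 < ito_moment_const p.
Proof. by rewrite ltr_pwDl// mulr_ge0 ?exprn_ge0 ?exp_moment_const_ge0. Qed.

Lemma sqr_integral_add3_le (a b c : T -> R) :
  measurable_fun setT a -> measurable_fun setT b -> measurable_fun setT c ->
  (\int[P]_w ((a w + b w + c w) ^+ 2)%:E <=
   3%:E * (\int[P]_w (a w ^+ 2)%:E + \int[P]_w (b w ^+ 2)%:E +
           \int[P]_w (c w ^+ 2)%:E))%E.
Proof.
move=> ma mb mc.
have m2 (f : T -> R) : measurable_fun setT f -> measurable_fun setT (fun w => (f w ^+ 2)%:E).
  by move=> mf; apply/measurable_EFinP; exact: measurable_funX.
have p2 (f : T -> R) w : (0 <= (f w ^+ 2)%:E)%E by rewrite lee_fin sqr_ge0.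
have mab : measurable_fun setT (fun w => ((a w ^+ 2)%:E + (b w ^+ 2)%:E)%E).
  by apply: emeasurable_funD; exact: m2.
have mabc : measurable_fun setT
    (fun w => ((a w ^+ 2)%:E + (b w ^+ 2)%:E + (c w ^+ 2)%:E)%E).
  by apply: emeasurable_funD => //; exact: m2.
rewrite -ge0_integralD//; [|exact: m2|exact: m2].
rewrite -ge0_integralD//; [|by move=> w _; rewrite adde_ge0|exact: m2].
rewrite -ge0_integralZl//; last by move=> w _; rewrite !adde_ge0.
apply: ge0_le_integral => //.
- by move=> w _; rewrite lee_fin sqr_ge0.
- apply: (m2 (fun w => a w + b w + c w)).
  by apply: measurable_funD => //; exact: measurable_funD.
- by apply: emeasurable_funM.
- move=> w _; rewrite -!EFinD -EFinM lee_fin.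
  have := sqr_ge0 (a w - b w); have := sqr_ge0 (a w - c w).
  have := sqr_ge0 (b w - c w); nra.
Qed.

(** The simple integrals converge in L^2 only. The difference [I - I'] is truncated at a level [k]
    and compared with the sub-Gaussian [J] of the n-th approximation; first [n], then [k] tends to
    infinity. *)
Lemma ito_increment_moment_le (s t : R) (p : nat) (I I' : T -> R) :
  0 <= s -> s < t ->
  is_ito_integral P F W H t I -> is_ito_integral P F W H s I' ->
  (\int[P]_w (`|I w - I' w| ^+ p.+1)%:E <=
   (ito_moment_const p.+1 * (gam * Num.sqrt (t - s)) ^+ p.+1)%:E)%E.
Proof.
move=> s0 st [mI [h [hH hI]]] [mI' [g [gH gI]]].
set v := gam * Num.sqrt (t - s).
have v0 : 0 < v by rewrite mulr_gt0// sqrtr_gt0 subr_gt0.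
have vE : v ^+ 2 = gam ^+ 2 * (t - s).
  by rewrite exprMn sqr_sqrtr// subr_ge0 ltW.
pose Y w := I w - I' w.
have mY : measurable_fun setT Y by exact: measurable_funB.
have mYn : measurable_fun setT (fun w => `|Y w|) by exact: measurableT_comp.
pose B := 2 ^+ p.+2 * (exp_moment_const p.+2 * v ^+ p.+2).
have moment2 : (\int[P]_w (`|Y w| ^+ p.+2)%:E <= B%:E)%E.
  apply: moment_of_trunc_le => // k.
  pose a n := (\int[P]_w ((sp_integral W (h n) w - I w) ^+ 2)%:E)%E.
  pose b n := (\int[P]_w ((sp_integral W (g n) w - I' w) ^+ 2)%:E)%E.
  have a0 : a n @[n --> \oo] --> 0%E by move: hI; rewrite unlock.
  have b0 : b n @[n --> \oo] --> 0%E by move: gI; rewrite unlock.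
  (* Three errors separate [I - I'] from [J]: the L^2 errors of the two approximations and the
     change of the coefficients. *)
  pose err n := (3%:E * (a n + b n +
    sqr_const%:E * (2%:E * sp_dist P H (h n) + 2%:E * sp_dist P H (g n))))%E.
  have err0 : err n @[n --> \oo] --> 0%E.
    have -> : 0%E = (3%:E * (0 + 0 + sqr_const%:E * (2%:E * 0 + 2%:E * 0)))%E :> \bar R.
      by rewrite !mule0 !adde0 mule0 adde0 mule0.
    apply: cvgeZl => //; apply: cvgeD; first by rewrite !mule0 !adde0 mule0.
      by apply: cvgeD.
    apply: cvgeZl => //; apply: cvgeD; first by rewrite !mule0.
      by apply: cvgeZl.
    by apply: cvgeZl.
  have bound n : (\int[P]_w (Num.min `|Y w| k%:R ^+ p.+2)%:E <=
      B%:E + (4 * k%:R ^+ p)%:E * err n)%E.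
    have [J [mJ J2 Jexp]] :=
      ito_increment_approx fF bW mH (ltW gam0) H_le (h n) (g n) s0 (ltW st).
    have mh := sp_integral_measurable (h n).
    have mg := sp_integral_measurable (g n).
    have mYJ : measurable_fun setT (fun w => ((Y w - J w) ^+ 2)%:E).
      by apply/measurable_EFinP; apply: measurable_funX; exact: measurable_funB.
    have mJp : measurable_fun setT (fun w => (`|J w| ^+ p.+2)%:E).
      by apply/measurable_EFinP; apply: measurable_funX; exact: measurableT_comp.
    have k0 : 0 <= 4 * k%:R ^+ p :> R by rewrite mulr_ge0// exprn_ge0.
    apply: (@le_trans _ _ (\int[P]_w ((2 ^+ p.+2)%:E * (`|J w| ^+ p.+2)%:E +
        (4 * k%:R ^+ p)%:E * ((Y w - J w) ^+ 2)%:E))%E).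
      apply: ge0_le_integral => //.
      - apply/measurable_EFinP; apply: measurable_funX; exact: measurable_minr.
      - by apply: emeasurable_funD; apply: emeasurable_funM.
      - by move=> w _; rewrite -!EFinM -EFinD lee_fin trunc_exprn_le.
    have k0' : (0 <= (4 * k%:R ^+ p)%:E :> \bar R)%E by rewrite lee_fin.
    have J0 w : (0 <= (`|J w| ^+ p.+2)%:E)%E by rewrite lee_fin exprn_ge0.
    have YJ0 w : (0 <= ((Y w - J w) ^+ 2)%:E)%E by rewrite lee_fin sqr_ge0.
    have c0 : (0 <= (2 ^+ p.+2)%:E :> \bar R)%E by rewrite lee_fin exprn_ge0.
    rewrite ge0_integralD//; last 3 first.
    - exact: emeasurable_funM.
    - by move=> w _; rewrite mule_ge0.
    - exact: emeasurable_funM.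
    rewrite !ge0_integralZl//.
    apply: leeD.
      rewrite /B (EFinM (2 ^+ p.+2) (_ * _)) lee_wpmul2l //.
      apply: moment_of_exp_le => // theta; apply: le_trans (Jexp theta) _.
      by rewrite vE.
    rewrite lee_wpmul2l ?lee_fin//.
    rewrite (eq_integral (fun w => (((I w - sp_integral W (h n) w) +
      (sp_integral W (g n) w - I' w) +
      (sp_integral W (h n) w - sp_integral W (g n) w - J w)) ^+ 2)%:E)); last first.
      by move=> w _; congr ((_ ^+ 2)%:E); rewrite /Y; ring.
    apply: le_trans (sqr_integral_add3_le _ _ _) _.
    - exact: measurable_funB.
    - exact: measurable_funB.
    - by apply: measurable_funB => //; exact: measurable_funB.
    rewrite lee_wpmul2l// leeD// leeD//.
    by under eq_integral do rewrite -sqrrN opprB.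
  (* The level [k] is fixed here, so its power is a constant factor of an error that tends to
     zero. *)
  have lim : (B%:E + (4 * k%:R ^+ p)%:E * err n)%E @[n --> \oo] --> B%:E.
    rewrite -[X in _ --> X]adde0; apply: cvgeD => //; first exact: cvg_cst.
    by rewrite -[X in _ --> X](mule0 (4 * k%:R ^+ p)%:E); apply: cvgeZl.
  by apply: (cvge_ge _ lim); near=> n; exact: bound.
have vp n : 0 <= v ^+ n by rewrite exprn_ge0// ltW.
(* [trunc_exprn_le] starts at exponent 2. Order [p.+1] follows from order [p.+2] by separating the
   values of |Y| up to [v] from those above [v]. *)
apply: (@le_trans _ _ (\int[P]_w ((v ^+ p.+1)%:E +
    (v^-1)%:E * (`|Y w| ^+ p.+2)%:E))%E).
  apply: ge0_le_integral => //.
  - by apply/measurable_EFinP; exact: measurable_funX.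
  - apply: emeasurable_funD => //; apply: emeasurable_funM => //.
    by apply/measurable_EFinP; exact: measurable_funX.
  - move=> w _; rewrite -EFinM -EFinD lee_fin -/(Y w).
    have [h1|h1] := leP `|Y w| v.
      rewrite (@le_trans _ _ (v ^+ p.+1))// ?lerXn2r ?nnegrE// ?(ltW v0)//.
      by rewrite lerDl mulr_ge0 ?exprn_ge0// invr_ge0 ltW.
    rewrite (@le_trans _ _ (v^-1 * `|Y w| ^+ p.+2))// ?lerDr//.
    by rewrite ler_pdivlMl// (exprS _ p.+1) ler_wpM2r ?exprn_ge0// ltW.
have Yp0 w : (0 <= (`|Y w| ^+ p.+2)%:E)%E by rewrite lee_fin exprn_ge0.
have mYp : measurable_fun setT (fun w => (`|Y w| ^+ p.+2)%:E).
  by apply/measurable_EFinP; exact: measurable_funX.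
have vi0 : (0 <= (v^-1)%:E)%E by rewrite lee_fin invr_ge0 ltW.
rewrite ge0_integralD//; last 3 first.
- by move=> w _; rewrite lee_fin.
- by move=> w _; rewrite mule_ge0.
- exact: emeasurable_funM.
have P1 : P setT = 1%E by exact: probability_setT.
rewrite integral_cst//= P1 mule1 ge0_integralZl//.
apply: (@le_trans _ _ ((v ^+ p.+1)%:E + (v^-1)%:E * B%:E)%E).
  by rewrite leeD2l// lee_wpmul2l// lee_fin invr_ge0 ltW.
rewrite -EFinM -EFinD lee_fin /B /ito_moment_const mulrDl mul1r lerD2l.
rewrite ler_pdivrMl// (exprS v p.+1).
by apply: eq_lexx; ring.
Unshelve. all: by end_near. Qed.

End ito_moment.

(** * Exponentially discounted integrals *)

(** The tangent at [m] to a convex power. The induction multiplies by [h] and adds the nonnegative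
    term [q.+1%:R * m ^+ q * (h - m) ^+ 2]. *)
Lemma exprn_tangent_le {R : realType} (m h : R) (q : nat) : 0 <= m -> 0 <= h ->
  q.+1%:R * m ^+ q * h <= h ^+ q.+1 + q%:R * m ^+ q.+1.
Proof.
move=> m0 h0; elim: q => [|q IH]; first by rewrite expr0 mulr1 !mul1r mul0r addr0.
have := ler_wpM2r h0 IH; rewrite mulrDl -!exprSr => h1.
have h2 : 0 <= q.+1%:R * m ^+ q * (h - m) ^+ 2.
  by rewrite mulr_ge0 ?sqr_ge0// mulr_ge0// exprn_ge0.
rewrite -subr_ge0; move: h1; rewrite -subr_ge0 => h1.
apply: le_trans (addr_ge0 h1 h2) _.
apply: eq_lexx.
rewrite -!natr1 !exprS; ring.
Qed.

(** Sum of the tangent inequalities at [a + b] for [2 * a] and [2 * b]. The 2 under the power and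
    the half outside are what makes a contraction possible. *)
Lemma exprn_midpoint_le {R : realType} (a b : R) (q : nat) : 0 <= a -> 0 <= b ->
  (a + b) ^+ q.+1 <= ((2 * a) ^+ q.+1 + (2 * b) ^+ q.+1) / 2.
Proof.
move=> a0 b0.
have m0 : 0 <= a + b by rewrite addr_ge0.
have := exprn_tangent_le q m0 (mulr_ge0 (ler0n R 2) a0).
have := exprn_tangent_le q m0 (mulr_ge0 (ler0n R 2) b0).
rewrite ler_pdivlMr// => h1 h2; have := lerD h1 h2.
have -> : q.+1%:R * (a + b) ^+ q * (2 * b) + q.+1%:R * (a + b) ^+ q * (2 * a) =
   2 * q.+1%:R * (a + b) ^+ q.+1 by rewrite exprS; ring.
rewrite -natr1; lra.
Qed.

Section jensen.
Local Open Scope ereal_scope.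
Context {R : realType} {d : measure_display} {T : measurableType d}.
Variable mu : {measure set T -> \bar R}.

(* Integrate the tangent inequality at [m] against the weight [wt]. *)
Lemma jensen_exprn (D : set T) (wt h : T -> R) (m : R) (q : nat) :
  measurable D -> measurable_fun D wt -> measurable_fun D h ->
  (forall u, D u -> 0 <= wt u)%R -> (forall u, D u -> 0 <= h u)%R ->
  \int[mu]_(u in D) (wt u)%:E <= 1 -> (0 <= m)%R ->
  m%:E <= \int[mu]_(u in D) (wt u * h u)%:E ->
  (m ^+ q.+1)%:E <= \int[mu]_(u in D) (wt u * h u ^+ q.+1)%:E.
Proof.
move=> mD mwt mh wt0 h0 wt1 m0 mint.
have c0 : (0 <= q.+1%:R * m ^+ q)%R by rewrite mulr_ge0 ?exprn_ge0.
have e0 : (0 <= q%:R * m ^+ q.+1)%R by rewrite mulr_ge0 ?exprn_ge0.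
have mwh : measurable_fun D (fun u => (wt u * h u)%:E).
  by apply/measurable_EFinP; exact: measurable_funM.
have mwp : measurable_fun D (fun u => (wt u * h u ^+ q.+1)%:E).
  by apply/measurable_EFinP; apply: measurable_funM => //; exact: measurable_funX.
have mw : measurable_fun D (fun u => (wt u)%:E) by exact/measurable_EFinP.
have mR : measurable_fun D
    (fun u => (wt u * h u ^+ q.+1)%:E + (q%:R * m ^+ q.+1)%:E * (wt u)%:E).
  by apply: emeasurable_funD => //; exact: emeasurable_funM.
have wh0 u : D u -> 0 <= (wt u * h u)%:E.
  by move=> Du; rewrite lee_fin mulr_ge0 ?wt0 ?h0.
have wp0 u : D u -> 0 <= (wt u * h u ^+ q.+1)%:E.
  by move=> Du; rewrite lee_fin mulr_ge0 ?wt0// exprn_ge0// h0.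
have w0 u : D u -> 0 <= (wt u)%:E by move=> Du; rewrite lee_fin wt0.
have : (q.+1%:R * m ^+ q)%:E * \int[mu]_(u in D) (wt u * h u)%:E <=
    \int[mu]_(u in D) (wt u * h u ^+ q.+1)%:E +
    (q%:R * m ^+ q.+1)%:E * \int[mu]_(u in D) (wt u)%:E.
  rewrite -!ge0_integralZl//.
  rewrite -ge0_integralD//; last 2 first.
  - by move=> u Du; rewrite mule_ge0 ?w0.
  - exact: emeasurable_funM.
  apply: ge0_le_integral => //.
  - by move=> u Du; rewrite mule_ge0 ?wh0.
  - exact: emeasurable_funM.
  - move=> u Du; rewrite -!EFinM -EFinD lee_fin.
    have := ler_wpM2l (wt0 _ Du) (exprn_tangent_le q m0 (h0 _ Du)).
    set A := (m ^+ q)%R; set B := (h u ^+ q.+1)%R; set C := (m ^+ q.+1)%R.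
    congr (is_true (_ <= _)%R); ring.
move=> key.
(* Mass at most one suffices: the mass multiplies the constant term of the tangent, which stands on
   the larger side. *)
have key2 : (q.+1%:R * m ^+ q.+1)%:E <=
    \int[mu]_(u in D) (wt u * h u ^+ q.+1)%:E + (q%:R * m ^+ q.+1)%:E.
  apply: (@le_trans _ _ ((q.+1%:R * m ^+ q)%:E * m%:E)).
    by rewrite -EFinM lee_fin exprSr mulrA.
  apply: le_trans (lee_wpmul2l _ mint) _; first by rewrite lee_fin.
  apply: le_trans key _; rewrite leeD2l//.
  by rewrite -[leRHS]mule1 lee_wpmul2l// lee_fin.
have := leeB key2 (lexx (q%:R * m ^+ q.+1)%:E).
rewrite addeK// => /(le_trans _); apply.
by rewrite -EFinB lee_fin -natr1 mulrDl mul1r addrAC subrr add0r.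
Qed.

End jensen.

Section disc.
Context {R : realType}.
Local Notation mu := (@lebesgue_measure R).

(** The kernel of the linear equation [y' = a * (h - y)]. The leading factor [a] normalises its mass
    over [[0, t]] to at most one, as Jensen's inequality requires. *)
Definition disc_weight (a t u : R) : R := a * expR (- (a * (t - u))).

Definition disc (a t : R) (h : R -> R) : R :=
  \int[mu]_(u in `[0, t]) (disc_weight a t u * h u).

Lemma disc_weight_ge0 a t u : 0 <= a -> 0 <= disc_weight a t u.
Proof. by move=> a0; rewrite mulr_ge0// expR_ge0. Qed.

Lemma continuous_disc_weight a t : continuous (disc_weight a t).
Proof.
move=> u; apply: cvgM; first exact: cvg_cst.
apply: continuous_cvg; first exact: continuous_expR.
apply: cvgN; apply: cvgM; first exact: cvg_cst.
by apply: cvgB; [exact: cvg_cst|exact: cvg_id].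
Qed.

Lemma measurable_disc_weight a t : measurable_fun setT (disc_weight a t).
Proof. by apply: continuous_measurable_fun; exact: continuous_disc_weight. Qed.

Lemma integral_disc_weight (a t : R) : 0 <= t ->
  (\int[mu]_(u in `[0%R, t]) (disc_weight a t u)%:E = (1 - expR (- (a * t)))%:E)%E.
Proof.
rewrite le_eqVlt => /predU1P[<-|t0].
  by rewrite set_itv1 integral_set1 mulr0 oppr0 expR0 subrr.
pose Fw (u : R) := expR (- (a * (t - u))).
have dF (u : R) : is_derive u 1 Fw (disc_weight a t u).
  rewrite /Fw /disc_weight.
  apply: is_derive_eq; rewrite /GRing.scale/=; ring.
have cF : continuous Fw.
  move=> u; apply/differentiable_continuous/derivable1_diffP.
  by have [] := dF u.
rewrite (@continuous_FTC2 _ _ Fw)//.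
- by rewrite /Fw subrr mulr0 oppr0 expR0 addr0.
- by apply: continuous_subspaceT; exact: continuous_disc_weight.
- split.
  + by move=> u _; have [] := dF u.
  + by apply: cvg_at_right_filter; exact: cF.
  + by apply: cvg_at_left_filter; exact: cF.
- by move=> u _; rewrite derive1E; exact: derive_val.
Qed.

Lemma integral_disc_weight_le1 (a t : R) : 0 <= t ->
  (\int[mu]_(u in `[0%R, t]) (disc_weight a t u)%:E <= 1)%E.
Proof.
by move=> t0; rewrite integral_disc_weight// lee_fin gerBl expR_ge0.
Qed.

Lemma disc_cst (a t c : R) : 0 <= t ->
  disc a t (fun=> c) = (1 - expR (- (a * t))) * c.
Proof.
move=> t0; rewrite /disc RintegralZr//.
  by rewrite /Rintegral integral_disc_weight.
apply: continuous_compact_integrable; first exact: segment_compact.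
by apply: continuous_subspaceT; exact: continuous_disc_weight.
Qed.

End disc.

Section disc_process.
Context {R : realType} {d : measure_display} {T : measurableType d}.
Variable P : probability T R.
Local Notation mu := (@lebesgue_measure R).

Lemma jointly_measurable_at (X : R -> T -> R) (u : R) :
  jointly_measurable X -> measurable_fun setT (X u).
Proof.
move=> mX.
have mw : measurable_fun setT (fun w => (w, u) : T * measurableTypeR R).
  by apply: measurable_fun_pair => //; exact: measurable_cst.
exact: (measurableT_comp mX mw).
Qed.

Lemma jointly_measurable_deterministic (f : R -> R) : measurable_fun setT f ->
  jointly_measurable (fun u (_ : T) => f u).
Proof.
move=> mf; have mf' : measurable_fun [set: measurableTypeR R] f by exact: mf.
exact: (measurableT_comp mf' measurable_snd).
Qed.

Lemma jointly_measurable_Rintegral (D : set R) (X : R -> T -> R) :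
  measurable D -> jointly_measurable X ->
  measurable_fun setT (fun w => \int[mu]_(u in D) X u w).
Proof.
move=> mD mX; rewrite /Rintegral.
apply: measurableT_comp => //.
under eq_fun do rewrite integralE.
have mp : measurable_fun [set: T * measurableTypeR R] (fun z => (X z.2 z.1)%:E).
  exact/measurable_EFinP.
have h1 : measurable_fun setT
    (fun w => \int[mu]_(u in D) ((fun u => (X u w)%:E)^\+ u))%E.
  apply: (@measurable_integral_section _ _ _ _
    (fun w u => (fun u => (X u w)%:E)^\+ u)%E) => //.
  have -> : (fun z : T * measurableTypeR R => (fun u => (X u z.1)%:E)^\+ z.2)%E =
      ((fun z => (X z.2 z.1)%:E)^\+)%E.
    by apply/funext => z; rewrite !funeposE.
  exact: measurable_funepos.
have h2 : measurable_fun setT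
    (fun w => \int[mu]_(u in D) ((fun u => (X u w)%:E)^\- u))%E.
  apply: (@measurable_integral_section _ _ _ _
    (fun w u => (fun u => (X u w)%:E)^\- u)%E) => //.
  have -> : (fun z : T * measurableTypeR R => (fun u => (X u z.1)%:E)^\- z.2)%E =
      ((fun z => (X z.2 z.1)%:E)^\-)%E.
    by apply/funext => z; rewrite !funenegE.
  exact: measurable_funeneg.
exact: (emeasurable_funB h1 h2).
Qed.

Lemma jointly_measurableM (X Y : R -> T -> R) :
  jointly_measurable X -> jointly_measurable Y ->
  jointly_measurable (fun u w => X u w * Y u w).
Proof. by move=> mX mY; exact: measurable_funM. Qed.

Lemma jointly_measurableX (X : R -> T -> R) n :
  jointly_measurable X -> jointly_measurable (fun u w => X u w ^+ n).
Proof. by move=> mX; exact: measurable_funX. Qed.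

Lemma jointly_measurableD (X Y : R -> T -> R) :
  jointly_measurable X -> jointly_measurable Y ->
  jointly_measurable (fun u w => X u w + Y u w).
Proof. by move=> mX mY; exact: measurable_funD. Qed.

Lemma jointly_measurableB (X Y : R -> T -> R) :
  jointly_measurable X -> jointly_measurable Y ->
  jointly_measurable (fun u w => X u w - Y u w).
Proof. by move=> mX mY; exact: measurable_funB. Qed.

Lemma jointly_measurable_comp (f : R -> R) (X : R -> T -> R) :
  measurable_fun setT f -> jointly_measurable X ->
  jointly_measurable (fun u w => f (X u w)).
Proof. by move=> mf mX; exact: (measurableT_comp mf mX). Qed.

Lemma measurable_disc (a t : R) (X : R -> T -> R) : jointly_measurable X ->
  measurable_fun setT (fun w => disc a t (X^~ w)).
Proof.
move=> mX; apply: (@jointly_measurable_Rintegral _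
  (fun u w => disc_weight a t u * X u w)) => //.
apply: jointly_measurableM => //; apply: jointly_measurable_deterministic.
exact: measurable_disc_weight.
Qed.

(** Jensen's inequality in [u], then Tonelli. Since the mass is at most one, the bound [B] passes
    through with no extra constant. *)
Lemma disc_moment_le (a t B : R) (X : R -> T -> R) (q : nat) :
  0 < a -> 0 <= t -> 0 <= B -> jointly_measurable X ->
  (forall u w, 0 <= X u w) ->
  (forall u, 0 <= u <= t -> (\int[P]_w (X u w ^+ q.+1)%:E <= B%:E)%E) ->
  (\int[P]_w (disc a t (X^~ w) ^+ q.+1)%:E <= B%:E)%E.
Proof.
move=> a0 t0 B0 mX X0 XB.
have w0 u : 0 <= disc_weight a t u by rewrite disc_weight_ge0 ?ltW.
have disc0 w : 0 <= disc a t (X^~ w).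
  by apply: Rintegral_ge0 => u _; rewrite mulr_ge0.
have mwt : measurable_fun setT (disc_weight a t) by exact: measurable_disc_weight.
have mwX : jointly_measurable (fun u w => disc_weight a t u * X u w ^+ q.+1).
  apply: jointly_measurableM; last exact: jointly_measurableX.
  exact: jointly_measurable_deterministic.
apply: (@le_trans _ _ (\int[P]_w
    \int[mu]_(u in `[0%R, t]) (disc_weight a t u * X u w ^+ q.+1)%:E)%E).
  apply: ge0_le_integral => //.
  - by move=> w _; rewrite lee_fin exprn_ge0.
  - by apply/measurable_EFinP; apply: measurable_funX; exact: measurable_disc.
  - apply: (@measurable_integral_section _ _ _ _
      (fun w u => (disc_weight a t u * X u w ^+ q.+1)%:E)) => //.
    + exact/measurable_EFinP.
    + by move=> w u; rewrite lee_fin mulr_ge0// exprn_ge0.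
  - move=> w _; apply: jensen_exprn => //.
    + exact: measurable_funTS.
    + by apply: measurable_funTS; exact: jointly_measurable_section.
    + exact: integral_disc_weight_le1.
    (* [disc] is the [fine] part of an integral not known to be finite; an infinite value becomes 0,
       and the inequality still holds. *)
    + rewrite /disc /Rintegral; set I := integral _ _ _.
      have : (0 <= I)%E by apply: integral_ge0 => u _; rewrite lee_fin mulr_ge0.
      by case: I => //= r _; exact: leey.
rewrite (@tonelli_lebesgue _ _ _ P _
  (fun w u => (disc_weight a t u * X u w ^+ q.+1)%:E))//; last 2 first.
- exact/measurable_EFinP.
- by move=> w u; rewrite lee_fin mulr_ge0// exprn_ge0.
have mwE : measurable_fun `[0, t] (fun u : measurableTypeR R => (disc_weight a t u)%:E).
  by apply: measurable_funTS; exact/measurable_EFinP.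
have w0E u : (0 <= (disc_weight a t u)%:E)%E by rewrite lee_fin.
have mwXE : measurable_fun [set: T * measurableTypeR R]
    (fun z => (disc_weight a t z.2 * X z.2 z.1 ^+ q.+1)%:E).
  exact/measurable_EFinP.
have wX0 (z : T * measurableTypeR R) :
    (0 <= (disc_weight a t z.2 * X z.2 z.1 ^+ q.+1)%:E)%E.
  by rewrite lee_fin mulr_ge0// exprn_ge0.
have mXu u : measurable_fun setT (fun w => (X u w ^+ q.+1)%:E).
  apply/measurable_EFinP; apply: measurable_funX.
  exact: jointly_measurable_at.
apply: (@le_trans _ _ (\int[mu]_(u in `[0%R, t]) (B%:E * (disc_weight a t u)%:E))%E).
  apply: ge0_le_integral => //.
  - by move=> u _; apply: integral_ge0 => w _; rewrite lee_fin mulr_ge0// exprn_ge0.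
  - apply: measurable_funTS.
    exact: (measurable_fun_fubini_tonelli_G (m1 := P)
      (fun z => (disc_weight a t z.2 * X z.2 z.1 ^+ q.+1)%:E) mwXE wX0).
  - exact: emeasurable_funM.
  - move=> u; rewrite /= in_itv/= => ut.
    under eq_integral do rewrite EFinM.
    have Xp0 w : (0 <= (X u w ^+ q.+1)%:E)%E by rewrite lee_fin exprn_ge0.
    rewrite ge0_integralZl//.
    by rewrite muleC lee_wpmul2r ?XB// lee_fin.
rewrite ge0_integralZl//.
by rewrite -[leRHS]mule1 lee_wpmul2l ?lee_fin// integral_disc_weight_le1.
Qed.

End disc_process.

(** * Pathwise comparison *)

Section barrier.
Context {R : realType}.

(** After the last time at which [u <= 0] the function could only decrease, by the mean value
    theorem. Derivatives are asked for strictly inside the interval, which leaves room for kinks at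
    the grid points. *)
Lemma barrier_le0 (u : R -> R) (a b : R) : continuous u -> u a <= 0 ->
  (forall t, a < t < b -> 0 < u t -> exists2 D, is_derive t 1 u D & D <= 0) ->
  forall t, a <= t <= b -> u t <= 0.
Proof.
move=> cu ua du t /andP[at_ tb]; rewrite leNgt; apply/negP => ut.
pose S := [set s | a <= s <= t /\ u s <= 0].
have Sa : S a by split => //; rewrite lexx at_.
have ubS : ubound S t by move=> s [] /andP[].
have hS : has_sup S by split; [exists a|exists t].
set t0 := sup S.
have a_t0 : a <= t0 by apply: ub_le_sup => //; exists t.
have t0_t : t0 <= t by apply: ge_sup => //; exists a.
have ut0 : u t0 <= 0.
  rewrite leNgt; apply/negP => ut0.
  have /nbhs_ballP[e /= e0 He] : \forall s \near t0, 0 < u s.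
    by move/cvgr_gt: (cu t0); apply.
  have [s Ss st0] := sup_adherent e0 hS.
  have s_le : s <= t0 by apply: ub_le_sup => //; exists t.
  have : 0 < u s.
    apply: He; rewrite /ball/= ger0_norm ?subr_ge0// ltrBlDr addrC -ltrBlDr.
    exact: st0.
  by case: Ss => _; rewrite leNgt => /negbTE ->.
have t0t : t0 < t.
  by rewrite lt_neqAle t0_t andbT; apply/eqP => E; move: ut0; rewrite E leNgt ut.
have upos s : t0 < s <= t -> 0 < u s.
  move=> /andP[t0s st]; rewrite ltNge; apply/negP => us.
  have : s <= t0.
    apply: ub_le_sup; first by exists t.
    by split => //; rewrite st (le_trans a_t0)// ltW.
  by rewrite leNgt t0s.
have dd s : s \in `]t0, t[ -> is_derive s 1 u ('D_1 u s).
  rewrite in_itv/= => /andP[t0s st].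
  have asb : a < s < b by rewrite (le_lt_trans a_t0 t0s) (lt_le_trans st tb).
  have us : 0 < u s by apply: upos; rewrite t0s ltW.
  have [D dD _] := du s asb us.
  by apply: derivableP; case: dD.
have [c] := MVT t0t dd (continuous_subspaceT cu).
rewrite in_itv/= => /andP[t0c ct] E.
have acb : a < c < b by rewrite (le_lt_trans a_t0 t0c) (lt_le_trans ct tb).
have uc : 0 < u c by apply: upos; rewrite t0c ltW.
have [D dD D0] := du c acb uc.
have : u t - u t0 <= 0.
  rewrite E (@derive_val _ _ _ _ _ _ _ dD).
  by rewrite mulr_le0_ge0// subr_ge0 ltW.
by rewrite subr_le0 leNgt => /negP; apply; rewrite (le_lt_trans ut0).
Qed.

End barrier.

Section primitive.
Context {R : realType}.
Local Notation mu := (@lebesgue_measure R).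

(** A class that contains both the continuous paths and the piecewise constant frozen coefficient,
    and guarantees integrability on every [[0, t]]. *)
Definition locally_bounded (h : R -> R) : Prop := measurable_fun setT h /\
  forall t, exists M, forall u, 0 <= u <= t -> `|h u| <= M.

Lemma locally_bounded_integrable (h : R -> R) (t : R) : locally_bounded h ->
  mu.-integrable `[0, t] (EFin \o h).
Proof.
move=> [mh /(_ t)[M hM]]; apply: measurable_bounded_integrable => //.
- rewrite /= lebesgue_measure_itv/= lte_fin; case: ifP => _; last by rewrite ltry.
  by rewrite -EFinB ltry.
- exact: measurable_funTS.
- exists M; split; first exact: num_real.
  move=> y My u /=; rewrite in_itv/= => ut.
  by rewrite (le_trans (hM _ ut))// ltW.
Qed.

Lemma continuous_locally_bounded (h : R -> R) : continuous h -> locally_bounded h.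
Proof.
move=> ch; split; first exact: continuous_measurable_fun.
move=> t; have [t0|t0] := leP 0 t; last first.
  by exists 0 => u /andP[u0 ut]; move: (le_lt_trans (le_trans u0 ut) t0); rewrite ltxx.
have cn : {within `[0, t], continuous (fun u => `|h u|)}.
  by apply: continuous_subspaceT => u; apply: continuous_comp; [exact: ch|exact: norm_continuous].
have [c _ hc] := EVT_max t0 cn.
by exists `|h c| => u ut; apply: hc; rewrite in_itv.
Qed.

Lemma locally_boundedM (h k : R -> R) : locally_bounded h -> locally_bounded k ->
  locally_bounded (fun u => h u * k u).
Proof.
move=> [mh bh] [mk bk]; split; first exact: measurable_funM.
move=> t; have [M hM] := bh t; have [M' kM] := bk t; exists (M * M') => u ut.
by rewrite normrM ler_pM ?hM ?kM.
Qed.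

Lemma locally_boundedD (h k : R -> R) : locally_bounded h -> locally_bounded k ->
  locally_bounded (fun u => h u + k u).
Proof.
move=> [mh bh] [mk bk]; split; first exact: measurable_funD.
move=> t; have [M hM] := bh t; have [M' kM] := bk t; exists (M + M') => u ut.
by rewrite (le_trans (ler_normD _ _))// lerD ?hM ?kM.
Qed.

Lemma locally_bounded_norm (h : R -> R) : locally_bounded h ->
  locally_bounded (fun u => `|h u|).
Proof.
move=> [mh bh]; split; first exact: measurableT_comp.
by move=> t; have [M hM] := bh t; exists M => u ut; rewrite normr_id hM.
Qed.

Lemma locally_boundedN (h : R -> R) : locally_bounded h ->
  locally_bounded (fun u => - h u).
Proof.
move=> [mh bh]; split; first exact: measurableT_comp.
by move=> t; have [M hM] := bh t; exists M => u ut; rewrite normrN hM.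
Qed.

Definition primitive (h : R -> R) (t : R) : R := \int[mu]_(u in `[0, t]) h u.

(** For negative [t] the interval is empty. Primitives are thus constant before 0, which lets them
    be continuous on the whole line. *)
Lemma primitive_le0 (h : R -> R) (t : R) : t <= 0 -> primitive h t = 0.
Proof.
rewrite /primitive le_eqVlt => /predU1P[->|t0].
  by rewrite set_itv1 Rintegral_set1.
by rewrite set_itv_ge ?Rintegral_set0// bnd_simp -ltNge.
Qed.

Lemma primitive_ge0 (h : R -> R) (t : R) : (forall u, 0 <= h u) ->
  0 <= primitive h t.
Proof. by move=> h0; apply: Rintegral_ge0 => u _. Qed.

Lemma is_derive_primitive (h : R -> R) (t : R) : locally_bounded h -> 0 < t ->
  {for t, continuous h} -> is_derive t 1 (primitive h) (h t).
Proof.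
move=> bh t0 ch.
have t1 : t < t + 1 by rewrite ltrDl.
have [dF F'] := continuous_FTC1_closed t1 (locally_bounded_integrable (t + 1) bh) t0 ch.
by rewrite -F' derive1E; exact: derivableP.
Qed.

Lemma continuous_primitive (h : R -> R) : locally_bounded h ->
  continuous (primitive h).
Proof.
move=> bh t.
have cw T : 0 <= T -> {within `[0, T], continuous (primitive h)}.
  move=> T0.
  exact: (parameterized_integral_continuous T0 (locally_bounded_integrable T bh)).
have [t0|t0|t0] := ltgtP t 0.
- rewrite /continuous_at primitive_le0 ?ltW//; apply: cvg_near_cst; near=> s.
  by rewrite primitive_le0//; near: s; exact: lt_le_nbhsl.
- have T0 : 0 < t + 1 by rewrite addr_gt0.
  have [/(_ t) + _ _] := (continuous_within_itvP (primitive h) T0).1 (cw _ (ltW T0)).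
  by apply; rewrite in_itv/= t0 ltrDl ltr01.
- rewrite t0; have [_ + _] := (continuous_within_itvP (primitive h) ltr01).1 (cw _ ler01).
  move=> hr; apply/left_right_continuousP; split => //.
  by rewrite primitive_le0//; apply: cvg_near_cst; near=> s; rewrite primitive_le0.
Unshelve. all: by end_near. Qed.

(** Factoring the exponential takes [t] out of the integrand, so that [disc] can be differentiated
    in [t] by the fundamental theorem of calculus. *)
Lemma disc_primitive (a t : R) (h : R -> R) : locally_bounded h ->
  disc a t h = a * expR (- (a * t)) * primitive (fun u => expR (a * u) * h u) t.
Proof.
move=> bh; rewrite /disc /primitive -RintegralZl//.
  apply: eq_Rintegral => u _; rewrite /disc_weight !mulrA; congr (_ * _).
  by rewrite -mulrA -expRD; congr (_ * expR _); ring.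
apply: locally_bounded_integrable; apply: locally_boundedM => //.
apply: continuous_locally_bounded => u; apply: continuous_comp; last exact: continuous_expR.
by apply: cvgM; [exact: cvg_cst|exact: cvg_id].
Qed.

End primitive.

Section comparison.
Context {R : realType}.
Variables (f kx x X kbar : R -> R) (lambda delta x0 : R).
Hypothesis lambda0 : 0 < lambda.
Hypothesis delta0 : 0 < delta.
Hypothesis cf : continuous f.
Hypothesis f_dissipative :
  forall y z, (y - z) * (f y - f z) <= - lambda * `|y - z| ^+ 2.
Hypothesis cX : continuous X.
Hypothesis cx : continuous x.
Hypothesis ckx : continuous kx.
Hypothesis x_0 : x 0 = x0.
Hypothesis dx : forall t : R, 0 < t -> is_derive t 1 x (f (x t) + kx t).
Hypothesis bkbar : locally_bounded kbar.
Hypothesis ckbar : forall (j : nat) (t : R),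
  j%:R * delta < t < j.+1%:R * delta -> {for t, continuous kbar}.

Definition drift (u : R) : R := f (X u) + kbar u.
Definition noise (t : R) : R := X t - x0 - primitive drift t.
Definition ou (t : R) : R := noise t - disc lambda t noise.
Definition source (u : R) : R :=
  `|f (x u + ou u) - f (x u)| + lambda * `|ou u| + `|kbar u - kx u|.

Lemma locally_bounded_drift : locally_bounded drift.
Proof.
apply: locally_boundedD => //; apply: continuous_locally_bounded => u.
by apply: continuous_comp; [exact: cX|exact: cf].
Qed.

Lemma continuous_noise : continuous noise.
Proof.
move=> t; apply: cvgB; last exact: (continuous_primitive locally_bounded_drift).
by apply: cvgB; [exact: cX|exact: cvg_cst].
Qed.

Lemma continuous_expR_mul (a : R) : continuous (fun u => expR (a * u)).
Proof.
move=> u; apply: continuous_comp; last exact: continuous_expR.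
by apply: cvgM; [exact: cvg_cst|exact: cvg_id].
Qed.

Lemma continuous_disc (a : R) (h : R -> R) : continuous h ->
  continuous (fun t => disc a t h).
Proof.
move=> ch; have bh := continuous_locally_bounded ch.
rewrite (_ : (fun t => _) = fun t =>
  a * expR ((- a) * t) * primitive (fun u => expR (a * u) * h u) t); last first.
  by apply/funext => t; rewrite disc_primitive// mulNr.
move=> t; apply: cvgM.
  by apply: cvgM; [exact: cvg_cst|exact: continuous_expR_mul].
apply: continuous_primitive; apply: locally_boundedM => //.
by apply: continuous_locally_bounded; exact: continuous_expR_mul.
Qed.

Lemma continuous_ou : continuous ou.
Proof.
move=> t; apply: cvgB; first exact: continuous_noise.
by apply: continuous_disc; exact: continuous_noise.
Qed.

Let continuous_smooth_source :
  continuous (fun u => `|f (x u + ou u) - f (x u)| + lambda * `|ou u|).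
Proof.
move=> u; apply: cvgD.
  apply: cvg_norm; apply: cvgB; last by apply: continuous_comp; [exact: cx|exact: cf].
  apply: (@continuous_comp _ _ _ (fun u => x u + ou u) f); last exact: cf.
  by apply: cvgD; [exact: cx|exact: continuous_ou].
by apply: cvgM; [exact: cvg_cst|apply: cvg_norm; exact: continuous_ou].
Qed.

Lemma locally_bounded_source : locally_bounded source.
Proof.
apply: locally_boundedD; first exact: continuous_locally_bounded.
apply: locally_bounded_norm; apply: locally_boundedD => //.
by apply: locally_boundedN; exact: continuous_locally_bounded.
Qed.

Lemma source_ge0 u : 0 <= source u.
Proof. by rewrite !addr_ge0// mulr_ge0// ltW. Qed.

Let Y t := X t - x t - ou t.
Let wsource u := expR (lambda * u) * source u.
Let Psi := primitive wsource.
Let wnoise u := expR (lambda * u) * noise u.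

Let bwsource : locally_bounded wsource.
Proof.
apply: locally_boundedM; last exact: locally_bounded_source.
by apply: continuous_locally_bounded; exact: continuous_expR_mul.
Qed.

Let cwnoise : continuous wnoise.
Proof.
by move=> u; apply: cvgM; [exact: continuous_expR_mul|exact: continuous_noise].
Qed.

(** [X t] cancels against the [X t] inside [noise t]. What remains is made of primitives and of [x],
    hence differentiable off the grid, although [X] need not be. *)
Let YE t : Y t = x0 + primitive drift t - x t +
  lambda * expR ((- lambda) * t) * primitive wnoise t.
Proof.
rewrite /Y /ou /noise disc_primitive; last first.
  by apply: continuous_locally_bounded; exact: continuous_noise.
by rewrite mulNr /wnoise; ring.
Qed.

Let dY (j : nat) (t : R) : j%:R * delta < t < j.+1%:R * delta ->
  is_derive t 1 Y (f (X t) - f (x t) + (kbar t - kx t) + lambda * ou t).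
Proof.
move=> jt; have t0 : 0 < t.
  by case/andP: jt => + _; apply: le_lt_trans; rewrite mulr_ge0// ltW.
have dD : is_derive t 1 (primitive drift) (drift t).
  apply: is_derive_primitive => //; first exact: locally_bounded_drift.
  apply: cvgD; last exact: ckbar jt.
  by apply: continuous_comp; [exact: cX|exact: cf].
have dN : is_derive t 1 (primitive wnoise) (wnoise t).
  apply: is_derive_primitive => //; last exact: cwnoise.
  exact: continuous_locally_bounded.
have dxt := dx t0.
rewrite (_ : Y = fun t => x0 + primitive drift t - x t +
  lambda * expR ((- lambda) * t) * primitive wnoise t); last first.
  by apply/funext => s; rewrite YE.
apply: is_derive_eq.
rewrite /GRing.scale/= /ou disc_primitive; last first.
  by apply: continuous_locally_bounded; exact: continuous_noise.
have -> : wnoise t = expR (lambda * t) * noise t by [].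
have -> : primitive (fun u => expR (lambda * u) * noise u) t = primitive wnoise t by [].
have e1 : expR (- lambda * t) * expR (lambda * t) = 1.
  by rewrite -expRD mulNr addNr expR0.
rewrite /drift mulNr in e1 *.
set E := expR (- (lambda * t)) in e1 *; set E' := expR _ in e1 *.
set Pn := primitive wnoise t.
transitivity (f (X t) - f (x t) + (kbar t - kx t) +
  (lambda * (E * E') * noise t - lambda * (lambda * E * Pn))); last first.
  by rewrite e1; ring.
ring.
Qed.

Let dwY (sg : R) (j : nat) (t : R) : j%:R * delta < t < j.+1%:R * delta ->
  is_derive t 1 (fun t => expR (lambda * t) * (sg * Y t) - Psi t)
    (expR (lambda * t) *
      (sg * (lambda * Y t + (f (X t) - f (x t) + (kbar t - kx t) + lambda * ou t))
       - source t)).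
Proof.
move=> jt; have t0 : 0 < t.
  by case/andP: jt => + _; apply: le_lt_trans; rewrite mulr_ge0// ltW.
have dYt := dY jt.
have dP : is_derive t 1 Psi (wsource t).
  apply: is_derive_primitive => //; apply: cvgM; first exact: continuous_expR_mul.
  apply: cvgD; first exact: continuous_smooth_source.
  by apply: cvg_norm; apply: cvgB; [exact: ckbar jt|exact: ckx].
apply: is_derive_eq; rewrite /GRing.scale/= /wsource; ring.
Qed.

Let cwY (sg : R) : continuous (fun t => expR (lambda * t) * (sg * Y t) - Psi t).
Proof.
move=> t; apply: cvgB; last exact: continuous_primitive.
apply: cvgM; first exact: continuous_expR_mul.
apply: cvgM; first exact: cvg_cst.
apply: cvgB; last exact: continuous_ou.
by apply: cvgB; [exact: cX|exact: cx].
Qed.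

(** Two signs replace the absolute value of [Y]. The barrier argument runs on
    [expR (lambda * t) * (sg * Y t) - Psi t], cell after cell, because [kbar] may jump at the grid
    points. *)
Let Y_sign (sg t : R) : `|sg| = 1 -> 0 <= t -> expR (lambda * t) * (sg * Y t) <= Psi t.
Proof.
move=> sg1 t0; rewrite -subr_le0.
pose u s := expR (lambda * s) * (sg * Y s) - Psi s.
have u0 : u 0 <= 0.
  rewrite /u YE /Psi !primitive_le0// x_0.
  by apply: eq_lexx; ring.
have cell (j : nat) : u (j%:R * delta) <= 0 ->
    forall s, j%:R * delta <= s <= j.+1%:R * delta -> u s <= 0.
  move=> uj; apply: barrier_le0 => //; first exact: cwY.
  move=> s js us; exists (expR (lambda * s) *
      (sg * (lambda * Y s + (f (X s) - f (x s) + (kbar s - kx s) + lambda * ou s))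
       - source s)); first exact: dwY js.
  rewrite mulr_ge0_le0 ?expR_ge0// subr_le0.
  (* Where the barrier function is positive, so is [sg * Y s], since [Psi] is nonnegative; the
     dissipativity inequality can then be divided by it. *)
  have sY : 0 < sg * Y s.
    have P0 : 0 <= Psi s.
      by apply: primitive_ge0 => v; rewrite mulr_ge0 ?expR_ge0 ?source_ge0.
    move: us; rewrite /u subr_gt0 => /(le_lt_trans P0).
    by rewrite pmulr_rgt0// expR_gt0.
  have XE : X s = x s + ou s + Y s by rewrite /Y; ring.
  have dis : sg * (f (X s) - f (x s + ou s)) <= - lambda * (sg * Y s).
    rewrite -(ler_pM2l sY).
    have := f_dissipative (X s) (x s + ou s).
    have -> : X s - (x s + ou s) = Y s by rewrite XE; ring.
    have sg2 : sg ^+ 2 = 1 by rewrite -real_normK ?num_real// sg1 expr1n.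
    rewrite real_normK ?num_real//.
    have -> : sg * Y s * (sg * (f (X s) - f (x s + ou s))) =
      sg ^+ 2 * (Y s * (f (X s) - f (x s + ou s))) by ring.
    have -> : sg * Y s * (- lambda * (sg * Y s)) = sg ^+ 2 * (- lambda * Y s ^+ 2) by ring.
    by rewrite sg2 !mul1r.
  have b1 (v : R) : sg * v <= `|v|.
    by rewrite (le_trans (ler_norm _))// normrM sg1 mul1r.
  have -> : sg * (lambda * Y s + (f (X s) - f (x s) + (kbar s - kx s) + lambda * ou s)) =
    (lambda * (sg * Y s) + sg * (f (X s) - f (x s + ou s))) +
    sg * (f (x s + ou s) - f (x s)) + lambda * (sg * ou s) + sg * (kbar s - kx s) by ring.
  rewrite /source lerD// lerD//.
    by rewrite -[leRHS]add0r lerD//; move: dis; lra.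
  by rewrite ler_wpM2l// ltW.
have grid (j : nat) : u (j%:R * delta) <= 0.
  elim: j => [|j IH]; first by rewrite mul0r.
  by apply: (cell j IH); rewrite lexx (ler_wpM2r (ltW delta0)) ?ler_nat.
have td : 0 <= t / delta by rewrite divr_ge0// ltW.
apply: (cell _ (grid (Num.truncn (t / delta)))).
have /andP[a b] := truncn_itv td.
by rewrite -ler_pdivlMr// a -ler_pdivrMr// ltW.
Qed.

Lemma comparison (t : R) : 0 <= t ->
  `|X t - x t| <= `|ou t| + lambda^-1 * disc lambda t source.
Proof.
move=> t0.
have -> : X t - x t = ou t + Y t by rewrite /Y; ring.
apply: (le_trans (ler_normD _ _)); rewrite lerD2l.
rewrite disc_primitive; last exact: locally_bounded_source.
rewrite -mulrA mulKf ?gt_eqF// expRN -ler_pdivrMl ?invr_gt0 ?expR_gt0// invrK.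
have h1 := Y_sign (normr1 R) t0.
have h2 := Y_sign (etrans (normrN1 R) erefl) t0.
have [y0|y0] := ger0P (Y t); first by move: h1; rewrite mul1r.
by move: h2; rewrite mulN1r.
Qed.

End comparison.

(** * Regularity of the coefficients and of the deterministic solution *)

Section coefficients_facts.
Context {R : realType}.

Lemma locally_lipschitz_continuous (f : R -> R) :
  (forall z, exists L, forall y, `|z - y| <= 1 -> `|f z - f y| <= L * `|z - y|) ->
  continuous f.
Proof.
move=> lip z; have [L hL] := lip z.
have L0 : 0 < `|L| + 1 by rewrite ltr_wpDl.
apply/cvgrPdist_le => e e0; near=> y.
have zy1 : `|z - y| <= 1 by near: y; exact: cvgr_dist_le.
have zy2 : `|z - y| <= e / (`|L| + 1).
  by near: y; apply: cvgr_dist_le => //; rewrite divr_gt0.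
apply: (le_trans (hL _ zy1)).
apply: (@le_trans _ _ ((`|L| + 1) * `|z - y|)).
  by rewrite ler_wpM2r// (le_trans (ler_norm _))// lerDl.
by rewrite mulrC -ler_pdivlMr.
Unshelve. all: by end_near. Qed.

Lemma lipschitz_continuous (f : R -> R) (L : R) :
  (forall y z, `|f y - f z| <= L * `|y - z|) -> continuous f.
Proof. by move=> lip; apply: locally_lipschitz_continuous => z; exists L. Qed.

Lemma powR_le_bound (q y K : R) : 0 < q -> `|y| <= K -> `|y| `^ q <= K `^ q.
Proof.
by move=> q0 yK; rewrite ge0_ler_powR ?nnegrE// ?(ltW q0)// (le_trans _ yK).
Qed.

Lemma polynomial_lipschitz_continuous (f : R -> R) (q xi m : R) :
  0 < q -> 0 < xi ->
  (forall y z, `|f y - f z| <= (xi * (`|y| `^ q + `|z| `^ q) + m) * `|y - z|) ->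
  continuous f.
Proof.
move=> q0 xi0 lip; apply: locally_lipschitz_continuous => z.
exists (xi * (`|z| `^ q + (`|z| + 1) `^ q) + m) => y zy.
apply: (le_trans (lip _ _)); rewrite ler_wpM2r// lerD2r.
rewrite (ler_wpM2l (ltW xi0))// lerD2l.
apply: powR_le_bound => //.
have := ler_normB z (z - y); rewrite (_ : z - (z - y) = y); last by ring.
lra.
Qed.

Lemma continuous_max0 (h : R -> R) : {within `[0, +oo[, continuous h} ->
  continuous (fun t : R => h (Num.max 0 t)).
Proof.
move=> /(continuous_within_itvcyP 0)[hc h0] t.
have [t0|t0|t0] := ltgtP t 0.
- rewrite /continuous_at (max_l (ltW t0)); apply: cvg_near_cst; near=> s.
  rewrite max_l//.
  by near: s; exact: lt_le_nbhsl.
- rewrite /continuous_at (max_r (ltW t0)).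
  have ht : h s @[s --> t] --> h t by apply: hc; rewrite in_itv/= t0.
  apply: cvg_trans ht; apply: near_eq_cvg; near=> s; rewrite max_r// ltW//.
  by near: s; exact: lt_nbhsr.
- rewrite t0; apply/left_right_continuousP; rewrite maxxx; split.
    by apply: cvg_near_cst; near=> s; rewrite max_l.
  by apply: cvg_trans h0; apply: near_eq_cvg; near=> s; rewrite max_r.
Unshelve. all: by end_near. Qed.

Lemma is_derive_max0 (h : R -> R) (t D : R) : 0 < t -> is_derive t 1 h D ->
  is_derive t 1 (fun t : R => h (Num.max 0 t)) D.
Proof.
move=> t0; apply: near_eq_is_derive; near=> s; rewrite max_r// ltW//.
by near: s; exact: lt_nbhsr.
Unshelve. all: by end_near. Qed.

End coefficients_facts.

Section ode_facts.
Context {R : realType}.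
Variables (f kappa x : R -> R) (lambda gam : R).
Hypothesis lambda0 : 0 < lambda.
Hypothesis f_dissipative :
  forall y z, (y - z) * (f y - f z) <= - lambda * `|y - z| ^+ 2.
Hypothesis kappa_le : forall y, `|kappa y| <= gam.
Hypothesis cx : continuous x.
Hypothesis dx : forall t : R, 0 < t -> is_derive t 1 x (f (x t) + kappa (x t)).

(** A radius containing the initial value and beyond which the inward pull [lambda * |x|] dominates
    [|f 0| + gam], the most that [f 0] and [kappa] can push outwards. *)
Definition ode_radius : R := `|x 0| + (`|f 0| + gam) / lambda.

Lemma ode_bounded (t : R) : 0 <= t -> `|x t| <= ode_radius.
Proof.
move=> t0.
have gam0 : 0 <= gam by rewrite (le_trans _ (kappa_le 0)).
have lr : `|f 0| + gam <= lambda * ode_radius.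
  rewrite /ode_radius mulrDr mulrCA divff ?gt_eqF// mulr1 lerDr.
  by rewrite mulr_ge0// ltW.
have r0 : 0 <= ode_radius by rewrite addr_ge0// divr_ge0 ?addr_ge0// ltW.
have x0r : `|x 0| <= ode_radius by rewrite lerDl divr_ge0 ?addr_ge0// ltW.
have side (sg : R) : `|sg| = 1 -> sg * x t - ode_radius <= 0.
  move=> sg1; have sg2 : sg ^+ 2 = 1 by rewrite -real_normK ?num_real// sg1 expr1n.
  apply: (@barrier_le0 _ (fun s => sg * x s - ode_radius) 0 t) => [| | |].
  - move=> s; apply: cvgB; last exact: cvg_cst.
    by apply: cvgM; [exact: cvg_cst|exact: cx].
  - rewrite subr_le0 (le_trans _ x0r)// (le_trans (ler_norm _))//.
    by rewrite normrM sg1 mul1r.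
  - move=> s /andP[s0 _]; rewrite subr_gt0 => rs.
    exists (sg * (f (x s) + kappa (x s))).
      have dxs := dx s0.
      by apply: is_derive_eq; rewrite /GRing.scale/=; ring.
    have sx : 0 < sg * x s by rewrite (le_lt_trans r0).
    have b1 (v : R) : sg * v <= `|v|.
      by rewrite (le_trans (ler_norm _))// normrM sg1 mul1r.
    have dis : sg * (f (x s) - f 0) <= - lambda * (sg * x s).
      rewrite -(ler_pM2l sx).
      have := f_dissipative (x s) 0; rewrite subr0 real_normK ?num_real//.
      have -> : sg * x s * (sg * (f (x s) - f 0)) =
        sg ^+ 2 * (x s * (f (x s) - f 0)) by ring.
      have -> : sg * x s * (- lambda * (sg * x s)) = sg ^+ 2 * (- lambda * x s ^+ 2) by ring.
      by rewrite sg2 !mul1r.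
    have h1 := b1 (f 0); have h2 := le_trans (b1 _) (kappa_le (x s)).
    have h3 : lambda * ode_radius <= lambda * (sg * x s).
      by rewrite ler_wpM2l// ltW.
    have -> : sg * (f (x s) + kappa (x s)) =
      sg * (f (x s) - f 0) + sg * f 0 + sg * kappa (x s) by ring.
    lra.
  - by rewrite t0 lexx.
have h1 := side 1 (normr1 R); have h2 := side (-1) (normrN1 R).
by rewrite ler_norml; lra.
Qed.

Variables (q xi m : R).
Hypothesis q0 : 0 < q.
Hypothesis xi0 : 0 < xi.
Hypothesis f_lip :
  forall y z, `|f y - f z| <= (xi * (`|y| `^ q + `|z| `^ q) + m) * `|y - z|.

(** A bound on the velocity of the solution: the Lipschitz estimate of [f] between 0 and a point
    within [ode_radius], plus [|f 0|] and the bound of [kappa]. *)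
Definition ode_speed : R :=
  `|(xi * (ode_radius `^ q + `|0 : R| `^ q) + m)| * ode_radius + `|f 0| + gam.

Lemma ode_lipschitz (s t : R) : 0 <= s -> s <= t ->
  `|x t - x s| <= ode_speed * (t - s).
Proof.
move=> s0; rewrite le_eqVlt => /predU1P[<-|st].
  by rewrite !subrr normr0 mulr0.
have dd u : u \in `]s, t[ -> is_derive u 1 x (f (x u) + kappa (x u)).
  by rewrite in_itv/= => /andP[su _]; apply: dx; exact: le_lt_trans su.
have [c] := MVT st dd (continuous_subspaceT cx).
rewrite in_itv/= => /andP[sc _] ->.
have c0 : 0 <= c by rewrite (le_trans s0)// ltW.
have ts0 : 0 <= t - s by rewrite subr_ge0 ltW.
rewrite normrM (ger0_norm ts0) ler_wpM2r//.
have xr := ode_bounded c0.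
have h1 : `|f (x c) - f 0| <= `|(xi * (ode_radius `^ q + `|0 : R| `^ q) + m)| * ode_radius.
  apply: (le_trans (f_lip _ _)); rewrite subr0.
  apply: (@le_trans _ _ (`|(xi * (ode_radius `^ q + `|0 : R| `^ q) + m)| * `|x c|)).
    rewrite ler_wpM2r// (le_trans _ (ler_norm _))// lerD2r.
    by rewrite (ler_wpM2l (ltW xi0))// lerD2r powR_le_bound.
  by rewrite ler_wpM2l.
have -> : f (x c) + kappa (x c) = (f (x c) - f 0) + f 0 + kappa (x c) by ring.
apply: (le_trans (ler_normD _ _)); rewrite lerD//.
by apply: (le_trans (ler_normD _ _)); rewrite lerD.
Qed.

End ode_facts.

(** * Moments of the error *)

Lemma is_ito_integral_eq {R : realType} {d : measure_display}
    {T : measurableType d} (P : probability T R) (F : R -> set (set T))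
    (W H H' : R -> T -> R) (t : R) (Y : T -> R) :
  (forall s w, 0 <= s <= t -> H s w = H' s w) ->
  is_ito_integral P F W H t Y -> is_ito_integral P F W H' t Y.
Proof.
move=> HH [mY [h [h1 h2]]]; split => //; exists h; split => //.
rewrite (_ : (fun n => _) = (fun n => \int[P]_w
    \int[lebesgue_measure]_(s in `[0%R, t])
        ((sp_value (h n) s w - H s w) ^+ 2)%R%:E)%E)//.
apply/funext => n; apply: eq_integral => w _; apply: eq_integral => s.
by rewrite inE/= in_itv/= => st; rewrite HH.
Qed.

Section weak_solution_paths.
Context {R : realType} {d : measure_display} {T : measurableType d}.
Variables (P : probability T R) (F : R -> set (set T)).
Variables (f kappa sigma : R -> R) (x0 eps delta : R) (W X : R -> T -> R).
Hypothesis sol : weak_solution P F f kappa sigma x0 eps delta W X.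
Hypothesis eps0 : 0 < eps.
Hypothesis delta0 : 0 < delta.
Hypothesis cf : continuous f.
Hypothesis ck : continuous kappa.
Hypothesis cs : continuous sigma.
Variable gam : R.
Hypothesis gam0 : 0 < gam.
Hypothesis kappa_le : forall y, `|kappa y| <= gam.
Hypothesis sigma_le : forall y, `|sigma y| <= gam.

(* Extending all processes by their value at [0] makes their paths continuous
   on the whole line. *)
Definition ext (u : R) (w : T) : R := X (Num.max 0 u) w.

Definition frozen (u : R) (w : T) : R := kappa (ext (grid_time delta u) w).

(** Defined from the path of [X] and not from the Ito integrals: it is continuous in time for every
    [w], whereas the integrals are given at each time up to a null set. *)
Definition pnoise (u : R) (w : T) : R := noise f (ext^~ w) (frozen^~ w) x0 u.

Lemma ext_measurable t : measurable_fun setT (ext t).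
Proof.
case: sol => [[sF FM Fm] _ [aX _] _ _].
have t0 : 0 <= Num.max 0 t by rewrite le_max lexx.
exact: (measurable_wrt_fun (FM _ t0) (aX _ t0)).
Qed.

Lemma ext_continuous w : continuous (ext^~ w).
Proof. by case: sol => _ _ [_ cX] _ _; exact: (continuous_max0 (cX w)). Qed.

Lemma ext_le0 t w : t <= 0 -> ext t w = ext 0 w.
Proof. by move=> t0; rewrite /ext maxxx max_l. Qed.

Lemma ext_jointly_measurable : jointly_measurable ext.
Proof.
apply: continuous_jointly_measurable; first exact: ext_measurable.
  exact: ext_continuous.
by move=> t w; exact: ext_le0.
Qed.

(** Grid points become indexed by natural numbers. [truncn] and the floor differ only at negative
    times, where [ext] is constant. *)
Lemma frozenE u w : frozen u w = kappa (ext (delta * (Num.truncn (u * delta^-1))%:R) w).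
Proof.
rewrite /frozen /grid_time truncn_floor.
case: ifPn => [h|]; first by rewrite natr_absz ger0_norm ?floor_ge0.
rewrite -ltNge mulr0 => h; rewrite ext_le0// mulr_ge0_le0 ?(ltW delta0)//.
by rewrite (le_trans (ge_floor _))// ltW.
Qed.

Lemma frozen_jointly_measurable : jointly_measurable frozen.
Proof.
rewrite (_ : frozen = fun u w => kappa (ext (delta * (Num.truncn (u * delta^-1))%:R) w)).
  apply: (@jointly_measurable_step _ _ _ (fun k w => kappa (ext (delta * k%:R) w))
    (fun u => Num.truncn (u * delta^-1))) => k.
    by apply: measurableT_comp; [exact: continuous_measurable_fun|exact: ext_measurable].
  by apply: measurable_truncn_eq; rewrite invr_gt0.
by apply/funext => u; apply/funext => w; rewrite frozenE.
Qed.

Lemma frozen_locally_bounded w : locally_bounded (frozen^~ w).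
Proof.
split; first exact: (jointly_measurable_section w frozen_jointly_measurable).
by move=> t; exists gam => u _; exact: kappa_le.
Qed.

Lemma frozen_continuous w (j : nat) (t : R) : j%:R * delta < t < j.+1%:R * delta ->
  {for t, continuous (frozen^~ w)}.
Proof.
move=> /andP[jt tj].
have E s : j%:R * delta < s -> s < j.+1%:R * delta ->
    frozen s w = kappa (ext (delta * j%:R) w).
  move=> js sj; rewrite frozenE (@truncn_def _ _ j)//.
  by rewrite ler_pdivlMr// ltr_pdivrMr// sj ltW.
rewrite /prop_for /continuous_at (E t jt tj); apply: cvg_near_cst; near=> s; rewrite E//.
  by near: s; exact: lt_nbhsr.
by near: s; exact: lt_nbhsl.
Unshelve. all: by end_near. Qed.

Lemma pnoise_continuous w : continuous (pnoise^~ w).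
Proof.
apply: continuous_noise => //; first exact: ext_continuous.
exact: frozen_locally_bounded.
Qed.

Lemma drift_jointly_measurable :
  jointly_measurable (fun u w => drift f (ext^~ w) (frozen^~ w) u).
Proof.
apply: jointly_measurableD; last exact: frozen_jointly_measurable.
apply: jointly_measurable_comp; last exact: ext_jointly_measurable.
exact: continuous_measurable_fun.
Qed.

Lemma pnoise_measurable t : measurable_fun setT (pnoise t).
Proof.
apply: measurable_funB; first by apply: measurable_funB => //; exact: ext_measurable.
by apply: jointly_measurable_Rintegral => //; exact: drift_jointly_measurable.
Qed.

Lemma pnoise_jointly_measurable : jointly_measurable pnoise.
Proof.
apply: continuous_jointly_measurable; first exact: pnoise_measurable.
  exact: pnoise_continuous.
by move=> t w t0; rewrite /pnoise /noise ext_le0// !primitive_le0.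
Qed.

Lemma pnoise_ito (t : R) : 0 <= t ->
  exists2 I, is_ito_integral P F W (fun s w => sigma (ext s w)) t I &
    {ae P, forall w, pnoise t w = eps * I w}.
Proof.
move=> t0; case: sol => _ _ _ _ /(_ t t0)[I II hI]; exists I.
  apply: is_ito_integral_eq II => s w /andP[s0 _].
  by rewrite /ext max_r.
apply: filterS hI => w hw; rewrite /pnoise /noise.
have -> : ext t w = X t w by rewrite /ext max_r.
have -> : primitive (drift f (ext^~ w) (frozen^~ w)) t =
    \int[lebesgue_measure]_(s in `[0, t])
      (f (X s w) + kappa (X (grid_time delta s) w)).
  apply: eq_Rintegral => s; rewrite inE/= in_itv/= => /andP[s0 _].
  rewrite /drift /frozen /ext !max_r//.
  by rewrite mulr_ge0 ?(ltW delta0)// ler0z floor_ge0 divr_ge0// ltW.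
by rewrite hw; ring.
Qed.

(** Only two times are involved, so the null sets of two Ito integrals suffice. The case [s = t] is
    apart because the increment estimate assumes [s < t]. *)
Lemma pnoise_moment_le (s t : R) (p : nat) : 0 <= s -> s <= t ->
  (\int[P]_w (`|pnoise t w - pnoise s w| ^+ p.+1)%:E <=
   (eps ^+ p.+1 * (ito_moment_const p.+1 * (gam * Num.sqrt (t - s)) ^+ p.+1))%:E)%E.
Proof.
move=> s0; rewrite le_eqVlt => /predU1P[<-|st].
  under eq_integral do rewrite subrr normr0 expr0n/=.
  rewrite integral0 lee_fin mulr_ge0 ?exprn_ge0 ?(ltW eps0)//.
  rewrite mulr_ge0 ?exprn_ge0 ?(ltW (ito_moment_const_gt0 _))//.
  by rewrite mulr_ge0 ?sqrtr_ge0// ltW.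
have t0 : 0 <= t := le_trans s0 (ltW st).
have [I [mI II] hI] := pnoise_ito t0; have [I' [mI' II'] hI'] := pnoise_ito s0.
case: sol => fF bW _ _ _.
have jH : jointly_measurable (fun s w => sigma (ext s w)).
  apply: jointly_measurable_comp; last exact: ext_jointly_measurable.
  exact: continuous_measurable_fun.
have key := ito_increment_moment_le fF bW jH gam0 (fun u w => sigma_le _) p s0 st
  (conj mI II) (conj mI' II').
have mII : measurable_fun setT (fun w => (`|I w - I' w| ^+ p.+1)%:E).
  apply/measurable_EFinP; apply: measurable_funX; apply: measurableT_comp => //.
  exact: measurable_funB.
have e0 : (0 <= (eps ^+ p.+1)%:E)%E by rewrite lee_fin exprn_ge0// ltW.
have II0 w : (0 <= (`|I w - I' w| ^+ p.+1)%:E)%E by rewrite lee_fin exprn_ge0.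
apply: (@le_trans _ _ (\int[P]_w ((eps ^+ p.+1)%:E * (`|I w - I' w| ^+ p.+1)%:E))%E).
  apply: ae_ge0_le_integral => //.
  - apply/measurable_EFinP; apply: measurable_funX; apply: measurableT_comp => //.
    by apply: measurable_funB; exact: pnoise_measurable.
  - by move=> w _; rewrite mule_ge0.
  - exact: emeasurable_funM.
  - apply: filterS2 hI hI' => w -> -> _.
    by rewrite -mulrBr normrM (ger0_norm (ltW eps0)) exprMn EFinM.
rewrite ge0_integralZl//.
by rewrite EFinM lee_wpmul2l.
Qed.

End weak_solution_paths.

Section moment_combination.
Context {R : realType} {d : measure_display} {T : measurableType d}.
Variable P : probability T R.

Lemma moment_scale_le (k m : R) (g : T -> R) (p : nat) : 0 <= k ->
  measurable_fun setT g -> (forall w, 0 <= g w) ->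
  (\int[P]_w (g w ^+ p)%:E <= m%:E)%E ->
  (\int[P]_w ((k * g w) ^+ p)%:E <= (k ^+ p * m)%:E)%E.
Proof.
move=> k0 mg g0 gm.
have mgp : measurable_fun setT (fun w => (g w ^+ p)%:E).
  by apply/measurable_EFinP; exact: measurable_funX.
have gp0 w : (0 <= (g w ^+ p)%:E)%E by rewrite lee_fin exprn_ge0.
have kp0 : (0 <= (k ^+ p)%:E)%E by rewrite lee_fin exprn_ge0.
under eq_integral do rewrite exprMn EFinM.
by rewrite ge0_integralZl// EFinM lee_wpmul2l.
Qed.

(** The half of [exprn_midpoint_le] stays outside: a term whose double has moment at most [M]
    contributes [M / 2]. *)
Lemma moment_add_le (a b : R) (U A B : T -> R) (q : nat) :
  measurable_fun setT U -> measurable_fun setT A -> measurable_fun setT B ->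
  (forall w, 0 <= A w) -> (forall w, 0 <= B w) ->
  {ae P, forall w, `|U w| <= A w + B w} ->
  (\int[P]_w ((2 * A w) ^+ q.+1)%:E <= a%:E)%E ->
  (\int[P]_w ((2 * B w) ^+ q.+1)%:E <= b%:E)%E ->
  (\int[P]_w (`|U w| ^+ q.+1)%:E <= ((a + b) / 2)%:E)%E.
Proof.
move=> mU mA mB A0 B0 UAB Aa Bb.
have m2 (g : T -> R) : measurable_fun setT g ->
    measurable_fun setT (fun w => ((2 * g w) ^+ q.+1)%:E).
  by move=> mg; apply/measurable_EFinP; apply: measurable_funX; exact: measurable_funM.
have p2 (g : T -> R) w : 0 <= g w -> (0 <= ((2 * g w) ^+ q.+1)%:E)%E.
  by move=> g0; rewrite lee_fin exprn_ge0// mulr_ge0.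
have mAB : measurable_fun setT
    (fun w => ((2 * A w) ^+ q.+1)%:E + ((2 * B w) ^+ q.+1)%:E)%E.
  by apply: emeasurable_funD; exact: m2.
apply: (@le_trans _ _ (\int[P]_w ((2^-1)%:E *
    (((2 * A w) ^+ q.+1)%:E + ((2 * B w) ^+ q.+1)%:E)))%E).
  apply: ae_ge0_le_integral => //.
  - by apply/measurable_EFinP; apply: measurable_funX; exact: measurableT_comp.
  - by move=> w _; rewrite mule_ge0// adde_ge0// p2.
  - exact: emeasurable_funM.
  - apply: filterS UAB => w Uw _; rewrite -EFinD -EFinM lee_fin mulrC.
    apply: le_trans (exprn_midpoint_le q (A0 w) (B0 w)).
    by rewrite lerXn2r ?nnegrE// addr_ge0.
rewrite ge0_integralZl//; last by move=> w _; rewrite adde_ge0// p2.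
rewrite ge0_integralD//; last 4 first.
- by move=> w _; exact: p2.
- exact: m2.
- by move=> w _; exact: p2.
- exact: m2.
apply: (@le_trans _ _ ((2^-1)%:E * (a%:E + b%:E))%E).
  by rewrite lee_wpmul2l// leeD.
by rewrite -EFinD -EFinM lee_fin mulrC.
Qed.

End moment_combination.

(** * Moments of the Ornstein-Uhlenbeck part *)

Section disc_bounds.
Context {R : realType}.
Local Notation mu := (@lebesgue_measure R).

Lemma locally_bounded_disc_weight (a t : R) (h : R -> R) : locally_bounded h ->
  locally_bounded (fun u => disc_weight a t u * h u).
Proof.
move=> bh; apply: locally_boundedM => //.
by apply: continuous_locally_bounded; exact: continuous_disc_weight.
Qed.

Lemma discD (a t : R) (h k : R -> R) : locally_bounded h -> locally_bounded k ->
  disc a t (fun u => h u + k u) = disc a t h + disc a t k.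
Proof.
move=> bh bk; rewrite /disc -RintegralD//.
- by apply: eq_Rintegral => u _; rewrite mulrDr.
- exact/locally_bounded_integrable/locally_bounded_disc_weight.
- exact/locally_bounded_integrable/locally_bounded_disc_weight.
Qed.

Lemma discZ (a t c : R) (h : R -> R) : locally_bounded h ->
  disc a t (fun u => c * h u) = c * disc a t h.
Proof.
move=> bh; rewrite /disc -RintegralZl//.
  by apply: eq_Rintegral => u _; rewrite mulrCA.
exact/locally_bounded_integrable/locally_bounded_disc_weight.
Qed.

Lemma le_disc (a t : R) (h k : R -> R) : 0 <= a ->
  locally_bounded h -> locally_bounded k ->
  (forall u, 0 <= u -> h u <= k u) -> disc a t h <= disc a t k.
Proof.
move=> a0 bh bk hk; apply: le_Rintegral => //.
- exact/locally_bounded_integrable/locally_bounded_disc_weight.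
- exact/locally_bounded_integrable/locally_bounded_disc_weight.
- move=> u; rewrite /= in_itv/= => /andP[u0 _].
  by rewrite ler_wpM2l ?disc_weight_ge0// hk.
Qed.

Lemma disc_ge0 (a t : R) (h : R -> R) : 0 <= a -> (forall u, 0 <= h u) ->
  0 <= disc a t h.
Proof.
by move=> a0 h0; apply: Rintegral_ge0 => u _; rewrite mulr_ge0 ?disc_weight_ge0.
Qed.

Lemma norm_disc_le (a t : R) (h : R -> R) : 0 <= a -> locally_bounded h ->
  `|disc a t h| <= disc a t (fun u => `|h u|).
Proof.
move=> a0 bh; apply: (le_trans (le_normr_Rintegral _ _)) => //.
  exact/locally_bounded_integrable/locally_bounded_disc_weight.
apply: eq_lexx; apply: eq_Rintegral => u _.
by rewrite normrM ger0_norm ?disc_weight_ge0.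
Qed.

(* One half of the exponent is kept in the kernel, the other half compensates
   the growth of the increment. *)
Lemma sub_disc_le (a t : R) (h : R -> R) : 0 < a -> 0 <= t -> continuous h ->
  `|h t - disc a t h| <= expR (- (a * t)) * `|h t| +
    2 * disc (a / 2) t (fun u => expR (- (a / 2 * (t - u))) * `|h t - h u|).
Proof.
move=> a0 t0 ch.
have bh := continuous_locally_bounded ch.
have bc : locally_bounded (fun=> h t).
  by apply: continuous_locally_bounded; exact: cst_continuous.
have bN : locally_bounded (fun u => - h u) by exact: locally_boundedN.
have bd : locally_bounded (fun u => h t + - h u) by exact: locally_boundedD.
(* The weight has mass [1 - expR (- (a * t))]; the missing mass produces the boundary term. *)
have E : h t - disc a t h = expR (- (a * t)) * h t + disc a t (fun u => h t + - h u).
  rewrite discD// disc_cst//.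
  have -> : disc a t (fun u => - h u) = - disc a t h.
    rewrite -mulN1r -discZ//; congr disc; apply/funext => u.
    by rewrite mulN1r.
  ring.
rewrite E (le_trans (ler_normD _ _))// lerD//.
  by rewrite normrM ger0_norm ?expR_ge0.
apply: (le_trans (norm_disc_le _ (ltW a0) bd)).
apply: eq_lexx.
rewrite -discZ; last first.
  apply: locally_boundedM; last exact: locally_bounded_norm.
  apply: continuous_locally_bounded => u.
  apply: continuous_comp; last exact: continuous_expR.
  apply: cvgN; apply: cvgM; first exact: cvg_cst.
  by apply: cvgB; [exact: cvg_cst|exact: cvg_id].
apply: eq_Rintegral => u _; rewrite /disc_weight.
have -> : - (a * (t - u)) = - (a / 2 * (t - u)) + - (a / 2 * (t - u)) by field.
by rewrite expRD; field.
Qed.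

(** [Num.sqrt v <= 1 + v], and the exponential dominates both terms. The square-root growth of
    Brownian increments is thereby absorbed with a bound free of time. *)
Lemma expR_sqrt_le (a v : R) : 0 < a -> 0 <= v ->
  expR (- (a * v)) * Num.sqrt v <= 1 + a^-1.
Proof.
move=> a0 v0.
have sv : Num.sqrt v <= 1 + v.
  have := sqr_ge0 (Num.sqrt v - 1); have := sqr_sqrtr v0; have := sqrtr_ge0 v.
  nra.
rewrite expRN mulrC ler_pdivrMr ?expR_gt0// (le_trans sv)//.
have h1 : 1 + a * v <= expR (a * v) by exact: expR_ge1Dx.
have ai : 0 <= a^-1 by rewrite invr_ge0 ltW.
have h2 : v <= a^-1 * expR (a * v).
  apply: le_trans (ler_wpM2l ai h1); rewrite mulrDr mulrA mulVf ?gt_eqF// mul1r mulr1.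
  by rewrite lerDr.
have h3 : 1 <= expR (a * v) by rewrite (le_trans _ h1)// lerDl mulr_ge0// ltW.
by rewrite mulrDl mul1r lerD.
Qed.

End disc_bounds.

Section strong_error.
Context {R : realType} {d : measure_display} {T : measurableType d}.
Variables (P : probability T R) (F : R -> set (set T)).
Variables (f kappa sigma : R -> R) (x0 eps delta : R) (W X : R -> T -> R).
Hypothesis sol : weak_solution P F f kappa sigma x0 eps delta W X.
Hypothesis eps0 : 0 < eps.
Hypothesis delta0 : 0 < delta.
Hypothesis cf : continuous f.
Hypothesis ck : continuous kappa.
Hypothesis cs : continuous sigma.
Variable gam : R.
Hypothesis gam0 : 0 < gam.
Hypothesis kappa_le : forall y, `|kappa y| <= gam.
Hypothesis sigma_le : forall y, `|sigma y| <= gam.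
Variable lambda : R.
Hypothesis lambda0 : 0 < lambda.

Local Notation Xe := (ext X).
Local Notation Kd := (frozen kappa delta X).
Local Notation N := (pnoise f kappa x0 delta X).

Definition pou (u : R) (w : T) : R := ou f (Xe^~ w) (Kd^~ w) lambda x0 u.

Let jN : jointly_measurable N.
Proof. exact: (pnoise_jointly_measurable sol delta0 cf ck kappa_le). Qed.

Let mN t : measurable_fun setT (N t).
Proof. exact: jointly_measurable_at. Qed.

Let cN w : continuous (N^~ w).
Proof. exact: (pnoise_continuous sol delta0 cf ck kappa_le). Qed.

Let bK w : locally_bounded (Kd^~ w).
Proof. exact: (frozen_locally_bounded sol delta0 ck kappa_le). Qed.

Let cX w : continuous (Xe^~ w).
Proof. exact: (ext_continuous sol). Qed.

Lemma pou_continuous w : continuous (pou^~ w).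
Proof. by apply: continuous_ou; [exact: cf|exact: cX|exact: bK]. Qed.

Lemma pou_measurable t : measurable_fun setT (pou t).
Proof. by apply: measurable_funB; [exact: mN|exact: measurable_disc]. Qed.

Lemma pou_jointly_measurable : jointly_measurable pou.
Proof.
apply: continuous_jointly_measurable; first exact: pou_measurable.
  exact: pou_continuous.
move=> t w t0; rewrite /pou /ou; congr (_ - _).
  by rewrite /noise ext_le0// !primitive_le0.
by rewrite !disc_primitive ?primitive_le0 ?mulr0//;
  apply: continuous_locally_bounded; exact: cN.
Qed.

Lemma pnoise0_ae : {ae P, forall w, N 0 w = 0}.
Proof.
case: sol => _ _ _ h _; apply: filterS h => w h.
by rewrite /pnoise /noise /ext maxxx h primitive_le0// subrr subr0.
Qed.

(** The two summands belong to the two terms of [sub_disc_le], with decay rates [lambda] and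
    [lambda / 2] in [expR_sqrt_le]. [moment_add_le] doubles both; the second carries a factor 2
    already, hence 4. *)
Definition ou_const (p : nat) : R := ito_moment_const p *
  ((2 * (gam * (1 + lambda^-1))) ^+ p + (4 * (gam * (1 + (lambda / 2)^-1))) ^+ p) / 2.

Lemma ou_const_ge0 p : 0 <= ou_const p.
Proof.
have c0 : 0 <= ito_moment_const p :> R by exact/ltW/ito_moment_const_gt0.
have g0 := ltW gam0; have l0 : 0 <= lambda^-1 by rewrite invr_ge0 ltW.
have l1 : 0 <= (lambda / 2)^-1 by rewrite invr_ge0 divr_ge0// ltW.
by rewrite divr_ge0// mulr_ge0// addr_ge0// exprn_ge0// !mulr_ge0// addr_ge0.
Qed.

(** By [sub_disc_le], [Z t] is controlled by exponentially weighted increments of the noise ending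
    at [t]; the weights cancel their growth in the length of the time interval. *)
Lemma pou_moment_le (t : R) (q : nat) : 0 <= t ->
  (\int[P]_w (`|pou t w| ^+ q.+1)%:E <= (ou_const q.+1 * eps ^+ q.+1)%:E)%E.
Proof.
move=> t0; set p := q.+1.
have c0 : 0 <= ito_moment_const p :> R by exact/ltW/ito_moment_const_gt0.
have lh0 : 0 < lambda / 2 by rewrite divr_gt0.
have g0 := ltW gam0; have e0 : 0 <= eps ^+ p by rewrite exprn_ge0// ltW.
pose K1 := 1 + lambda^-1; pose K2 := 1 + (lambda / 2)^-1.
have K10 : 0 <= K1 by rewrite addr_ge0// invr_ge0 ltW.
have K20 : 0 <= K2 by rewrite addr_ge0// invr_ge0 ltW.
have mom s : 0 <= s <= t -> (\int[P]_w (`|N t w - N s w| ^+ p)%:E <=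
    (eps ^+ p * (ito_moment_const p * (gam * Num.sqrt (t - s)) ^+ p))%:E)%E.
  move=> /andP[s0 st].
  exact: (pnoise_moment_le sol eps0 delta0 cf ck cs gam0 sigma_le q s0 st).
have scale k a v : 0 < a -> 0 <= v -> 0 <= k ->
    (k * expR (- (a * v))) ^+ p *
      (eps ^+ p * (ito_moment_const p * (gam * Num.sqrt v) ^+ p)) <=
    ito_moment_const p * (k * (gam * (1 + a^-1))) ^+ p * eps ^+ p.
  move=> a0 v0 k0.
  have -> : (k * expR (- (a * v))) ^+ p *
      (eps ^+ p * (ito_moment_const p * (gam * Num.sqrt v) ^+ p)) =
      ito_moment_const p * (k * (gam * (expR (- (a * v)) * Num.sqrt v))) ^+ p * eps ^+ p.
    by rewrite !exprMn; ring.
  rewrite ler_wpM2r// ler_wpM2l// lerXn2r ?nnegrE//.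
  - by rewrite !mulr_ge0 ?expR_ge0 ?sqrtr_ge0.
  - by rewrite !mulr_ge0// addr_ge0// invr_ge0 ltW.
  - by rewrite ler_wpM2l// ler_wpM2l// expR_sqrt_le.
have mD s : measurable_fun setT (fun w => `|N t w - N s w|).
  by apply: measurableT_comp => //; apply: measurable_funB; exact: mN.
pose HH u w := expR (- (lambda / 2 * (t - u))) * `|N t w - N u w|.
have jHH : jointly_measurable HH.
  apply: jointly_measurableM.
    apply: (@jointly_measurable_deterministic _ _ _
      (fun u => expR (- (lambda / 2 * (t - u))))).
    apply: measurableT_comp => //; apply: measurableT_comp => //.
    by apply: measurable_funM => //; exact: measurable_funB.
  apply: (@jointly_measurable_comp _ _ _ Num.norm (fun u w => N t w - N u w)) => //.
  apply: jointly_measurableB => //.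
  exact: (measurableT_comp (mN t) measurable_fst).
have HH0 u w : 0 <= HH u w by rewrite mulr_ge0 ?expR_ge0.
have -> : ou_const p * eps ^+ p =
  (ito_moment_const p * (2 * (gam * K1)) ^+ p * eps ^+ p +
   ito_moment_const p * (4 * (gam * K2)) ^+ p * eps ^+ p) / 2.
  by rewrite /ou_const; ring.
apply: (@moment_add_le _ _ _ P _ _ _
  (fun w => expR (- (lambda * t)) * `|N t w - N 0 w|)
  (fun w => 2 * disc (lambda / 2) t (HH^~ w))).
- exact: pou_measurable.
- exact: measurable_funM.
- by apply: measurable_funM => //; exact: measurable_disc.
- by move=> w; rewrite mulr_ge0 ?expR_ge0.
- by move=> w; rewrite mulr_ge0// disc_ge0// ltW.
(* [N 0] vanishes almost surely, so the boundary term is the increment from 0, whose moments are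
   known. *)
- apply: filterS pnoise0_ae => w Nw; rewrite Nw subr0.
  exact: (sub_disc_le lambda0 t0 (@cN w)).
- under eq_integral do rewrite mulrA.
  have k0 : 0 <= 2 * expR (- (lambda * t)) by rewrite mulr_ge0 ?expR_ge0.
  have m0 : 0 <= (0 : R) <= t by rewrite lexx.
  apply: le_trans (moment_scale_le k0 (mD 0) (fun w => normr_ge0 _) (mom 0 m0)) _.
  by rewrite lee_fin subr0; apply: scale.
- under eq_integral do rewrite mulrA.
  have -> : ito_moment_const p * (4 * (gam * K2)) ^+ p * eps ^+ p =
    (2 * 2) ^+ p * (ito_moment_const p * (1 * (gam * K2)) ^+ p * eps ^+ p).
    by rewrite -natrM !exprMn expr1n; ring.
  apply: moment_scale_le => //.
  + exact: measurable_disc.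
  + by move=> w; rewrite disc_ge0// ltW.
  apply: disc_moment_le => //.
  + rewrite mulr_ge0// mulr_ge0// exprn_ge0// mul1r mulr_ge0//.
  + move=> u /andP[u0 ut].
    have m0 : 0 <= u <= t by rewrite u0.
    apply: le_trans (moment_scale_le (expR_ge0 _) (mD u) (fun w => normr_ge0 _)
      (mom u m0)) _.
    rewrite lee_fin -[X in X ^+ p * _]mul1r; apply: scale => //.
    by rewrite subr_ge0.
Qed.

End strong_error.

Lemma add1_exprn_le {R : realType} (z : R) (m : nat) : 0 <= z ->
  (1 + z) ^+ m <= 2 ^+ m * (1 + z ^+ m).
Proof.
move=> z0; rewrite mulrDr mulr1 -exprMn; have [z1|z1] := leP z 1.
  rewrite (@le_trans _ _ (2 ^+ m))// ?lerDl ?exprn_ge0 ?mulr_ge0//.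
  by rewrite lerXn2r ?nnegrE ?addr_ge0//; lra.
rewrite (@le_trans _ _ ((2 * z) ^+ m))// ?lerDr ?exprn_ge0//.
by rewrite lerXn2r ?nnegrE ?addr_ge0 ?mulr_ge0//; lra.
Qed.

(** * One step of the error estimate *)

Section strong_error_step.
Context {R : realType} {d : measure_display} {T : measurableType d}.
Variables (P : probability T R) (F : R -> set (set T)).
Variables (f kappa sigma : R -> R) (x0 eps delta : R) (W X : R -> T -> R).
Hypothesis sol : weak_solution P F f kappa sigma x0 eps delta W X.
Hypothesis eps0 : 0 < eps.
Hypothesis eps1 : eps <= 1.
Hypothesis delta0 : 0 < delta.
Hypothesis cf : continuous f.
Hypothesis ck : continuous kappa.
Hypothesis cs : continuous sigma.
Variable gam : R.
Hypothesis gam0 : 0 < gam.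
Hypothesis kappa_le : forall y, `|kappa y| <= gam.
Hypothesis sigma_le : forall y, `|sigma y| <= gam.
Variable lambda : R.
Hypothesis lambda0 : 0 < lambda.
Hypothesis f_dissipative :
  forall y z, (y - z) * (f y - f z) <= - lambda * `|y - z| ^+ 2.
Variable x : R -> R.
Hypothesis cx : continuous x.
Hypothesis x_0 : x 0 = x0.
Hypothesis dx : forall t : R, 0 < t -> is_derive t 1 x (f (x t) + kappa (x t)).
Variables (c1 : R) (n : nat).
Hypothesis c10 : 0 <= c1.
Hypothesis growth : forall u z, 0 <= u ->
  `|f (x u + z) - f (x u)| + lambda * `|z| <= c1 * ((1 + `|z|) ^+ n * `|z|).

Local Notation Xe := (ext X).
Local Notation Kd := (frozen kappa delta X).
Local Notation Z := (pou f kappa x0 delta X lambda).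

Definition perturbation (u : R) (w : T) : R :=
  `|f (x u + Z u w) - f (x u)| + lambda * `|Z u w|.

Let jZ : jointly_measurable Z.
Proof. exact: (pou_jointly_measurable sol delta0 cf ck kappa_le). Qed.

Let cZ w : continuous (Z^~ w).
Proof. exact: (pou_continuous sol delta0 cf ck kappa_le). Qed.

Let mf : measurable_fun setT f. Proof. exact: continuous_measurable_fun. Qed.
Let mx : measurable_fun setT x. Proof. exact: continuous_measurable_fun. Qed.

Lemma perturbation_jointly_measurable : jointly_measurable perturbation.
Proof.
have jx := jointly_measurable_deterministic (T := T) mx.
have jn (Y : R -> T -> R) : jointly_measurable Y -> jointly_measurable (fun u w => `|Y u w|).
  by move=> jY; apply: jointly_measurable_comp.
apply: jointly_measurableD.
  apply: jn; apply: jointly_measurableB.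
    by apply: jointly_measurable_comp => //; exact: jointly_measurableD.
  by apply: jointly_measurable_comp.
apply: jointly_measurableM; last exact: jn.
by apply: jointly_measurable_deterministic.
Qed.

Lemma perturbation_locally_bounded w : locally_bounded (perturbation^~ w).
Proof.
apply: continuous_locally_bounded => u; apply: cvgD.
  apply: cvg_norm; apply: cvgB; last by apply: continuous_comp; [exact: cx|exact: cf].
  apply: (@continuous_comp _ _ _ (fun u => x u + Z u w) f); last exact: cf.
  by apply: cvgD; [exact: cx|exact: cZ].
by apply: cvgM; [exact: cvg_cst|apply: cvg_norm; exact: cZ].
Qed.

Lemma perturbation_ge0 u w : 0 <= perturbation u w.
Proof. by rewrite addr_ge0// mulr_ge0// ltW. Qed.

(** The p-th power of the growth bound involves |Z| to the orders [p] and [n * p + p]; since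
    [eps <= 1], the moment of the higher order is also at most a multiple of [eps ^+ p]. *)
Definition perturbation_const (p : nat) : R := c1 ^+ p * 2 ^+ (n * p) *
  (ou_const gam lambda p + ou_const gam lambda (n * p + p)).

Lemma perturbation_const_ge0 p : 0 <= perturbation_const p.
Proof. by rewrite mulr_ge0 ?mulr_ge0 ?exprn_ge0// addr_ge0// ou_const_ge0. Qed.

Lemma perturbation_moment_le (u : R) (q : nat) : 0 <= u ->
  (\int[P]_w (perturbation u w ^+ q.+1)%:E <=
   (perturbation_const q.+1 * eps ^+ q.+1)%:E)%E.
Proof.
move=> u0; set p := q.+1.
have zmom m : (\int[P]_w (`|Z u w| ^+ m.+1)%:E <=
    (ou_const gam lambda m.+1 * eps ^+ m.+1)%:E)%E.
  exact: (pou_moment_le sol eps0 delta0 cf ck cs gam0 kappa_le sigma_le lambda0 m u0).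
have mZ m : measurable_fun setT (fun w => (`|Z u w| ^+ m)%:E).
  apply/measurable_EFinP; apply: measurable_funX; apply: measurableT_comp => //.
  exact: jointly_measurable_at.
have Zp m w : (0 <= (`|Z u w| ^+ m)%:E)%E by rewrite lee_fin exprn_ge0.
pose k : R := c1 ^+ p * 2 ^+ (n * p).
have k0 : 0 <= k by rewrite mulr_ge0 ?exprn_ge0.
apply: (@le_trans _ _
    (\int[P]_w (k%:E * ((`|Z u w| ^+ p)%:E + (`|Z u w| ^+ (n * p + p))%:E)))%E).
  apply: ge0_le_integral => //.
  - by move=> w _; rewrite lee_fin exprn_ge0// perturbation_ge0.
  - apply/measurable_EFinP; apply: measurable_funX.
    by apply: jointly_measurable_at; exact: perturbation_jointly_measurable.
  - by apply: emeasurable_funM => //; exact: emeasurable_funD.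
  - move=> w _; rewrite -EFinD -EFinM lee_fin.
    apply: (@le_trans _ _ ((c1 * ((1 + `|Z u w|) ^+ n * `|Z u w|)) ^+ p)).
      rewrite lerXn2r ?nnegrE ?perturbation_ge0//.
        by rewrite !mulr_ge0// exprn_ge0// addr_ge0.
      exact: growth.
    rewrite !exprMn -exprM /k -mulrA ler_wpM2l ?exprn_ge0//.
    rewrite [X in _ <= _ * X](_ : _ = (1 + `|Z u w| ^+ (n * p)) * `|Z u w| ^+ p).
      by rewrite mulrA ler_wpM2r ?exprn_ge0// add1_exprn_le.
    by rewrite exprD mulrDl mul1r.
have k0' : (0 <= k%:E)%E by rewrite lee_fin.
have mZZ : measurable_fun setT
    (fun w => (`|Z u w| ^+ p)%:E + (`|Z u w| ^+ (n * p + p))%:E)%E.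
  exact: emeasurable_funD.
rewrite ge0_integralZl//; last by move=> w _; rewrite adde_ge0.
rewrite ge0_integralD//.
have h2 := zmom (n * p + q)%N; rewrite -addnS -/p in h2.
apply: (le_trans (lee_wpmul2l k0' (leeD (zmom q) h2))).
rewrite -EFinD -EFinM lee_fin /perturbation_const -/k -mulrA ler_wpM2l//.
rewrite mulrDl lerD2l ler_wpM2l ?ou_const_ge0//.
by rewrite exprD ler_piMl ?exprn_ge0 ?(ltW eps0)// exprn_ile1// ltW.
Qed.

(** Every use of [moment_add_le] doubles its terms: [Z] is doubled twice, the discounted
    perturbation and the constant [c] three times, and [lambda^-1] comes from [comparison]. *)
Definition step_const (p : nat) : R := 4 ^+ p * ou_const gam lambda p +
  (8 / lambda) ^+ p * perturbation_const p + (8 / lambda) ^+ p.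

Lemma step_const_ge0 p : 0 <= step_const p.
Proof.
have l0 : 0 <= 8 / lambda by rewrite divr_ge0// ltW.
apply: addr_ge0; last exact: exprn_ge0.
apply: addr_ge0; apply: mulr_ge0; rewrite ?exprn_ge0 ?ou_const_ge0//.
exact: perturbation_const_ge0.
Qed.

(** [c] and [r] are left open because the step is taken twice. The factor [lambda / 2] before [r]
    meets [lambda^-1] from [comparison] and the 2 of [moment_add_le], so that [M] enters with the
    coefficient one half exactly. *)
Lemma strong_error_step (t c M : R) (r : R -> T -> R) (q : nat) :
  0 <= t -> 0 <= c -> 0 <= M -> jointly_measurable r -> (forall u w, 0 <= r u w) ->
  (forall w, locally_bounded (r^~ w)) ->
  (forall u w, 0 <= u -> `|Kd u w - kappa (x u)| <= c + lambda / 2 * r u w) ->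
  (forall u, 0 <= u <= t -> (\int[P]_w (r u w ^+ q.+1)%:E <= M%:E)%E) ->
  (\int[P]_w (`|Xe t w - x t| ^+ q.+1)%:E <=
   ((step_const q.+1 * (eps ^+ q.+1 + c ^+ q.+1) + M) / 2)%:E)%E.
Proof.
move=> t0 c0 M0 jr r0 br Kr rM; set p := q.+1.
have li0 : 0 <= lambda^-1 by rewrite invr_ge0 ltW.
have ep0 : 0 <= eps ^+ p by rewrite exprn_ge0// ltW.
have cp0 : 0 <= c ^+ p by rewrite exprn_ge0.
pose D1 w := disc lambda t (perturbation^~ w).
pose Dr w := disc lambda t (r^~ w).
have mD1 : measurable_fun setT D1.
  by apply: measurable_disc; exact: perturbation_jointly_measurable.
have mDr : measurable_fun setT Dr by exact: measurable_disc.
have D10 w : 0 <= D1 w.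
  by apply: disc_ge0; [exact: ltW|move=> u; exact: perturbation_ge0].
have Dr0 w : 0 <= Dr w by apply: disc_ge0; [exact: ltW|].
have mZt : measurable_fun setT (Z t) by exact: jointly_measurable_at.
have mZn : measurable_fun setT (fun w => `|Z t w|) by exact: measurableT_comp.
(* [A] collects everything but the [r] term, so that a single splitting is spent on [r]; further
   splittings inside [A] affect only the constant. *)
pose A w := `|Z t w| + (lambda^-1 * D1 w + lambda^-1 * c).
have mlD : measurable_fun setT (fun w => lambda^-1 * D1 w + lambda^-1 * c).
  by apply: measurable_funD => //; exact: measurable_funM.
have lD0 w : 0 <= lambda^-1 * D1 w + lambda^-1 * c by rewrite addr_ge0// mulr_ge0.
have mA : measurable_fun setT A by exact: measurable_funD.
have A0 w : 0 <= A w by rewrite addr_ge0.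
have path w : `|Xe t w - x t| <= A w + 2^-1 * Dr w.
  have ckx : continuous (kappa \o x).
    by move=> u; apply: continuous_comp; [exact: cx|exact: ck].
  have bK : locally_bounded (Kd^~ w).
    exact: (frozen_locally_bounded sol delta0 ck kappa_le).
  have cK := fun j s => @frozen_continuous _ _ _ kappa delta X delta0 w j s.
  apply: (le_trans (comparison lambda0 delta0 cf f_dissipative
    (@ext_continuous _ _ _ _ _ _ _ _ _ _ _ _ _ sol w) cx ckx x_0 dx bK cK t0)).
  rewrite /A -addrA lerD2l.
  have bp := perturbation_locally_bounded w.
  have bd : locally_bounded (fun u => `|Kd u w - kappa (x u)|).
    apply: locally_bounded_norm; apply: locally_boundedD => //.
    by apply: locally_boundedN; exact: continuous_locally_bounded.
  have bc : locally_bounded (fun=> c).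
    by apply: continuous_locally_bounded; exact: cst_continuous.
  have bl : locally_bounded (fun u => lambda / 2 * r u w).
    apply: locally_boundedM => //.
    by apply: continuous_locally_bounded; exact: cst_continuous.
  have H : disc lambda t (fun u => perturbation u w + `|Kd u w - kappa (x u)|) <=
      D1 w + (c + lambda / 2 * Dr w).
    apply: (@le_trans _ _ (disc lambda t (fun u => perturbation u w +
        (c + lambda / 2 * r u w)))).
      apply: le_disc; first exact: ltW.
      - exact: locally_boundedD.
      - by apply: locally_boundedD => //; exact: locally_boundedD.
      - by move=> u u0; rewrite lerD2l Kr.
    rewrite discD//; last exact: locally_boundedD.
    rewrite lerD2l discD// discZ// lerD2r disc_cst//.
    by rewrite ler_piMl// gerBl expR_ge0.
  apply: (le_trans (ler_wpM2l li0 H)).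
  apply: eq_lexx.
  by field; rewrite gt_eqF.
have mDc : (\int[P]_w (D1 w ^+ p)%:E <= (perturbation_const p * eps ^+ p)%:E)%E.
  apply: disc_moment_le => //.
  - by rewrite mulr_ge0 ?perturbation_const_ge0.
  - exact: perturbation_jointly_measurable.
  - exact: perturbation_ge0.
  - by move=> u /andP[u0 _]; exact: perturbation_moment_le.
have tail : (\int[P]_w (`|2 * (2 * (lambda^-1 * D1 w + lambda^-1 * c))| ^+ p)%:E <=
    (((8 / lambda) ^+ p * (perturbation_const p * eps ^+ p) +
      (8 / lambda * c) ^+ p) / 2)%:E)%E.
  apply: (@moment_add_le _ _ _ P _ _ _
    (fun w => 4 / lambda * D1 w) (fun=> 4 / lambda * c)).
  - by apply: measurable_funM => //; exact: measurable_funM.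
  - exact: measurable_funM.
  - exact: measurable_cst.
  - by move=> w; rewrite mulr_ge0// divr_ge0// ltW.
  - by move=> w; rewrite mulr_ge0// divr_ge0// ltW.
  - apply: aeW => w; rewrite ger0_norm ?mulr_ge0//.
    by apply: eq_lexx; ring.
  - have -> : (fun w => ((2 * (4 / lambda * D1 w)) ^+ p)%:E) =
        (fun w => ((8 / lambda * D1 w) ^+ p)%:E).
      by apply/funext => w; congr ((_ ^+ _)%:E); ring.
    by apply: moment_scale_le => //; rewrite divr_ge0// ltW.
  - have P1 : P setT = 1%E by exact: probability_setT.
    rewrite integral_cst//= P1 mule1 lee_fin.
    by apply: eq_lexx; congr (_ ^+ _); ring.
have twoA : (\int[P]_w ((2 * A w) ^+ p)%:E <=
    (step_const p * (eps ^+ p + c ^+ p))%:E)%E.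
  have -> : (fun w => ((2 * A w) ^+ p)%:E) = (fun w => (`|2 * A w| ^+ p)%:E).
    by apply/funext => w; rewrite ger0_norm// mulr_ge0.
  have zmom : (\int[P]_w ((2 * (2 * `|Z t w|)) ^+ p)%:E <=
      (4 ^+ p * (ou_const gam lambda p * eps ^+ p))%:E)%E.
    have -> : (fun w => ((2 * (2 * `|Z t w|)) ^+ p)%:E) =
        (fun w => ((4 * `|Z t w|) ^+ p)%:E).
      by apply/funext => w; congr ((_ ^+ _)%:E); ring.
    apply: moment_scale_le => //.
    exact: (pou_moment_le sol eps0 delta0 cf ck cs gam0 kappa_le sigma_le lambda0 q t0).
  have tail' : (\int[P]_w ((2 * (2 * (lambda^-1 * D1 w + lambda^-1 * c))) ^+ p)%:E <=
    (((8 / lambda) ^+ p * (perturbation_const p * eps ^+ p) +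
      (8 / lambda * c) ^+ p) / 2)%:E)%E.
    apply: le_trans tail; apply: eq_lexx.
    by apply: eq_integral => w _; rewrite ger0_norm ?mulr_ge0.
  apply: le_trans (moment_add_le _ _ _ _ _ _ zmom tail') _.
  - exact: measurable_funM.
  - exact: measurable_funM.
  - exact: measurable_funM.
  - by move=> w; rewrite mulr_ge0.
  - by move=> w; rewrite mulr_ge0.
  - apply: aeW => w; rewrite ger0_norm ?mulr_ge0//.
    by apply: eq_lexx; rewrite /A; ring.
  - rewrite lee_fin (exprMn p (8 / lambda) c) /step_const.
    set l8 := (8 / lambda) ^+ p; set pc := perturbation_const p.
    set oc := ou_const _ _ _; set f4 := 4 ^+ p.
    have l80 : 0 <= l8 by rewrite exprn_ge0// divr_ge0// ltW.
    have pc0 : 0 <= pc by exact: perturbation_const_ge0.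
    have oc0 : 0 <= oc by exact: ou_const_ge0.
    have f40 : 0 <= f4 by rewrite exprn_ge0.
    have := mulr_ge0 (mulr_ge0 f40 oc0) ep0; have := mulr_ge0 (mulr_ge0 f40 oc0) cp0.
    have := mulr_ge0 (mulr_ge0 l80 pc0) ep0; have := mulr_ge0 (mulr_ge0 l80 pc0) cp0.
    have := mulr_ge0 l80 ep0; have := mulr_ge0 l80 cp0.
    set e := eps ^+ p; set cp := c ^+ p.
    have -> : (f4 * (oc * e) + (l8 * (pc * e) + l8 * cp) / 2) / 2 =
      (f4 * oc * e + (l8 * pc * e + l8 * cp) / 2) / 2 by ring.
    have -> : (f4 * oc + l8 * pc + l8) * (e + cp) =
      f4 * oc * e + f4 * oc * cp + l8 * pc * e + l8 * pc * cp + l8 * e + l8 * cp by ring.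
    lra.
apply: (@moment_add_le _ _ _ P _ _ _ A (fun w => 2^-1 * Dr w)) => //.
- by apply: measurable_funB => //; exact: (ext_measurable sol).
- exact: measurable_funM.
- by move=> w; rewrite mulr_ge0.
- exact: aeW.
- under eq_integral do rewrite mulrA divff// mul1r.
  exact: disc_moment_le.
Qed.

End strong_error_step.

(** Both arguments of [f] are bounded by [(1 + K) * (1 + |z|)], a number at least 1, so the real
    exponent [q] can be raised to the integer above it; integer powers fit the moment bounds. *)
Lemma polynomial_growth {R : realType} (f x : R -> R) (q xi m lambda K : R) :
  0 < q -> 0 < xi -> 0 < m -> 0 < lambda ->
  (forall y z, `|f y - f z| <= (xi * (`|y| `^ q + `|z| `^ q) + m) * `|y - z|) ->
  (forall u, 0 <= u -> `|x u| <= K) ->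
  exists c1 n, 0 <= c1 /\ forall u z, 0 <= u ->
    `|f (x u + z) - f (x u)| + lambda * `|z| <= c1 * ((1 + `|z|) ^+ n * `|z|).
Proof.
move=> q0 xi0 m0 l0 f_lip xK.
have K0 : 0 <= K by rewrite (le_trans _ (xK 0 (lexx _))).
pose n := (Num.truncn q).+1.
exists (xi * (2 * (1 + K) ^+ n) + m + lambda), n; split.
  by rewrite !addr_ge0 ?(ltW m0) ?(ltW l0)// !mulr_ge0 ?exprn_ge0 ?addr_ge0// ltW.
move=> u z u0; set E := (1 + `|z|) ^+ n.
have E1 : 1 <= E by rewrite exprn_ege1// lerDl.
have pow (v : R) : `|v| <= (1 + K) * (1 + `|z|) -> `|v| `^ q <= (1 + K) ^+ n * E.
  move=> vb; have b1 : 1 <= (1 + K) * (1 + `|z|).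
    by rewrite mulr_ege1// lerDl.
  apply: (le_trans (powR_le_bound q0 vb)); rewrite /E -exprMn -powR_mulrn ?(le_trans ler01)//.
  by apply: ler_powR => //; rewrite ltW// truncnS_gt.
have xz : `|x u + z| `^ q <= (1 + K) ^+ n * E.
  apply: pow; apply: (le_trans (ler_normD _ _)).
  have := xK _ u0; have := normr_ge0 z; have := mulr_ge0 K0 (normr_ge0 z); lra.
have xx : `|x u| `^ q <= (1 + K) ^+ n * E.
  apply: pow.
  have := xK _ u0; have := normr_ge0 z; have := mulr_ge0 K0 (normr_ge0 z); lra.
have h := f_lip (x u + z) (x u); rewrite (_ : x u + z - x u = z) in h; last by ring.
have mE : m <= m * E by rewrite ler_peMr// ltW.
have lE : lambda <= lambda * E by rewrite ler_peMr// ltW.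
apply: (@le_trans _ _ ((xi * (`|x u + z| `^ q + `|x u| `^ q) + m + lambda) * `|z|)).
  by rewrite mulrDl lerD2r.
rewrite [leRHS]mulrA ler_wpM2r//.
have -> : (xi * (2 * (1 + K) ^+ n) + m + lambda) * E =
  xi * ((1 + K) ^+ n * E + (1 + K) ^+ n * E) + m * E + lambda * E by ring.
by rewrite lerD// lerD// (ler_wpM2l (ltW xi0))// lerD.
Qed.

(** * Closing the estimate uniformly in time *)

Section uniform_strong_error.
Context {R : realType} {d : measure_display} {T : measurableType d}.
Variables (P : probability T R) (F : R -> set (set T)).
Variables (f kappa sigma : R -> R) (x0 eps delta : R) (W X : R -> T -> R).
Hypothesis sol : weak_solution P F f kappa sigma x0 eps delta W X.
Hypothesis eps0 : 0 < eps.
Hypothesis eps1 : eps <= 1.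
Hypothesis delta0 : 0 < delta.
Hypothesis cf : continuous f.
Hypothesis ck : continuous kappa.
Hypothesis cs : continuous sigma.
Variable gam : R.
Hypothesis gam0 : 0 < gam.
Hypothesis kappa_le : forall y, `|kappa y| <= gam.
Hypothesis sigma_le : forall y, `|sigma y| <= gam.
Variable lambda : R.
Hypothesis lambda0 : 0 < lambda.
Hypothesis f_dissipative :
  forall y z, (y - z) * (f y - f z) <= - lambda * `|y - z| ^+ 2.
Variable x : R -> R.
Hypothesis cx : continuous x.
Hypothesis x_0 : x 0 = x0.
Hypothesis dx : forall t : R, 0 < t -> is_derive t 1 x (f (x t) + kappa (x t)).
Variables (c1 : R) (n : nat).
Hypothesis c10 : 0 <= c1.
Hypothesis growth : forall u z, 0 <= u ->
  `|f (x u + z) - f (x u)| + lambda * `|z| <= c1 * ((1 + `|z|) ^+ n * `|z|).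
Variables (L B : R).
Hypothesis L0 : 0 <= L.
Hypothesis L_lt : L <= lambda / 2.
Hypothesis B0 : 0 <= B.
Hypothesis kappa_lip : forall y z, `|kappa y - kappa z| <= L * `|y - z|.
Hypothesis x_lip : forall s t, 0 <= s -> s <= t -> `|x t - x s| <= B * (t - s).

Local Notation Xe := (ext X).
Local Notation S := (step_const gam lambda c1 n).

Let node (u : R) : R := delta * (Num.truncn (u * delta^-1))%:R.

Let node_itv u : 0 <= u -> [/\ 0 <= node u, node u <= u & u <= node u + delta].
Proof.
move=> u0.
have ud : 0 <= u * delta^-1 by rewrite mulr_ge0// invr_ge0 ltW.
have /andP[a b] := truncn_itv ud.
rewrite /node; split; first by rewrite mulr_ge0// ltW.
  by rewrite mulrC -ler_pdivlMr.
have -> : delta * (Num.truncn (u * delta^-1))%:R + delta =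
  (Num.truncn (u * delta^-1)).+1%:R * delta by rewrite -natr1; ring.
by rewrite -ler_pdivrMr// ltW.
Qed.

(** The error at the last grid point before [u]. It is a step process in [u], and its moments are
    bounded by the same supremum as those of the error. *)
Let gap (u : R) (w : T) : R := `|Xe (node u) w - x (node u)|.

Let gap_jointly_measurable : jointly_measurable gap.
Proof.
apply: (@jointly_measurable_step _ _ _
  (fun k w => `|Xe (delta * k%:R) w - x (delta * k%:R)|)
  (fun u => Num.truncn (u * delta^-1))) => k.
  apply: measurableT_comp => //; apply: measurable_funB => //.
  exact: (ext_measurable sol).
by apply: measurable_truncn_eq; rewrite invr_gt0.
Qed.

Let gap_locally_bounded w : locally_bounded (gap^~ w).
Proof.
split; first exact: (jointly_measurable_section w gap_jointly_measurable).
move=> t.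
have bd : locally_bounded (fun u => Xe u w - x u).
  apply: continuous_locally_bounded => u.
  by apply: cvgB; [exact: (ext_continuous sol)|exact: cx].
have [_ /(_ t)[M hM]] := bd; exists M => u /andP[u0 ut].
have [h1 h2 _] := node_itv u0.
by rewrite /gap normr_id hM// h1 (le_trans h2).
Qed.

(* A first application of the one-step bound with [c = 2 gam] shows that the
   supremum [M] of the moments is finite; the second one, with the Lipschitz
   bound, gives [M <= (S + M) / 2]. *)
Lemma uniform_strong_error (t : R) (q : nat) : 0 <= t ->
  (\int[P]_w (`|Xe t w - x t| ^+ q.+1)%:E <=
   (S q.+1 * (eps ^+ q.+1 + (L * B * delta) ^+ q.+1))%:E)%E.
Proof.
set p := q.+1.
pose mom s := (\int[P]_w (`|Xe s w - x s| ^+ p)%:E)%E.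
have mom0 s : (0 <= mom s)%E.
  by apply: integral_ge0 => w _; rewrite lee_fin exprn_ge0.
have step := @strong_error_step _ _ _ P F f kappa sigma x0 eps delta W X sol
  eps0 eps1 delta0 cf ck cs gam gam0 kappa_le sigma_le lambda lambda0
  f_dissipative x cx x_0 dx c1 n c10 growth.
have crude s : 0 <= s -> (mom s <= ((S p * (eps ^+ p + (2 * gam) ^+ p) + 0) / 2)%:E)%E.
  move=> s0; apply: (step _ _ 0 (fun _ _ => 0)) => //.
  - by rewrite mulr_ge0// ltW.
  - exact: measurable_cst.
  - by move=> w; apply: continuous_locally_bounded; exact: cst_continuous.
  - move=> u w _; rewrite mulr0 addr0 (le_trans (ler_normB _ _))//.
    by have := kappa_le (ext X (grid_time delta u) w); have := kappa_le (x u);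
       rewrite /frozen; lra.
  - move=> u _; rewrite (eq_integral (fun=> 0%E)) ?integral0//.
    by move=> w _; rewrite expr0n.
pose sup := ereal_sup [set mom s | s in [set s | 0 <= s]].
have mom_sup s : 0 <= s -> (mom s <= sup)%E.
  by move=> s0; apply: ereal_sup_ubound; exists s.
have sup0 : (0 <= sup)%E by apply: le_trans (mom_sup 0 (lexx _)).
have sup_le C : (forall s, 0 <= s -> (mom s <= C)%E) -> (sup <= C)%E.
  by move=> h; apply: ge_ereal_sup => _ [s s0 <-]; exact: h.
have supfin : sup \is a fin_num.
  by rewrite ge0_fin_numE//; apply: le_lt_trans (sup_le _ crude) _; rewrite ltry.
pose M := fine sup.
have ME : sup = M%:E by rewrite fineK.
have M0 : 0 <= M by rewrite fine_ge0.
have contraction s : 0 <= s ->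
    (mom s <= ((S p * (eps ^+ p + (L * B * delta) ^+ p) + M) / 2)%:E)%E.
  move=> s0; apply: (step _ _ M gap) => //.
  - by rewrite !mulr_ge0// ltW.
  - by move=> u w; rewrite /gap.
  - move=> u w u0; have [h1 h2 h3] := node_itv u0.
    rewrite frozenE//; rewrite -/(node u).
    (* Splitting at [x (node u)] leaves the increment over a grid cell to the Lipschitz path [x];
       increments of [X] do not occur. *)
    have -> : kappa (Xe (node u) w) - kappa (x u) =
      (kappa (Xe (node u) w) - kappa (x (node u))) +
      (kappa (x (node u)) - kappa (x u)) by ring.
    rewrite (le_trans (ler_normD _ _))// addrC lerD//.
      rewrite distrC (le_trans (kappa_lip _ _))// -mulrA ler_wpM2l//.
      rewrite (le_trans (x_lip h1 h2))// ler_wpM2l//; lra.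
    by rewrite (le_trans (kappa_lip _ _))// ler_wpM2r.
  - move=> u /andP[u0 _]; have [h1 _ _] := node_itv u0.
    by rewrite -ME; exact: (mom_sup _ h1).
move=> t0; apply: le_trans (mom_sup _ t0) _; rewrite ME lee_fin.
(* Since [M] is a real number, [M / 2] can be subtracted from both sides. *)
have := sup_le _ contraction; rewrite ME lee_fin ler_pdivlMr//; lra.
Qed.

End uniform_strong_error.

Theorem theorem2p5 (R : realType) (f kappa sigma : R -> R) (x0 : R)
    (hA1 : assumption_A1 f kappa sigma) (hA2 : assumption_A2 kappa sigma)
    (hsde : forall eps delta : R, 0 < eps -> 0 < delta ->
       unique_weak_solution f kappa sigma x0 eps delta)
    (x : R -> R) (hx : ode_solution f kappa x0 x)
    (p : nat) (hp : (1 <= p)%N) :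
  exists2 C : R, 0 < C &
  exists2 r : R, 0 < r &
  forall eps delta : R, 0 < eps < r -> 0 < delta < r ->
  forall (d : measure_display) (T : measurableType d) (P : probability T R)
         (F : R -> set (set T)) (W X : R -> T -> R),
    weak_solution P F f kappa sigma x0 eps delta W X ->
    (ereal_sup [set 'E_P[fun w => (`|X t w - x t| ^+ p)%R] | t in `[0%R, +oo[] <=
      (C * (delta ^+ p + eps ^+ p + delta `^ (p%:R / 2) * eps ^+ p))%:E)%E.
Proof.
case: hA1 => q [xi [m [Lk [Ls [lambda [[q0 xi0 m0] f_lip [k_lip s_lip] [lambda0 f_dis] Lk_lt]]]]]].
case: hA2 => gamma bnd; case: hx => x_0 xc dx.
case: p hp => [//|p' _]; set p := p'.+1.
(* The added 1 makes the bound positive, so that the scale [v] of the increments can be divided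
   by. *)
pose gam : R := `|gamma| + 1.
have gam0 : 0 < gam by rewrite ltr_wpDl.
have bnd' y : `|sigma y| + `|kappa y| <= gam.
  by rewrite (le_trans (bnd y))// (le_trans (ler_norm _))// lerDl.
have kappa_le y : `|kappa y| <= gam by rewrite (le_trans _ (bnd' y))// lerDr.
have sigma_le y : `|sigma y| <= gam by rewrite (le_trans _ (bnd' y))// lerDl.
have Lk0 : 0 <= Lk.
  by have := k_lip 1 0; rewrite subr0 normr1 mulr1; exact: le_trans.
have cf := polynomial_lipschitz_continuous q0 xi0 f_lip.
have ck := lipschitz_continuous k_lip.
have cs := lipschitz_continuous s_lip.
pose y (t : R) : R := x (Num.max 0 t).
have cy : continuous y by exact: continuous_max0.
have dy (t : R) : 0 < t -> is_derive t 1 y (f (y t) + kappa (y t)).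
  by move=> t0; rewrite {2 3}/y max_r ?ltW//; apply: is_derive_max0 => //; exact: dx.
have y_0 : y 0 = x0 by rewrite /y maxxx.
pose K := ode_radius f y lambda gam.
have yK (t : R) : 0 <= t -> `|y t| <= K.
  by move=> t0; exact: (ode_bounded lambda0 f_dis kappa_le cy dy t0).
have [c1 [n [c10 growth]]] :=
  polynomial_growth q0 xi0 m0 lambda0 f_lip yK.
pose S := step_const gam lambda c1 n p.
have S0 : 0 <= S by exact: step_const_ge0.
pose B := ode_speed f y lambda gam q xi m.
have yB (s t : R) : 0 <= s -> s <= t -> `|y t - y s| <= B * (t - s).
  by move=> s0 st; exact: (ode_lipschitz lambda0 f_dis kappa_le cy dy q0 xi0 f_lip s0 st).
have B0 : 0 <= B.
  by have := yB 0 1 (lexx _) ler01; rewrite subr0 mulr1; exact: le_trans.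
(* [S] is the coefficient of [eps ^+ p] in the error bound and [S * (Lk * B) ^+ p] that of
   [delta ^+ p]; the final 1 gives positivity. *)
exists (S * (1 + (Lk * B) ^+ p) + 1).
  by rewrite ltr_wpDl// mulr_ge0// addr_ge0// exprn_ge0// mulr_ge0.
(* The threshold 1 supplies [eps <= 1], by which higher powers of [eps] are absorbed. *)
exists 1 => // eps delta /andP[eps0 eps1] /andP[delta0 _] d T P F W X sol.
apply: ge_ereal_sup => _ [t t0 <-]; move: t0; rewrite /= in_itv/= andbT => t0.
rewrite unlock.
have Lk2 : Lk <= lambda / 2 by lra.
have err := uniform_strong_error sol eps0 (ltW eps1) delta0 cf ck cs gam0 kappa_le
  sigma_le lambda0 f_dis cy y_0 dy c10 growth Lk0 Lk2 B0 k_lip yB p' t0.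
have -> : (fun w => (`|X t w - x t| ^+ p)%:E) = (fun w => (`|ext X t w - y t| ^+ p)%:E).
  by apply/funext => w; rewrite /ext /y max_r.
apply: (le_trans err); rewrite lee_fin -/p -/S.
have ep : 0 <= eps ^+ p by rewrite exprn_ge0// ltW.
have dp : 0 <= delta ^+ p by rewrite exprn_ge0// ltW.
have dep : 0 <= delta `^ (p%:R / 2) * eps ^+ p by rewrite mulr_ge0 ?powR_ge0.
have LBp : 0 <= (Lk * B) ^+ p by rewrite exprn_ge0// mulr_ge0.
rewrite exprMn; set l := (Lk * B) ^+ p; set e := eps ^+ p; set de := delta ^+ p.
set r := delta `^ _ * _.
have -> : (S * (1 + l) + 1) * (de + e + r) = S * (e + l * de) +
  (S * de + S * l * e + de + e + (S * (1 + l) + 1) * r) by ring.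
rewrite lerDl.
have a1 : 0 <= S * de := mulr_ge0 S0 dp.
have a2 : 0 <= S * l * e := mulr_ge0 (mulr_ge0 S0 LBp) ep.
have a3 : 0 <= (S * (1 + l) + 1) * r.
  exact: (mulr_ge0 (addr_ge0 (mulr_ge0 S0 (addr_ge0 ler01 LBp)) ler01) dep).
by rewrite !addr_ge0.
Qed.
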